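(* For $0<\alpha<1$ let $B_\alpha$ be the operator in the space $\mathcal P$ given by $$B_\alpha f(x)=-\frac1{\pi x}\int_0^\infty\operatorname{Im}\Bigl\{\mathbb L_{\alpha,1}\bigl(x^{-\alpha}y\,e^{i\pi\alpha}\bigr)\Bigr\}f(y)\,dy,\qquad x>0.$$ Then, as operators in $\mathcal P$, for all $\alpha,\beta\in(0,1)$ and $h\in\mathbb C$, $$B_\alpha B_\beta=B_{\alpha\beta},\qquad B_\alpha J_h=J_{h\alpha}B_\alpha .$$
   Context: For $0<\alpha<1$, $\mathbb L_{\alpha,1}(z)=\sum_{n=0}^\infty\frac{(-1)^n\Gamma(\alpha n+1)}{n!}z^n$, $z\in\mathbb C$ (an entire function). $\mathcal P$ is the space of $C^\infty$-functions $f$ on the half-line $x\ge0$ such that $f^{(k)}(0)=0$ for all $k\ge0$ and $\lim_{x\to+\infty}f^{(m)}(x)e^{-\varepsilon x}=0$ for all $\varepsilon>0$, $m\ge0$. The value of $B_\alpha f$ at $x=0$ is defined by continuity. $J_r$ is the Riemann–Liouville fractional integration in $\mathcal P$: for $\operatorname{Re} r>0$, $$J_rf(x)=\frac1{\Gamma(r)}\int_0^xf(y)(x-y)^{r-1}\,dy,$$ and for other $r\in\mathbb C$, $J_rf(x)$ is defined by holomorphic continuation in $r$ for fixed $f$ and $x$ (so $J_{-n}=d^n/dx^n$ for integers $n\geq 0$). *)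

(* Defs.v *)
From HB Require Import structures.
From mathcomp Require Import all_boot all_order all_algebra.
From mathcomp Require Import all_classical all_reals all_analysis.
From mathcomp Require Import complex.

Set Implicit Arguments.
Unset Strict Implicit.
Unset Printing Implicit Defensive.

Import Order.TTheory GRing.Theory Num.Theory.
Import numFieldNormedType.Exports.

Local Open Scope classical_set_scope.
Local Open Scope ring_scope.
Local Open Scope complex_scope.

(* The complex numbers over R, as R[i]^o so that they carry the topology of
   the norm `|z| and the structure of normed module over themselves. *)
Notation Cplx R := (R[i]^o).

Section ComplexFunctions.
Variable R : realType.
Implicit Types (z w : Cplx R) (t x : R).

Definition cexp z : Cplx R :=
  (expR (complex.Re z) * cos (complex.Im z))
    +i* (expR (complex.Re z) * sin (complex.Im z)).

(* t ^ w := exp (w ln t), meaningful for t > 0. *)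
Definition cpow t w : Cplx R := cexp (w * (ln t)%:C).

Definition cintegrable (D : set R) (f : R -> Cplx R) : Prop :=
  (@lebesgue_measure R).-integrable D (fun t => (complex.Re (f t))%:E) /\
  (@lebesgue_measure R).-integrable D (fun t => (complex.Im (f t))%:E).

Definition cintegral (D : set R) (f : R -> Cplx R) : Cplx R :=
  (\int[@lebesgue_measure R]_(t in D) complex.Re (f t))
    +i* (\int[@lebesgue_measure R]_(t in D) complex.Im (f t)).

(* Euler's integral, meaningful for Re z > 0. *)
Definition Gamma z : Cplx R :=
  cintegral `]0, +oo[ (fun t => cpow t (z - 1) * (expR (- t))%:C).

(* Derivability over the field R[i] itself, i.e. in the complex sense. *)
Definition entire (F : Cplx R -> Cplx R) : Prop := forall z, derivable F z 1.

Definition L_alpha1 (alpha : R) z : Cplx R :=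
  limn (series (fun n : nat =>
    (-1) ^+ n * Gamma ((alpha * n%:R + 1)%:C) / (n`!)%:R * z ^+ n)).

End ComplexFunctions.

Section HalfLine.
Variable R : realType.
Implicit Types (f : R -> Cplx R) (x : R).

(* Functions on the half-line x >= 0 are functions on R of which only the
   values at x >= 0 matter; the derivative is taken inside the half-line, so it
   is one-sided at 0. *)
Definition hquot f x (y : R) : Cplx R := ((y - x)^-1)%:C * (f y - f x).

Definition hderivable f x : Prop :=
  cvg (hquot f x @ within `[0, +oo[ x^').

Definition hderive f x : Cplx R :=
  lim (hquot f x @ within `[0, +oo[ x^').

Definition hderiven (n : nat) f : R -> Cplx R := iter n hderive f.

Definition spaceP f : Prop :=
  [/\ forall (n : nat) x, 0 <= x -> hderivable (hderiven n f) x,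
      forall n : nat, hderiven n f 0 = 0
    & forall (e : R) (m : nat), 0 < e ->
        (hderiven m f x * (expR (- (e * x)))%:C) @[x --> +oo] --> (0 : Cplx R)].

Definition eq_opP (S T : (R -> Cplx R) -> R -> Cplx R) : Prop :=
  forall f, spaceP f -> forall x, 0 <= x -> S f x = T f x.

Definition B_integrand (alpha : R) f x (y : R) : Cplx R :=
  (complex.Im (L_alpha1 alpha
     ((x `^ (- alpha) * y)%:C * cexp ('i * (pi * alpha)%:C))))%:C * f y.

Definition B_formula (alpha : R) f x : Cplx R :=
  - ((pi * x)^-1)%:C * cintegral `[0, +oo[ (B_integrand alpha f x).

Definition B (alpha : R) f x : Cplx R :=
  if 0 < x then B_formula alpha f x
  else lim (B_formula alpha f t @[t --> 0^'+]).

Definition J_formula (r : Cplx R) f x : Cplx R :=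
  (Gamma r)^-1 * cintegral `]0, x[ (fun y => f y * cpow (x - y) (r - 1)).

Definition is_J_continuation f x (F : Cplx R -> Cplx R) : Prop :=
  entire F /\ forall r : Cplx R, 0 < complex.Re r -> F r = J_formula r f x.

(* The continuation, when it exists, is unique by the identity theorem; xget
   selects it. *)
Definition J (r : Cplx R) f x : Cplx R :=
  if 0 < complex.Re r then J_formula r f x
  else xget (fun=> 0) [set F | is_J_continuation f x F] r.

(* B alpha and J r are well-defined maps from spaceP to spaceP. *)
Definition B_acts_in_P (alpha : R) : Prop :=
  forall f, spaceP f ->
    (forall x, 0 < x -> cintegrable `[0, +oo[ (B_integrand alpha f x)) /\
    spaceP (B alpha f).

Definition J_acts_in_P (r : Cplx R) : Prop :=
  forall f, spaceP f ->
    (forall x, 0 <= x -> exists F, is_J_continuation f x F) /\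
    spaceP (J r f).

End HalfLine.

(* Main.v *)
Require Import Defs.
From mathcomp Require Import all_boot all_order all_algebra.
From mathcomp Require Import all_classical all_reals all_analysis.
From mathcomp Require Import measurable_realfun.
From mathcomp Require Import complex ring lra.

(** The Laplace transform [lap] identifies the space P with the functions F that
    are holomorphic on Re p > 0 and rapidly decreasing on every half-plane
    Re p >= s > 0 (the class [sym]); its inverse [iL] is the Bromwich integral
    over Re p = 1.  Under this identification J_r is multiplication by p^(-r) and
    B_alpha is the substitution p |-> p^alpha, so that the two identities become
    (p^alpha)^beta = p^(alpha beta) and (p^alpha)^(-h) = p^(- h alpha).

    For J_r with Re r > 0 this is the formula
      Gamma(r) p^(-r) = int_0^oo t^(r-1) e^(-pt) dt
    and Fubini's theorem; for fixed x, r |-> iL (p^(-r) F) x is entire, so it is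
    the continuation, which is unique by the identity theorem.  For B_alpha one has
      L(z) = int_0^oo exp(- t - z t^alpha) dt,
    and for z = x^(-alpha) y e^(i pi alpha) rotating the ray of integration
    arg t = pi into arg t = pi / 2 turns - Im L(z) / (pi x) into
      (2 i pi)^(-1) int_(Re p = 1) exp(x p - y p^alpha) dp. *)

Set Implicit Arguments.
Unset Strict Implicit.
Unset Printing Implicit Defensive.

Import Order.TTheory GRing.Theory Num.Theory.
Import numFieldNormedType.Exports.

Local Open Scope classical_set_scope.
Local Open Scope ring_scope.
Local Open Scope complex_scope.

Local Notation Re := complex.Re.
Local Notation Im := complex.Im.

(** * Modulus and exponential of complex numbers *)

Section Cabs.
Variable R : realType.
Implicit Types (z w : Cplx R) (x : R).

(** The obstacle is the interchange of the Bromwich integral with the integral over y in B_alpha.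
    The factor exp(- y p^alpha) decays only like exp(- c y |p|^alpha), a rate that degenerates as y
    -> 0, so it gives no joint majorant by itself. Flatness of f at 0 supplies the missing decay:
    |f(y)| <= C y^N e^(e y) for every N, and y^N exp(- c y |p|^alpha / 2) is O(|p|^(- alpha N)). The
    same flatness makes the extension of f by zero smooth, whence the rapid decay of its Laplace
    transform. The rotated ray is only the upper half of the imaginary axis, which moreover bounds
    the half-plane where the logarithm is defined. The lower half is its complex conjugate, which is
    why an imaginary part of L appears, and the axis is reached as a limit of lines Re p = s with s
    -> 0. The bound alpha < 1 keeps |arg p^alpha| below pi/2, so principal powers compose without a
    jump. Dividing by Gamma(r) in J_r needs Gamma(r) <> 0, which is drawn from the injectivity of
    the Laplace transform. *)

Definition cabs z : R := Normc.normc z.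

Lemma normE z : `|z| = (cabs z)%:C :> Cplx R. Proof. by []. Qed.

Lemma cabs_ge0 z : 0 <= cabs z.
Proof. by case: z => a b; exact: sqrtr_ge0. Qed.

Lemma cabs0 : cabs 0 = 0. Proof. exact: Normc.normc0. Qed.
Lemma cabs1 : cabs 1 = 1. Proof. exact: Normc.normc1. Qed.
Lemma cabsM z w : cabs (z * w) = cabs z * cabs w. Proof. exact: Normc.normcM. Qed.
Lemma cabsV z : cabs z^-1 = (cabs z)^-1. Proof. exact: Normc.normcV. Qed.
Lemma cabsN z : cabs (- z) = cabs z. Proof. exact: normcN. Qed.
Lemma cabsD z w : cabs (z + w) <= cabs z + cabs w. Proof. exact: le_normcD. Qed.
Lemma cabsB z w : cabs (z - w) <= cabs z + cabs w.
Proof. by rewrite -(cabsN w) cabsD. Qed.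
Lemma cabsX z n : cabs (z ^+ n) = cabs z ^+ n.
Proof. by elim: n => [|n ih]; rewrite ?cabs1// !exprS cabsM ih. Qed.
Lemma cabs_distC z w : cabs (z - w) = cabs (w - z).
Proof. by rewrite -cabsN opprB. Qed.
Lemma cabs_eq0 z : (cabs z == 0) = (z == 0).
Proof.
by apply/eqP/eqP => [/Normc.eq0_normc//|->]; rewrite cabs0.
Qed.
Lemma cabs_gt0 z : (0 < cabs z) = (z != 0).
Proof. by rewrite lt_def cabs_ge0 andbT cabs_eq0. Qed.

Lemma cabs_real x : cabs x%:C = `|x|.
Proof. by rewrite /cabs /= expr0n /= addr0 sqrtr_sqr. Qed.

Lemma cabs_i : cabs 'i = 1.
Proof. by rewrite /cabs /= expr0n expr1n /= add0r sqrtr1. Qed.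

Lemma cabs_sqr z : cabs z ^+ 2 = Re z ^+ 2 + Im z ^+ 2.
Proof. by case: z => a b; rewrite /cabs/= sqr_sqrtr// addr_ge0 ?sqr_ge0. Qed.

Lemma Re_le_cabs z : `|Re z| <= cabs z.
Proof.
rewrite -[leRHS]ger0_norm ?cabs_ge0// -sqrtr_sqr -[leRHS]sqrtr_sqr.
by rewrite ler_wsqrtr// cabs_sqr lerDl sqr_ge0.
Qed.

Lemma Im_le_cabs z : `|Im z| <= cabs z.
Proof.
rewrite -[leRHS]ger0_norm ?cabs_ge0// -sqrtr_sqr -[leRHS]sqrtr_sqr.
by rewrite ler_wsqrtr// cabs_sqr lerDr sqr_ge0.
Qed.

Lemma ReD z w : Re (z + w) = Re z + Re w.
Proof. by case: z; case: w. Qed.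
Lemma ImD z w : Im (z + w) = Im z + Im w.
Proof. by case: z; case: w. Qed.
Lemma ReN z : Re (- z) = - Re z. Proof. by case: z. Qed.
Lemma ImN z : Im (- z) = - Im z. Proof. by case: z. Qed.
Lemma ReB z w : Re (z - w) = Re z - Re w.
Proof. by rewrite ReD ReN. Qed.
Lemma ImB z w : Im (z - w) = Im z - Im w.
Proof. by rewrite ImD ImN. Qed.
Lemma ReM z w : Re (z * w) =
  Re z * Re w - Im z * Im w.
Proof. by case: z; case: w. Qed.
Lemma ImM z w : Im (z * w) =
  Re z * Im w + Im z * Re w.
Proof. by case: z; case: w. Qed.
Lemma ReMr x z : Re (x%:C * z) = x * Re z.
Proof. by rewrite ReM /= mul0r subr0. Qed.
Lemma ImMr x z : Im (x%:C * z) = x * Im z.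
Proof. by rewrite ImM /= mul0r addr0. Qed.

Lemma cplx_ext z w : Re z = Re w -> Im z = Im w ->
  z = w.
Proof. by case: z => a b; case: w => c d /= -> ->. Qed.

Lemma cplx_gt0 z : 0 < z -> z = (Re z)%:C /\ 0 < Re z.
Proof.
case: z => a b; rewrite ltcE /= => /andP[/eqP -> a0]; by split.
Qed.

Lemma cabs_le z : cabs z <= `|Re z| + `|Im z|.
Proof.
have -> : z = (Re z)%:C + 'i * (Im z)%:C.
  by apply: cplx_ext; rewrite ?ReD ?ImD ?ReM ?ImM /=; ring.
apply: le_trans (cabsD _ _) _.
by rewrite cabsM cabs_i mul1r !cabs_real ?ReD ?ImD ?ReM ?ImM /= !(mul0r, mul1r, mulr0, subr0, addr0, add0r, mulr1).
Qed.

Lemma cabs_dist_le z w : `|cabs z - cabs w| <= cabs (z - w).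
Proof.
have h a b : cabs a - cabs b <= cabs (a - b).
  by rewrite lerBlDr; apply: le_trans (cabsD _ _); rewrite subrK.
rewrite ler_norml h andbT lerNl opprB; apply: le_trans (h _ _) _.
by rewrite cabs_distC.
Qed.

Lemma cabs_Re_ge z : Re z <= cabs z.
Proof. exact: le_trans (ler_norm _) (Re_le_cabs _). Qed.

(** Multiplication by c turns a bound on a modulus into a bound on a real part. The mean value
    inequality and the triangle inequality for integrals are reduced to the real case in this
    way. *)
Lemma cabs_rot z : exists c, cabs c <= 1 /\ c * z = (cabs z)%:C.
Proof.
have [->|z0] := eqVneq z 0.
  by exists 0; rewrite cabs0 mul0r ler01.
exists ((cabs z)%:C / z); split; last by rewrite divfK.
by rewrite cabsM cabsV cabs_real ger0_norm ?cabs_ge0// divff// cabs_eq0.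
Qed.

Lemma realCV x : (x^-1)%:C = (x%:C)^-1 :> Cplx R.
Proof. exact: fmorphV. Qed.

Lemma cexpD z w : cexp (z + w) = cexp z * cexp w.
Proof.
by case: z => a b; case: w => c d; rewrite /cexp; apply: cplx_ext;
 rewrite ?ReM ?ImM /= expRD ?cosD ?sinD; ring.
Qed.

Lemma cexp0 : cexp 0 = 1 :> Cplx R.
Proof. by rewrite /cexp /= expR0 cos0 sin0 mulr1 mulr0. Qed.

Lemma cabs_cexp z : cabs (cexp z) = expR (Re z).
Proof.
apply/eqP; rewrite -(@eqrXn2 _ 2) ?cabs_ge0 ?expR_ge0//.
rewrite cabs_sqr /cexp /= !exprMn -mulrDr cos2Dsin2 mulr1//.
Qed.

Lemma cexp_neq0 z : cexp z != 0.
Proof. by rewrite -cabs_gt0 cabs_cexp expR_gt0. Qed.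

Lemma cexpX z n : cexp z ^+ n = cexp (n%:R * z).
Proof.
elim: n => [|n ih]; first by rewrite mul0r cexp0.
by rewrite exprS ih -cexpD; congr cexp; rewrite -natr1; ring.
Qed.

Lemma cexp_real x : cexp x%:C = (expR x)%:C.
Proof. by rewrite /cexp /= cos0 sin0 mulr1 mulr0. Qed.

End Cabs.
Arguments cabs : simpl never.
Arguments cexp : simpl never.

(** * Complex derivatives *)

Section Deriv.
Variable R : realType.
Local Notation C := (Cplx R).
Implicit Types (S : set C) (F G : C -> C) (z l m : C) (x : R).

(* Derivative at z along the increments in S: S = setT gives the complex
   derivative, and S = the reals the derivative of a curve. *)
Definition hasd S F z l := forall e : R, 0 < e -> exists2 d : R, 0 < d &
  forall u, S u -> cabs u < d -> cabs (F (z + u) - F z - l * u) <= e * cabs u.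

Definition cderiv F z l := hasd setT F z l.
Definition rderiv (G : R -> C) x l :=
  hasd [set u | Im u = 0] (G \o @complex.Re R) x%:C l.

Lemma hasd_bnd S F z l : hasd S F z l -> exists2 d : R, 0 < d &
  forall u, S u -> cabs u < d -> cabs (F (z + u) - F z) <= (cabs l + 1) * cabs u.
Proof.
move=> /(_ 1 ltr01)[d d0 h]; exists d => // u Su ud.
have := h u Su ud; rewrite mul1r => h1.
rewrite -(subrK (l * u) (F (z + u) - F z)); apply: le_trans (cabsD _ _) _.
by rewrite mulrDl mul1r addrC cabsM lerD.
Qed.

Lemma hasd_cont S F z l : hasd S F z l -> forall e : R, 0 < e ->
  exists2 d : R, 0 < d &
  forall u, S u -> cabs u < d -> cabs (F (z + u) - F z) <= e.
Proof.
move=> /hasd_bnd[d d0 h] e e0.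
have l0 : 0 < cabs l + 1 by rewrite ltr_wpDl ?cabs_ge0.
exists (Num.min d (e / (cabs l + 1))); first by rewrite lt_min d0 divr_gt0.
move=> u Su; rewrite lt_min => /andP[ud ue]; apply: le_trans (h u Su ud) _.
by rewrite mulrC -ler_pdivlMr// ltW.
Qed.

Lemma hasd_ext S F G z l (d0 : R) : 0 < d0 ->
  F z = G z -> (forall u, S u -> cabs u < d0 -> F (z + u) = G (z + u)) ->
  hasd S F z l -> hasd S G z l.
Proof.
move=> d00 FGz FG h e /h[d d1 hd]; exists (Num.min d d0); rewrite ?lt_min ?d00 ?d1// => u Su.
by rewrite lt_min => /andP[ud ud0]; rewrite -FG// -FGz; exact: hd.
Qed.

Lemma hasd_cst S (a : C) z : hasd S (fun=> a) z 0.
Proof.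
move=> e e0; exists 1 => // u _ _.
by rewrite mul0r subrr subr0 cabs0 mulr_ge0 ?cabs_ge0// ltW.
Qed.

Lemma hasd_id S z : hasd S id z 1.
Proof.
move=> e e0; exists 1 => // u _ _.
by rewrite mul1r [z + u]addrC addrK subrr cabs0 mulr_ge0 ?cabs_ge0// ltW.
Qed.

Lemma hasd_eql S F z l m : l = m -> hasd S F z l -> hasd S F z m.
Proof. by move=> ->. Qed.

Lemma hasdD S F G z l m : hasd S F z l -> hasd S G z m ->
  hasd S (fun w => F w + G w) z (l + m).
Proof.
move=> hF hG e e0; have e2 : 0 < e / 2 by rewrite divr_gt0.
have [d d0 hd] := hF _ e2; have [d' d0' hd'] := hG _ e2.
exists (Num.min d d'); first by rewrite lt_min d0.
move=> u Su; rewrite lt_min => /andP[ud ud'].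
have -> : F (z + u) + G (z + u) - (F z + G z) - (l + m) * u =
  (F (z + u) - F z - l * u) + (G (z + u) - G z - m * u) by ring.
apply: le_trans (cabsD _ _) _; rewrite [e]splitr mulrDl.
by rewrite lerD ?hd ?hd'.
Qed.

Lemma hasdM S F G z l m : hasd S F z l -> hasd S G z m ->
  hasd S (fun w => F w * G w) z (l * G z + F z * m).
Proof.
move=> hF hG e e0.
have [d1 d10 h1] := hasd_bnd hF.
pose K := cabs l + 1; have K0 : 0 < K by rewrite ltr_wpDl ?cabs_ge0.
pose A := cabs (F z) + 1; have A0 : 0 < A by rewrite ltr_wpDl ?cabs_ge0.
pose B := cabs (G z) + 1; have B0 : 0 < B by rewrite ltr_wpDl ?cabs_ge0.
have eA : 0 < e / 3 / A by rewrite !divr_gt0.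
have eB : 0 < e / 3 / B by rewrite !divr_gt0.
have eK : 0 < e / 3 / K by rewrite !divr_gt0.
have [d2 d20 h2] := hG _ eA.
have [d3 d30 h3] := hF _ eB.
have [d4 d40 h4] := hasd_cont hG eK.
exists (Num.min (Num.min d1 d2) (Num.min d3 d4)); first by rewrite !lt_min d10 d20 d30.
move=> u Su; rewrite !lt_min => /andP[/andP[u1 u2] /andP[u3 u4]].
have -> : F (z + u) * G (z + u) - F z * G z - (l * G z + F z * m) * u =
  F z * (G (z + u) - G z - m * u) + (F (z + u) - F z - l * u) * G z
  + (F (z + u) - F z) * (G (z + u) - G z) by ring.
have u0 := cabs_ge0 u.
apply: le_trans (cabsD _ _) _.
apply: (@le_trans _ _ (e / 3 * cabs u + e / 3 * cabs u + e / 3 * cabs u)); last first.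
  by rewrite le_eqVlt; apply/orP; left; apply/eqP; field.
apply: lerD.
  apply: le_trans (cabsD _ _) _; rewrite !cabsM; apply: lerD.
    apply: (@le_trans _ _ (A * (e / 3 / A * cabs u))); last first.
      by rewrite mulrA [A * _]mulrC divfK// gt_eqF.
    by rewrite ler_pM ?cabs_ge0 ?h2// /A lerDl.
  apply: (@le_trans _ _ ((e / 3 / B * cabs u) * B)); last first.
    by rewrite mulrAC divfK// gt_eqF.
  by rewrite ler_pM ?cabs_ge0 ?h3// /B lerDl.
rewrite cabsM.
apply: (@le_trans _ _ ((K * cabs u) * (e / 3 / K))); last first.
  by rewrite mulrC mulrA divfK// gt_eqF.
by rewrite ler_pM ?cabs_ge0// ?h1 ?h4.
Qed.

Lemma hasd_comp S F G z l m : cderiv F (G z) l -> hasd S G z m ->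
  hasd S (F \o G) z (l * m).
Proof.
move=> hF hG e e0.
have [d1 d10 h1] := hasd_bnd hG.
pose K := cabs m + 1; have K0 : 0 < K by rewrite ltr_wpDl ?cabs_ge0.
pose L := cabs l + 1; have L0 : 0 < L by rewrite ltr_wpDl ?cabs_ge0.
have eL : 0 < e / 2 / L by rewrite !divr_gt0.
have eK : 0 < e / 2 / K by rewrite !divr_gt0.
have [d2 d20 h2] := hF _ eK.
have [d3 d30 h3] := hG _ eL.
exists (Num.min (Num.min d1 (d2 / K)) d3).
  by rewrite !lt_min d10 divr_gt0//=.
move=> u Su; rewrite !lt_min => /andP[/andP[u1 u2] u3] /=.
pose v := G (z + u) - G z.
have Gv : G (z + u) = G z + v by rewrite /v; ring.
have vK : cabs v <= K * cabs u by exact: h1.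
have vd : cabs v < d2.
  by apply: le_lt_trans vK _; rewrite mulrC -ltr_pdivlMr.
have -> : F (G (z + u)) - F (G z) - l * m * u =
  (F (G z + v) - F (G z) - l * v) + l * (v - m * u) by rewrite Gv; ring.
apply: le_trans (cabsD _ _) _; rewrite [e]splitr mulrDl; apply: lerD.
  apply: le_trans (h2 v I vd) _.
  apply: (@le_trans _ _ (e / 2 / K * (K * cabs u))).
    by rewrite ler_wpM2l// ltW.
  by rewrite mulrA divfK// gt_eqF.
rewrite cabsM; apply: (@le_trans _ _ (L * (e / 2 / L * cabs u))).
  by rewrite ler_pM ?cabs_ge0// ?h3// /L lerDl.
by rewrite mulrA [L * _]mulrC divfK// gt_eqF.
Qed.

Lemma hasdN S F z l : hasd S F z l -> hasd S (fun w => - F w) z (- l).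
Proof.
move=> h; have := hasdM (hasd_cst S (-1) z) h.
rewrite mul0r add0r mulN1r; apply: (hasd_ext (d0 := 1)) => //.
- by rewrite mulN1r.
- by move=> u _ _; rewrite mulN1r.
Qed.

Lemma hasdZ S F z l a : hasd S F z l -> hasd S (fun w => a * F w) z (a * l).
Proof. by move=> h; have := hasdM (hasd_cst S a z) h; rewrite mul0r add0r. Qed.

Lemma hasdB S F G z l m : hasd S F z l -> hasd S G z m ->
  hasd S (fun w => F w - G w) z (l - m).
Proof. by move=> hF hG; exact: hasdD (hasdN hG). Qed.

Lemma hasd_sum S n (F : 'I_n -> C -> C) z (l : 'I_n -> C) :
  (forall i, hasd S (F i) z (l i)) ->
  hasd S (fun w => \sum_(i < n) F i w) z (\sum_(i < n) l i).
Proof.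
elim: n F l => [|n ih] F l h.
  rewrite big_ord0; apply: (hasd_ext (d0 := 1)) (hasd_cst S 0 z) => //.
  - by rewrite big_ord0.
  - by move=> u _ _; rewrite big_ord0.
rewrite big_ord_recr/=; apply: (hasd_ext (d0 := 1)) => //; last first.
- apply: hasdD; last exact: (h ord_max).
  by apply: ih => i; exact: (h (widen_ord (leqnSn n) i)).
- by move=> u _ _; rewrite big_ord_recr.
- by rewrite big_ord_recr.
Qed.

Lemma hasdX S F z l n : hasd S F z l ->
  hasd S (fun w => F w ^+ n.+1) z (n.+1%:R * F z ^+ n * l).
Proof.
move=> h; elim: n => [|n ih].
  by rewrite expr0 mulr1 mul1r; apply: (hasd_ext (d0 := 1)) h.
apply: hasd_eql (hasdM h ih).
have -> : n.+2%:R = n.+1%:R + 1 :> C by rewrite natr1.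
by rewrite !exprS; ring.
Qed.

End Deriv.

(** * Curves, the mean value inequality and Taylor's formula for exp *)

Section DerivLink.
Variable R : realType.
Local Notation C := (Cplx R).
Implicit Types (F : C -> C) (G g : R -> C) (z l : C) (x a b : R).

Lemma is_derive_epsP (f : R -> R) x (l : R) :
  (forall e, 0 < e -> exists2 d, 0 < d &
    forall h, `|h| < d -> `|f (x + h) - f x - l * h| <= e * `|h|) <->
  is_derive x 1 f l.
Proof.
split=> [H|[df Df] e e0].
  have cv : (h^-1 *: ((f \o shift x) (h *: 1) - f x)) @[h --> 0^'] --> l.
    apply/cvgrPdist_le => /= e e0; have [d d0 hd] := H e e0.
    near=> h.
    have h0 : h != 0 by near: h; exact: nbhs_dnbhs_neq.
    have ah : 0 < `|h| by rewrite normr_gt0.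
    have := hd h; rewrite [_ *: 1]mulr1 [h + x]addrC.
    have -> : l - h^-1 *: (f (x + h) - f x) = - h^-1 * (f (x + h) - f x - l * h).
      by rewrite /GRing.scale/=; field.
    rewrite normrM normrN normfV => /(_ _) hh.
    rewrite mulrC ler_pdivrMr//; apply: hh.
    by near: h; exact: dnbhs0_lt.
  by split; [apply/cvg_ex; exists l|exact: cvg_lim cv].
have cv : (h^-1 *: ((f \o shift x) (h *: 1) - f x)) @[h --> 0^'] --> l.
  by rewrite -Df; exact: df.
move/cvgrPdist_le : cv => /(_ e e0) /= /nbhs_ballP[d /= d0 hd].
exists d => // h hlt; have [->|h0] := eqVneq h 0.
  by rewrite addr0 subrr mulr0 subr0 normr0 mulr0.
have := hd h; rewrite /ball/= sub0r normrN => /(_ hlt h0).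
rewrite [_ *: 1]mulr1 [h + x]addrC.
have -> : l - h^-1 *: (f (x + h) - f x) = - h^-1 * (f (x + h) - f x - l * h).
  by rewrite /GRing.scale/=; field.
rewrite normrM normrN normfV => hh.
by rewrite -ler_pdivrMr ?normr_gt0// mulrC.
Unshelve. all: by end_near. Qed.

Lemma rderiv_epsP G x l : rderiv G x l <->
  (forall e, 0 < e -> exists2 d, 0 < d &
    forall h, `|h| < d -> cabs (G (x + h) - G x - l * h%:C) <= e * `|h|).
Proof.
split=> H e /H[d d0 hd]; exists d => // u.
  by move=> ud; have := hd u%:C erefl; rewrite cabs_real; exact.
move=> u0; have -> : u = (Re u)%:C :> C by case: u u0 => a b /= ->.
by rewrite cabs_real; exact: hd.
Qed.

Lemma rderivP G x l : rderiv G x l <->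
  is_derive x 1 (fun t => Re (G t)) (Re l) /\
  is_derive x 1 (fun t => Im (G t)) (Im l).
Proof.
split=> [/rderiv_epsP H|[/is_derive_epsP H1 /is_derive_epsP H2]].
  split; apply/is_derive_epsP => e /H[d d0 hd]; exists d => // h /hd.
  - apply: le_trans; apply: le_trans (Re_le_cabs _).
    by rewrite !ReB [l * _]mulrC ReMr [h * _]mulrC.
  - apply: le_trans; apply: le_trans (Im_le_cabs _).
    by rewrite !ImB [l * _]mulrC ImMr [h * _]mulrC.
apply/rderiv_epsP => e e0; have e2 : 0 < e / 2 by rewrite divr_gt0.
have [d d0 hd] := H1 _ e2; have [d' d0' hd'] := H2 _ e2.
exists (Num.min d d'); first by rewrite lt_min d0.
move=> h; rewrite lt_min => /andP[/hd r1 /hd' r2].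
apply: le_trans (cabs_le _) _; rewrite !ReB !ImB [l * _]mulrC ReMr ImMr.
by rewrite ![h * _]mulrC [e]splitr mulrDl lerD.
Qed.

Lemma rderiv_comp_cderiv F G x l m : cderiv F (G x) l -> rderiv G x m ->
  rderiv (F \o G) x (l * m).
Proof. by move=> hF hG; exact: (hasd_comp hF hG). Qed.

Lemma rderivM G g x l m : rderiv G x l -> rderiv g x m ->
  rderiv (fun t => G t * g t) x (l * g x + G x * m).
Proof. by move=> hF hG; exact: (hasdM hF hG). Qed.

Lemma rderiv_real x : rderiv (fun t => t%:C) x 1.
Proof.
by apply/rderivP; split => /=; [exact: is_derive_id|exact: is_derive_cst].
Qed.

Lemma rderiv_cont G x l : rderiv G x l ->
  {for x, continuous (fun t => Re (G t))} /\
  {for x, continuous (fun t => Im (G t))}.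
Proof.
move=> /rderivP[h1 h2]; split; apply: differentiable_continuous;
 apply/derivable1_diffP; [exact: (@ex_derive _ _ _ _ _ _ _ h1)|exact: (@ex_derive _ _ _ _ _ _ _ h2)].
Qed.

(** The real mean value theorem is applied to h - Re (c G), where c rotates G b - G a onto the
    positive real axis. *)
Lemma mvi G g (h h' : R -> R) a b : a <= b ->
  (forall t, a <= t <= b -> rderiv G t (g t)) ->
  (forall t, a <= t <= b -> is_derive t 1 h (h' t)) ->
  (forall t, a <= t <= b -> cabs (g t) <= h' t) ->
  cabs (G b - G a) <= h b - h a.
Proof.
rewrite le_eqVlt => /predU1P[->|ab] dG dh gh; first by rewrite !subrr cabs0.
have [c [c1 cG]] := cabs_rot (G b - G a).
pose phi t := h t - Re (c * G t).
have dphi t : a <= t <= b -> is_derive t 1 phi (h' t - Re (c * g t)).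
  move=> tab; apply: is_deriveB; first exact: dh.
  by have /rderivP[] : rderiv (fun t => c * G t) t (c * g t) by apply: hasdZ; exact: dG.
have [|//|s sab] := @MVT R phi (fun t => h' t - Re (c * g t)) a b ab.
- move=> t; rewrite in_itv/= => /andP[t1 t2]; apply: dphi.
  by rewrite !ltW.
- apply: derivable_within_continuous => t; rewrite in_itv/= => tab.
  exact: (@ex_derive _ _ _ _ _ _ _ (dphi t tab)).
move=> hs; have sab' : a <= s <= b.
  by move: sab; rewrite in_itv/= => /andP[? ?]; rewrite !ltW.
have p0 : 0 <= phi b - phi a.
  rewrite hs mulr_ge0// ?subr_ge0 ?(ltW ab)//.
  apply: le_trans (cabs_Re_ge _) _; rewrite cabsM.
  apply: le_trans (gh s sab').
  by rewrite -[leRHS]mul1r ler_wpM2r// cabs_ge0.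
have : Re (c * (G b - G a)) = cabs (G b - G a) by rewrite cG.
move=> <-; rewrite mulrBr ReB.
move: p0; rewrite /phi; lra.
Qed.

Lemma is_derive_cXn (c s : R) n :
  is_derive s 1 (fun t : R => c * t ^+ n.+1) (c * (n.+1%:R * s ^+ n)).
Proof.
have h := @is_deriveZ _ _ _ _ c _ _ _ (@is_deriveX _ _ id n.+1 s 1 1 (is_derive_id s 1)).
rewrite (_ : (fun _ => _) = c \*: id ^+ n.+1); last first.
  by apply/funext => t; rewrite /GRing.scale/= fctE.
by apply: is_derive_eq; rewrite /GRing.scale/= mulr1.
Qed.

Lemma is_derive_mull (c s : R) : is_derive s 1 (fun t : R => c * t) c.
Proof.
apply/is_derive_epsP => e e0; exists 1 => // h _.
rewrite (_ : _ - _ - _ = 0); last by ring.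
by rewrite normr0 mulr_ge0// ltW.
Qed.

Lemma rderiv_cexp_lin (w : C) t : rderiv (fun t : R => cexp (t%:C * w)) t (w * cexp (t%:C * w)).
Proof.
case: w => a b; apply/rderivP; split => /=.
- rewrite (_ : (fun _ => _) = (expR \o (fun t => a * t)) * (cos \o (fun t => b * t))); last first.
    by apply/funext => s; rewrite !mul0r subr0 addr0 ![s * _]mulrC.
  have da := is_derive_mull a t.
  have db := is_derive_mull b t.
  have D1 : is_derive t 1 (expR \o (fun t => a * t)) (expR (a * t) * a).
    exact: is_derive1_comp.
  have D2 := is_derive1_comp (is_derive_cos (b * t)) db.
  have D := is_deriveM D1 D2.
  apply: is_derive_eq D _.
  rewrite /= /GRing.scale/= !(mul0r, subr0, addr0) ![t * _]mulrC; ring.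
- rewrite (_ : (fun _ => _) = (expR \o (fun t => a * t)) * (sin \o (fun t => b * t))); last first.
    by apply/funext => s; rewrite !mul0r subr0 addr0 ![s * _]mulrC.
  have da := is_derive_mull a t.
  have db := is_derive_mull b t.
  have D1 : is_derive t 1 (expR \o (fun t => a * t)) (expR (a * t) * a).
    exact: is_derive1_comp.
  have D2 := is_derive1_comp (is_derive_sin (b * t)) db.
  have D := is_deriveM D1 D2.
  apply: is_derive_eq D _.
  rewrite /= /GRing.scale/= !(mul0r, subr0, addr0) ![t * _]mulrC; ring.
Qed.

Definition texp (n : nat) (w : C) : C := \sum_(i < n) w ^+ i / (i`!)%:R.

Lemma rderiv_texp n (w : C) t :
  rderiv (fun t : R => texp n.+1 (t%:C * w)) t (w * texp n (t%:C * w)).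
Proof.
rewrite /texp.
apply: (@hasd_ext _ _ (fun z => 1 + \sum_(i < n) ((Re z)%:C * w) ^+ i.+1 / (i.+1`!)%:R) _ _ _ 1) => //=.
- by rewrite big_ord_recl expr0 fact0 divr1.
- by move=> u _ _; rewrite big_ord_recl expr0 fact0 divr1.
rewrite -[X in hasd _ _ _ X]add0r; apply: hasdD; first exact: hasd_cst.
rewrite mulr_sumr; apply: hasd_sum => i.
have h1 : rderiv (fun s => s%:C * w) t w.
  by have := rderivM (rderiv_real t) (hasd_cst _ w _); rewrite mul1r mulr0 addr0; exact.
have h2 := @hasdX R _ (fun z => (Re z)%:C * w) _ _ i h1.
have := hasdM h2 (hasd_cst _ ((i.+1`!)%:R^-1) _).
apply: hasd_eql; rewrite mulr0 addr0 factS natrM /= .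
have f0 : (i`!)%:R != 0 :> C by rewrite pnatr_eq0 -lt0n fact_gt0.
have i0 : i.+1%:R != 0 :> C by rewrite pnatr_eq0.
by move: (i.+1%:R : C) (i`!%:R : C) f0 i0 => p q f0 i0; field; rewrite f0 i0.
Qed.

Lemma texpS0 n : texp n.+1 0 = 1.
Proof.
rewrite /texp big_ord_recl expr0 fact0 divr1 big1 ?addr0// => i _.
by rewrite expr0n mul0r.
Qed.

(** Induction on n along the segment t w: the derivative of the remainder of order n + 1 is w times
    the remainder of order n, and [mvi] integrates the bound. *)
Lemma cexp_taylor n (w : C) : cabs (cexp w - texp n w) <=
  cabs w ^+ n / (n`!)%:R * expR `|Re w|.
Proof.
pose M := expR `|Re w|.
(* The exponential factor M is frozen at its value for t = 1, so that only the power t^n has to be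
   integrated. *)
suff h : forall t, 0 <= t <= 1 -> cabs (cexp (t%:C * w) - texp n (t%:C * w)) <=
   M * (cabs w ^+ n / (n`!)%:R * t ^+ n).
  by have := h 1; rewrite lexx ler01 mul1r expr1n mulr1 mulrC; exact.
elim: n => [|n ih] t /andP[t0 t1].
  rewrite /texp big_ord0 subr0 !expr0 fact0 divr1 !mulr1 cabs_cexp ler_expR ReMr.
  apply: le_trans (ler_norm _) _; rewrite normrM (ger0_norm t0).
  by rewrite ler_piMl.
have E1 : cexp (0%:C * w) - texp n.+1 (0%:C * w) = 0.
  by rewrite mul0r cexp0 texpS0 subrr.
suff H : cabs (cexp (t%:C * w) - texp n.+1 (t%:C * w) - 
    (cexp (0%:C * w) - texp n.+1 (0%:C * w))) <=
    M * (cabs w ^+ n.+1 / (n.+1`!)%:R) * t ^+ n.+1 -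
    M * (cabs w ^+ n.+1 / (n.+1`!)%:R) * 0 ^+ n.+1.
  by move: H; rewrite E1 expr0n /= mulr0 !subr0 -[X in _ <= X -> _]mulrA.
apply: (@mvi (fun t => cexp (t%:C * w) - texp n.+1 (t%:C * w))
  (fun t => w * cexp (t%:C * w) - w * texp n (t%:C * w))
  (fun t => M * (cabs w ^+ n.+1 / (n.+1`!)%:R) * t ^+ n.+1)
  (fun t => M * (cabs w ^+ n.+1 / (n`!)%:R * t ^+ n)) 0 t t0).
- by move=> s _; apply: hasdB; [exact: rderiv_cexp_lin|exact: rderiv_texp].
- move=> s _; apply: is_derive_eq (is_derive_cXn _ _ _) _.
  rewrite factS natrM.
  have f0 : (n`!)%:R != 0 :> R by rewrite pnatr_eq0 -lt0n fact_gt0.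
  have i0 : n.+1%:R != 0 :> R by rewrite pnatr_eq0.
  by move: (n.+1%:R : R) (n`!%:R : R) f0 i0 => p q f0 i0; field; rewrite f0 i0.
- move=> s /andP[s0 st]; rewrite -mulrBr cabsM.
  have -> : M * (cabs w ^+ n.+1 / (n`!)%:R * s ^+ n) =
    cabs w * (M * (cabs w ^+ n / (n`!)%:R * s ^+ n)) by rewrite exprS; ring.
  by rewrite ler_wpM2l ?cabs_ge0// ih// s0 (le_trans st).
Qed.

(** This quadratic remainder serves every differentiation under the integral sign below: in x, in p
    and in the order r. *)
Lemma cexp_taylor2 (w : C) : cabs (cexp w - 1 - w) <=
  cabs w ^+ 2 * expR `|Re w|.
Proof.
have := cexp_taylor 2 w; rewrite /texp !big_ord_recr big_ord0 /= expr0 fact0 divr1 add0r.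
rewrite (_ : 1`! = 1%N)// expr1 divr1 opprD addrA => /le_trans; apply.
rewrite ler_wpM2r ?expR_ge0// ler_pdivrMr ?ltr0n// ler_peMr ?exprn_ge0 ?cabs_ge0//.
by rewrite ler1n.
Qed.

Lemma cderiv_cexp z : cderiv (@cexp R) z (cexp z).
Proof.
move=> e e0; pose K := cabs (cexp z) * expR 1.
have K0 : 0 < K by rewrite mulr_gt0 ?expR_gt0// cabs_gt0 cexp_neq0.
exists (Num.min 1 (e / K)); first by rewrite lt_min ltr01 divr_gt0.
move=> u _; rewrite lt_min => /andP[u1 u2].
have -> : cexp (z + u) - cexp z - cexp z * u = cexp z * (cexp u - 1 - u).
  by rewrite cexpD; ring.
rewrite cabsM; apply: (@le_trans _ _ (K * cabs u * cabs u)).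
  rewrite /K -!mulrA ler_wpM2l ?cabs_ge0//; apply: le_trans (cexp_taylor2 u) _.
  rewrite expr2 mulrC; rewrite ler_wpM2r ?mulr_ge0 ?cabs_ge0// ler_expR.
  by apply: le_trans (Re_le_cabs _) _; rewrite ltW.
by rewrite ler_wpM2r ?cabs_ge0// mulrC -ler_pdivlMr// ltW.
Qed.

Lemma derivable_cderivP F z : derivable F z 1 <-> exists l, cderiv F z l.
Proof.
split=> [/cvg_ex[l cv]|[l H]].
  exists l => e e0; have e0' : 0 < e%:C :> C by rewrite ltcR.
  move/cvgrPdist_le : cv => /(_ _ e0') /= /nbhs_ballP[d /= d0 hd].
  have dR : d = (Re d)%:C.
    by move: d0; rewrite ltcE => /andP[/eqP/= h _]; case: d h {hd} => ? ? /= ->.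
  exists (Re d); first by move: d0; rewrite {1}dR ltcR.
  move=> h _ hlt; have [->|h0] := eqVneq h 0.
    by rewrite addr0 subrr mulr0 subr0 cabs0 mulr0.
  have := hd h; rewrite /ball/= sub0r normrN normE dR ltcR => /(_ hlt h0).
  rewrite [_ *: 1]mulr1 [h + z]addrC.
  have -> : l - h^-1 *: (F (z + h) - F z) = - h^-1 * (F (z + h) - F z - l * h).
    by rewrite /GRing.scale/=; field.
  rewrite normE lecR cabsM cabsN cabsV => hh.
  by rewrite -ler_pdivrMr ?cabs_gt0// mulrC.
apply/cvg_ex; exists l; apply/cvgrPdist_le => /= e e0.
have [eR e0'] := cplx_gt0 e0.
have [d d0 hd] := H _ e0'.
apply/nbhs_ballP; exists d%:C => /=; first by rewrite ltcR.
move=> h; rewrite /ball/= sub0r normrN normE ltcR => hlt h0.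
have -> : h^-1 *: (F (h *: 1 + z) - F z) = h^-1 * (F (z + h) - F z).
  by rewrite [_ *: 1]mulr1 [h + z]addrC.
have -> : l - h^-1 * (F (z + h) - F z) = - h^-1 * (F (z + h) - F z - l * h).
  by field.
rewrite normE eR lecR cabsM cabsN cabsV mulrC ler_pdivrMr ?cabs_gt0//.
exact: hd.
Qed.

End DerivLink.

(** * Logarithm and powers on the right half-plane *)

Section Log.
Variable R : realType.
Local Notation C := (Cplx R).
Implicit Types (z w p : C) (x t : R).

(** Principal logarithm, meant for Re p > 0 only, where the argument is an arctangent. *)
Definition clog p : C := (ln (cabs p)) +i* (atan (Im p / Re p)).

Arguments clog : simpl never.

Lemma cabs_Re_gt0 p : 0 < Re p -> 0 < cabs p.
Proof. by move=> p0; apply: lt_le_trans (cabs_Re_ge p). Qed.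

Lemma cos_atan_gt0 x : 0 < cos (atan x).
Proof. by apply: cos_gt0_pihalf; rewrite atan_gtNpi2 atan_ltpi2. Qed.

Lemma clogK p : 0 < Re p -> cexp (clog p) = p.
Proof.
move=> p0; have ap := cabs_Re_gt0 p0.
rewrite /cexp /clog /= lnK ?posrE//.
set t := Im p / Re p.
have c0 := cos_atan_gt0 t.
have hc : cabs p * cos (atan t) = Re p.
  apply/eqP; rewrite -(@eqrXn2 _ 2) ?mulr_ge0 ?cabs_ge0 ?ltW//.
  rewrite exprMn cabs_sqr; have := @cos2_tan2 R (atan t); rewrite gt_eqF// atanK => /(_ isT) h.
  have aux (a b : R) : 0 < a -> (a ^+ 2 + b ^+ 2) / (1 + (b / a) ^+ 2) = a ^+ 2.
    move=> a0; field; rewrite gt_eqF//= gt_eqF//.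
    by rewrite ltr_pwDl ?sqr_ge0 ?exprn_gt0.
  by rewrite -[cos _ ^+ 2]invrK h /t aux.
have hs : sin (atan t) = t * cos (atan t).
  by rewrite -{2}(atanK t) /tan divfK// gt_eqF.
apply: cplx_ext => /=; first exact: hc.
by rewrite hs mulrCA hc /t divfK// gt_eqF.
Qed.

Lemma cexpK w : `|Im w| < pi / 2 -> clog (cexp w) = w.
Proof.
case: w => a b /=; rewrite ltr_norml => /andP[b1 b2].
have c0 : 0 < cos b by apply: cos_gt0_pihalf; rewrite b1.
rewrite /clog cabs_cexp /= expRK; congr (_ +i* _).
rewrite -mulf_div divff ?mul1r; last by rewrite gt_eqF// expR_gt0.
by rewrite -/(tan b) tanK// in_itv/= b1.
Qed.

Lemma Im_clog p : `|Im (clog p)| < pi / 2.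
Proof. by rewrite ltr_norml /= atan_gtNpi2 atan_ltpi2. Qed.

(** Continuity comes before differentiability: [cderiv_clog] inverts the derivative of [cexp], which
    requires that the increment of the logarithm be small. *)
Lemma clog_cont p : 0 < Re p -> forall e : R, 0 < e ->
  exists2 d : R, 0 < d & forall u, cabs u < d -> cabs (clog (p + u) - clog p) <= e.
Proof.
move=> p0 e e0; have e2 : 0 < e / 2 by rewrite divr_gt0.
have ap := cabs_Re_gt0 p0.
have := @continuous_ln R (cabs p) ap; move/cvgrPdist_le => /(_ _ e2)/nbhs_ballP[d1 /= d10 h1].
pose a := Re p; pose b := Im p.
have := @continuous_atan R (b / a); move/cvgrPdist_le => /(_ _ e2)/nbhs_ballP[d2 /= d20 h2].
have K0 : 0 < (a + `|b|) by rewrite ltr_pwDl.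
exists (Num.min (Num.min d1 (a / 2)) (d2 * a ^+ 2 / 2 / (a + `|b|))).
  by rewrite !lt_min d10 !divr_gt0 ?mulr_gt0 ?exprn_gt0.
move=> u; rewrite !lt_min => /andP[/andP[u1 u2] u3].
apply: le_trans (cabs_le _) _; rewrite ReB ImB /= [leRHS]splitr; apply: lerD.
  rewrite distrC; apply: h1; rewrite /ball/= distrC; apply: le_lt_trans u1.
  by apply: le_trans (cabs_dist_le _ _) _; rewrite (_ : p + u - p = u)//; ring.
rewrite distrC; apply: h2; rewrite /ball/= ReD ImD -/a -/b.
have ru := Re_le_cabs u; have iu := Im_le_cabs u.
have au : a / 2 < a + Re u.
  move: (le_lt_trans ru u2); rewrite ltr_norml => /andP[]; lra.
have au0 : 0 < a + Re u by apply: lt_trans au; rewrite divr_gt0.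
have -> : b / a - (b + Im u) / (a + Re u) =
  (b * Re u - a * Im u) / (a * (a + Re u)).
  by field; rewrite !gt_eqF.
rewrite normrM normfV (gtr0_norm (mulr_gt0 p0 au0)) ltr_pdivrMr ?mulr_gt0//.
apply: (@le_lt_trans _ _ ((a + `|b|) * cabs u)).
  apply: le_trans (ler_normB _ _) _; rewrite !normrM (gtr0_norm p0) addrC mulrDl.
  by apply: lerD; rewrite ler_wpM2l// ltW.
rewrite mulrC -ltr_pdivlMr//; apply: lt_le_trans u3 _.
rewrite ler_pM2r ?invr_gt0// -mulrA ler_pM2l// expr2 -mulrA ler_pM2l//.
exact: ltW.
Qed.

Lemma cderiv_clog p : 0 < Re p -> cderiv (@clog) p p^-1.
Proof.
move=> p0 e e0; have ap := cabs_Re_gt0 p0.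
(* The first bound yields |v| <= 2 |u| / |p| for the increment v of the logarithm; the second turns
   the error e' |v| into at most e |p| |u|. *)
pose e' := Num.min (cabs p / 2) (e * cabs p ^+ 2 / 2).
have e'0 : 0 < e' by rewrite lt_min !divr_gt0 ?mulr_gt0 ?exprn_gt0.
have [d d0 hd] := cderiv_cexp (clog p) e'0.
have d2 : 0 < d / 2 by rewrite divr_gt0.
have [d1 d10 h1] := clog_cont p0 d2.
exists (Num.min d1 (Re p)); first by rewrite lt_min d10.
move=> u _; rewrite lt_min => /andP[u1 u2].
have pu0 : 0 < Re (p + u).
  by rewrite ReD; move: (le_lt_trans (Re_le_cabs u) u2); rewrite ltr_norml => /andP[]; lra.
pose v := clog (p + u) - clog p.
have vE : clog (p + u) = clog p + v by rewrite /v; ring.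
have vd : cabs v < d.
  by apply: le_lt_trans (h1 _ u1) _; rewrite ltr_pdivrMr// ltr_pMr// ltr1n.
have := hd v I vd; rewrite -vE !clogK//.
have -> : p + u - p - p * v = u - p * v by ring.
move=> h.
have vle : cabs v <= 2 / cabs p * cabs u.
  have h3 : cabs p * cabs v <= cabs u + cabs p / 2 * cabs v.
    rewrite -cabsM; have -> : p * v = u - (u - p * v) by ring.
    apply: le_trans (cabsB _ _) _; rewrite lerD2l; apply: le_trans h _.
    by rewrite ler_wpM2r ?cabs_ge0// ge_min lexx.
  rewrite -(ler_pM2l ap).
  have -> : cabs p * (2 / cabs p * cabs u) = 2 * cabs u by field; rewrite gt_eqF.
  by move: h3; lra.
rewrite -/v; have pn0 : p != 0 by rewrite -cabs_gt0.
have -> : v - p^-1 * u = - p^-1 * (u - p * v) by field.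
rewrite cabsM cabsN cabsV mulrC ler_pdivrMr//; apply: le_trans h _.
apply: (@le_trans _ _ (e * cabs p ^+ 2 / 2 * (2 / cabs p * cabs u))).
  by rewrite ler_pM ?cabs_ge0 ?(ltW e'0)// ge_min lexx orbT.
rewrite le_eqVlt; apply/orP; left; apply/eqP; field.
by rewrite gt_eqF.
Qed.

Definition cpw p (r : C) : C := cexp (r * clog p).

Lemma cderiv_cpw p r : 0 < Re p ->
  cderiv (fun q => cpw q r) p (cexp (r * clog p) * (r * p^-1)).
Proof.
move=> p0; apply: (@hasd_comp _ _ (@cexp R) (fun q => r * clog q)).
  exact: cderiv_cexp.
by apply: hasdZ; exact: cderiv_clog.
Qed.

(** For a <= 1 the argument of p^a stays in the principal range, so the logarithm does not jump. The
    composition law of powers rests on this. *)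
Lemma clog_cpw_real p (a : R) : 0 <= a <= 1 -> clog (cpw p a%:C) = a%:C * clog p.
Proof.
move=> /andP[a0 a1]; apply: cexpK; rewrite ImMr normrM ger0_norm//.
by apply: le_lt_trans (Im_clog p); rewrite ler_piMl.
Qed.

Lemma cabs_cpw_real p (a : R) : 0 < Re p ->
  cabs (cpw p a%:C) = cabs p `^ a.
Proof.
by move=> p0; rewrite /cpw cabs_cexp ReMr /= /powR gt_eqF ?cabs_Re_gt0.
Qed.

Lemma le_cos x t : 0 <= x -> x <= t -> t <= pi -> cos t <= cos x.
Proof.
rewrite [x <= t]le_eqVlt => x0 /predU1P[->//|xt] tpi; apply: ltW.
by rewrite ltr_cos// in_itv/= ?x0 ?tpi ?(le_trans x0 (ltW xt))// (le_trans (ltW xt)).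
Qed.

(** The argument of p^a is at most a pi/2 in modulus, so p^a lies in a proper subsector of the right
    half-plane. This is the source of the decay of exp(- y p^a). *)
Lemma Re_cpw_ge p (a : R) : 0 < a < 1 -> 0 < Re p ->
  cos (a * (pi / 2)) * cabs p `^ a <= Re (cpw p a%:C).
Proof.
move=> /andP[a0 a1] p0; rewrite /cpw /cexp ReMr ImMr /=.
rewrite -[expR _](_ : cabs p `^ a = _); last by rewrite /powR gt_eqF ?cabs_Re_gt0.
rewrite mulrC ler_wpM2l ?powR_ge0// -[cos (a * atan _)]cos_norm.
have h := Im_clog p; rewrite /clog/= in h.
have pi0 : 0 < pi :> R := pi_gt0 R.
have ah : a * (pi / 2) <= pi / 2 by rewrite ler_piMl ?divr_ge0 ?ltW.
set t := atan _ in h *.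
have aa : `|a * t| <= a * (pi / 2).
  by rewrite normrM gtr0_norm// ler_wpM2l ?(ltW a0)// ltW.
by apply: le_cos => //; apply: (le_trans ah); lra.
Qed.

End Log.

(** * Complex integrals over the line *)

Section Meas.
Variable R : realType.
Local Notation C := (Cplx R).

Definition cmeas d (T : measurableType d) (f : T -> C) : Prop :=
  measurable_fun setT (fun t => Re (f t)) /\
  measurable_fun setT (fun t => Im (f t)).

Section MeasT.
Variables (d : measure_display) (T : measurableType d).
Implicit Types f g : T -> C.

Lemma cmeasD f g : cmeas f -> cmeas g -> cmeas (fun t => f t + g t).
Proof.
move=> [f1 f2] [g1 g2]; split.
- under eq_fun do rewrite ReD; exact: measurable_funD.
- under eq_fun do rewrite ImD; exact: measurable_funD.
Qed.

Lemma cmeasM f g : cmeas f -> cmeas g -> cmeas (fun t => f t * g t).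
Proof.
move=> [f1 f2] [g1 g2]; split.
- under eq_fun do rewrite ReM; apply: measurable_funB; exact: measurable_funM.
- under eq_fun do rewrite ImM; apply: measurable_funD; exact: measurable_funM.
Qed.

Lemma cmeas_cst (c : C) : cmeas (fun _ : T => c).
Proof. by split; exact: measurable_cst. Qed.

Lemma cmeas_real (u : T -> R) : measurable_fun setT u -> cmeas (fun t => (u t)%:C).
Proof. by move=> mu; split=> //=; exact: measurable_cst. Qed.

Lemma cmeasN f : cmeas f -> cmeas (fun t => - f t).
Proof.
move=> /(cmeasM (cmeas_cst (-1))).
by under eq_fun do rewrite mulN1r.
Qed.

Lemma cmeasB f g : cmeas f -> cmeas g -> cmeas (fun t => f t - g t).
Proof. by move=> mf /cmeasN; exact: cmeasD. Qed.

Lemma cmeas_exp f : cmeas f -> cmeas (fun t => cexp (f t)).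
Proof.
move=> [f1 f2].
have m1 : measurable_fun setT (fun t => expR (Re (f t))).
  exact: (measurableT_comp (@measurable_expR R) f1).
split=> /=; apply: measurable_funM => //.
- apply: measurableT_comp f2; apply: continuous_measurable_fun => x; exact: continuous_cos.
- apply: measurableT_comp f2; apply: continuous_measurable_fun => x; exact: continuous_sin.
Qed.

Lemma cmeas_if (b : T -> bool) f g : measurable_fun setT b -> cmeas f -> cmeas g ->
  cmeas (fun t => if b t then f t else g t).
Proof.
move=> mb [f1 f2] [g1 g2]; split.
- rewrite (_ : (fun t => _) = (fun t => if b t then Re (f t) else Re (g t))).
    exact: measurable_fun_ifT.
  by apply/funext => t; case: ifP.
- rewrite (_ : (fun t => _) = (fun t => if b t then Im (f t) else Im (g t))).
    exact: measurable_fun_ifT.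
  by apply/funext => t; case: ifP.
Qed.

End MeasT.

Lemma cmeas_comp d d' (T : measurableType d) (T' : measurableType d')
  (f : T' -> C) (phi : T -> T') : measurable_fun setT phi -> cmeas f ->
  cmeas (fun t => f (phi t)).
Proof. by move=> mp [f1 f2]; split; [exact: measurableT_comp f1 mp|exact: measurableT_comp f2 mp]. Qed.

Lemma measurable_ge (a : R) : measurable_fun setT (fun t : R => a <= t).
Proof. exact: (measurable_fun_ler (measurable_cst a) (@measurable_id _ R setT)). Qed.
Lemma measurable_gt (a : R) : measurable_fun setT (fun t : R => a < t).
Proof. exact: (measurable_fun_ltr (measurable_cst a) (@measurable_id _ R setT)). Qed.

End Meas.

(** * Limits of complex sequences *)

Section SeqLim.
Variable R : realType.
Local Notation C := (Cplx R).

Definition seq_lim (u : nat -> C) (l : C) : Prop := forall e : R, 0 < e ->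
  exists N, forall n, (N <= n)%N -> cabs (u n - l) <= e.

Lemma seq_lim_unique u l m : seq_lim u l -> seq_lim u m -> l = m.
Proof.
move=> h1 h2; apply/eqP; rewrite -subr_eq0 -cabs_eq0; apply/eqP/le_anti.
rewrite cabs_ge0 andbT; apply/ler_addgt0Pl => e e0; rewrite addr0.
have e2 : 0 < e / 2 by rewrite divr_gt0.
have [N1 n1] := h1 _ e2; have [N2 n2] := h2 _ e2.
have := n1 (maxn N1 N2) (leq_maxl _ _); have := n2 (maxn N1 N2) (leq_maxr _ _).
set x := u _ => a b; rewrite (_ : l - m = (x - m) - (x - l)); last by ring.
by apply: le_trans (cabsB _ _) _; rewrite [e]splitr lerD.
Qed.

Lemma seq_limP u l : seq_lim u l <->
  (fun n => Re (u n)) @ \oo --> Re l /\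
  (fun n => Im (u n)) @ \oo --> Im l.
Proof.
split=> [H|[/cvgrPdist_le H1 /cvgrPdist_le H2] e e0].
  split; apply/cvgrPdist_le => e /H[N HN]; exists N => // n /= /HN;
   apply: le_trans; rewrite distrC -?ReB -?ImB; [exact: Re_le_cabs|exact: Im_le_cabs].
have e2 : 0 < e / 2 by rewrite divr_gt0.
have [N1 _ n1] := H1 _ e2; have [N2 _ n2] := H2 _ e2.
exists (maxn N1 N2) => n; rewrite geq_max => /andP[/n1 /= r1 /n2 /= r2].
apply: le_trans (cabs_le _) _; rewrite ReB ImB distrC [X in _ + X]distrC.
by rewrite [e]splitr lerD.
Qed.

Lemma seq_lim_cvg (u : nat -> C) l : seq_lim u l -> u @ \oo --> l.
Proof.
move=> H; apply/cvgrPdist_le => /= e e0.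
have [eR e0'] := cplx_gt0 e0.
have [N HN] := H _ e0'; exists N => // n /= /HN h.
by rewrite eR normE lecR cabs_distC.
Qed.

Lemma seq_limZ u l c : seq_lim u l -> seq_lim (fun n => c * u n) (c * l).
Proof.
move=> H e e0; have c0 : 0 < cabs c + 1 by rewrite ltr_wpDl ?cabs_ge0.
have [|N HN] := H (e / (cabs c + 1)); first by rewrite divr_gt0.
exists N => n /HN; rewrite ler_pdivlMr// => h; rewrite -mulrBr cabsM mulrC.
by apply: le_trans h; rewrite ler_wpM2l ?cabs_ge0// lerDl.
Qed.

Lemma seq_limD u v l m : seq_lim u l -> seq_lim v m ->
  seq_lim (fun n => u n + v n) (l + m).
Proof.
move=> h1 h2 e e0.
have e2 : 0 < e / 2 by rewrite divr_gt0.
have [N1 n1] := h1 _ e2; have [N2 n2] := h2 _ e2.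
exists (maxn N1 N2) => n; rewrite geq_max => /andP[/n1 r1 /n2 r2].
rewrite (_ : _ - _ = (u n - l) + (v n - m)); last by ring.
by apply: le_trans (cabsD _ _) _; rewrite [e]splitr lerD.
Qed.

Lemma seq_lim_cst c : seq_lim (fun=> c) c.
Proof. by move=> e e0; exists 0 => n _; rewrite subrr cabs0 ltW. Qed.

Lemma seq_limB u v l m : seq_lim u l -> seq_lim v m ->
  seq_lim (fun n => u n - v n) (l - m).
Proof.
move=> h1 /(seq_limZ (-1)) h2; have := seq_limD h1 h2.
by rewrite mulN1r; under eq_fun do rewrite mulN1r.
Qed.

End SeqLim.

(** * Integrals over the line: linearity, domination, Fubini *)

Section Integral.
Variable R : realType.
Local Notation C := (Cplx R).
Local Notation mu := (@lebesgue_measure R).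
Implicit Types (f g : R -> C) (M : R).

Definition ci f := cintegrable setT f.
Definition cI f : C := cintegral setT f.
Definition ker (t : R) : R := (oneDsqr t)^-1.

Lemma ker_gt0 t : 0 < ker t.
Proof. by rewrite invr_gt0 /oneDsqr ltr_pwDl ?sqr_ge0. Qed.
Lemma ker_ge0 t : 0 <= ker t. Proof. exact/ltW/ker_gt0. Qed.

Lemma ker_le1 t : ker t <= 1.
Proof. exact: oneDsqrV_le1. Qed.

Lemma continuous_ker : continuous ker.
Proof. by move=> x; exact: continuous_oneDsqrV. Qed.

Lemma measurable_ker : measurable_fun setT ker.
Proof. exact: continuous_measurable_fun continuous_ker. Qed.

Lemma eintegral_ker : (\int[mu]_t (ker t)%:E = pi%:E)%E.
Proof.
rewrite ge0_symfun_integralT//; last 2 first.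
- exact: continuous_ker.
- by move=> x; rewrite /ker /oneDsqr /= sqrrN.
- rewrite (_ : [set x | 0 <= x] = `[0, +oo[%classic).
    rewrite integral0y_oneDsqr -EFinM; congr EFin; lra.
  by rewrite set_itvcy.
- by move=> x; exact: ker_ge0.
Qed.

Lemma integrable_ker : mu.-integrable setT (EFin \o ker).
Proof.
apply/integrableP; split; first by apply/measurable_EFinP; exact: measurable_ker.
under eq_integral do rewrite /= ger0_norm ?ker_ge0//.
by rewrite eintegral_ker ltry.
Qed.

Lemma integral_ker : \int[mu]_t ker t = pi.
Proof. by rewrite /Rintegral eintegral_ker. Qed.

Lemma integrable_scale (c : R) (g : R -> R) : mu.-integrable setT (EFin \o g) ->
  mu.-integrable setT (EFin \o (fun t => c * g t)).
Proof. by move=> ig; exact: (integrableZl measurableT c ig). Qed.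

Lemma ci_bnd f (g : R -> R) : cmeas f -> mu.-integrable setT (EFin \o g) ->
  (forall t, cabs (f t) <= g t) -> ci f.
Proof.
move=> [m1 m2] ig fg; split; apply: le_integrable ig => //.
- exact/measurable_EFinP.
- move=> t _ /=; rewrite lee_fin; apply: le_trans (Re_le_cabs _) _.
  exact: le_trans (fg t) (ler_norm _).
- exact/measurable_EFinP.
- move=> t _ /=; rewrite lee_fin; apply: le_trans (Im_le_cabs _) _.
  exact: le_trans (fg t) (ler_norm _).
Qed.

Lemma cID f g : ci f -> ci g -> cI (fun t => f t + g t) = cI f + cI g.
Proof.
move=> [f1 f2] [g1 g2]; apply: cplx_ext; rewrite ?ReD ?ImD /=.
- by under eq_Rintegral do rewrite ReD; rewrite RintegralD.
- by under eq_Rintegral do rewrite ImD; rewrite RintegralD.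
Qed.

Lemma ciD f g : ci f -> ci g -> ci (fun t => f t + g t).
Proof.
move=> [f1 f2] [g1 g2]; split.
- by under eq_fun do rewrite ReD EFinD; exact: integrableD.
- by under eq_fun do rewrite ImD EFinD; exact: integrableD.
Qed.

Lemma ciZ c f : ci f -> ci (fun t => c * f t).
Proof.
move=> [f1 f2]; split.
- by under eq_fun do rewrite ReM EFinB !EFinM; apply: integrableB => //; exact: integrableZl.
- by under eq_fun do rewrite ImM EFinD !EFinM; apply: integrableD => //; exact: integrableZl.
Qed.

Lemma cIZ c f : ci f -> cI (fun t => c * f t) = c * cI f.
Proof.
move=> [f1 f2]; apply: cplx_ext; rewrite ?ReM ?ImM /=.
- under eq_Rintegral do rewrite ReM; rewrite RintegralB//; last 2 first.
  + exact: integrable_scale.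
  + exact: integrable_scale.
  by rewrite !RintegralZl.
- under eq_Rintegral do rewrite ImM; rewrite RintegralD//; last 2 first.
  + exact: integrable_scale.
  + exact: integrable_scale.
  by rewrite !RintegralZl.
Qed.

Lemma ciB f g : ci f -> ci g -> ci (fun t => f t - g t).
Proof.
move=> cf /(ciZ (-1)) cg; under eq_fun do rewrite -mulN1r; exact: ciD.
Qed.

Lemma cIB f g : ci f -> ci g -> cI (fun t => f t - g t) = cI f - cI g.
Proof.
move=> cf cg; rewrite -[- cI g]mulN1r -cIZ// -cID//; last exact: ciZ.
by congr cI; apply/funext => t; rewrite mulN1r.
Qed.

(** A rotation makes the integral real, so that only Re (c f) <= g has to be integrated and no
    constant is lost. *)
Lemma cI_bnd f (g : R -> R) : ci f -> mu.-integrable setT (EFin \o g) ->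
  (forall t, cabs (f t) <= g t) -> cabs (cI f) <= \int[mu]_t g t.
Proof.
move=> cf ig fg; have [c [c1 cE]] := cabs_rot (cI f).
have -> : cabs (cI f) = Re (c * cI f) by rewrite cE.
rewrite -cIZ//=; apply: le_Rintegral => //; first by have [] := ciZ c cf.
move=> t _; apply: le_trans (cabs_Re_ge _) _; rewrite cabsM.
by apply: le_trans (fg t); rewrite ler_piMl ?cabs_ge0.
Qed.

(* All dominations of integrands use the single integrable majorant [ker]. *)
Definition dom M f := forall t, cabs (f t) <= M * ker t.

Lemma ci_dom M f : cmeas f -> dom M f -> ci f.
Proof.
move=> mf df; apply: ci_bnd mf _ df.
exact: integrable_scale integrable_ker.
Qed.

Lemma cI_dom M f : cmeas f -> dom M f -> cabs (cI f) <= M * pi.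
Proof.
move=> mf df; rewrite -integral_ker -RintegralZl//; last exact: integrable_ker.
apply: cI_bnd (ci_dom mf df) _ df.
exact: integrable_scale integrable_ker.
Qed.

Lemma dom_ge0 M f : dom M f -> 0 <= M.
Proof.
move=> /(_ 0) h; have := le_trans (cabs_ge0 _) h.
by rewrite pmulr_lge0// ker_gt0.
Qed.

Lemma cI_dctg (f_ : nat -> R -> C) f (g : R -> R) : (forall n, cmeas (f_ n)) -> cmeas f ->
  mu.-integrable setT (EFin \o g) ->
  (forall n t, cabs (f_ n t) <= g t) -> (forall t, seq_lim (fun n => f_ n t) (f t)) ->
  seq_lim (fun n => cI (f_ n)) (cI f).
Proof.
move=> mf_ mf iM df cv.
have df' t : cabs (f t) <= g t.
  apply/ler_addgt0Pr => e e0; have [N /(_ N (leqnn _)) h] := cv t _ e0.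
  rewrite (_ : f t = f_ N t - (f_ N t - f t)); last by ring.
  by apply: le_trans (cabsB _ _) _; apply: lerD h; exact: df.
have [f1 f2] := ci_bnd mf iM df'.
apply/seq_limP; split => /=.
- apply: fine_cvg; rewrite fineK ?integrable_fin_num//.
  have [|||//||_ _ //] := @dominated_convergence _ _ _ mu setT measurableT
     (fun n t => (Re (f_ n t))%:E) (fun t => (Re (f t))%:E)
     (EFin \o g).
  + by move=> n; apply/measurable_EFinP; have [] := mf_ n.
  + by apply/measurable_EFinP; have [] := mf.
  + apply: aeW => t _; apply: cvg_EFin; first by near=> n.
    by have /seq_limP[] := cv t.
  + apply: aeW => t n _; rewrite /= lee_fin; apply: le_trans (Re_le_cabs _) (df n t).
- apply: fine_cvg; rewrite fineK ?integrable_fin_num//.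
  have [|||//||_ _ //] := @dominated_convergence _ _ _ mu setT measurableT
     (fun n t => (Im (f_ n t))%:E) (fun t => (Im (f t))%:E)
     (EFin \o g).
  + by move=> n; apply/measurable_EFinP; have [] := mf_ n.
  + by apply/measurable_EFinP; have [] := mf.
  + apply: aeW => t _; apply: cvg_EFin; first by near=> n.
    by have /seq_limP[] := cv t.
  + apply: aeW => t n _; rewrite /= lee_fin; apply: le_trans (Im_le_cabs _) (df n t).
Unshelve. all: by end_near. Qed.

Lemma cI_dct (f_ : nat -> R -> C) f M : (forall n, cmeas (f_ n)) -> cmeas f ->
  (forall n, dom M (f_ n)) -> (forall t, seq_lim (fun n => f_ n t) (f t)) ->
  seq_lim (fun n => cI (f_ n)) (cI f).
Proof.
move=> mf_ mf df; apply: (cI_dctg mf_ mf _ df).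
exact: integrable_scale integrable_ker.
Qed.

Lemma integrable_ker2 M : (mu \x mu)%E.-integrable setT
  (fun z : R * R => (M * ker z.1 * ker z.2)%:E).
Proof.
have mk : measurable_fun setT (fun z : R * R => M * ker z.1 * ker z.2).
  apply: measurable_funM; last exact: measurableT_comp measurable_ker measurable_snd.
  by apply: measurable_funM => //; exact: measurableT_comp measurable_ker measurable_fst.
apply/integrable12ltyP; first exact/measurable_EFinP.
rewrite /=.
under eq_integral => x _.
  under eq_integral => y _ do
    rewrite /= normrM (ger0_norm (ker_ge0 y)) EFinM.
  rewrite ge0_integralZl//; last 2 first.
  - by apply/measurable_EFinP; exact: measurable_ker.
  - by move=> y _; rewrite lee_fin ker_ge0.
  rewrite eintegral_ker normrM (ger0_norm (ker_ge0 x)) mulrC EFinM -muleA.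
  over.
rewrite /= ge0_integralZr//; last 3 first.
- by apply/measurable_EFinP; exact: measurable_ker.
- by move=> y _; rewrite lee_fin ker_ge0.
- by rewrite mule_ge0// lee_fin ?pi_ge0.
- by rewrite eintegral_ker -!EFinM ltry.
Qed.

(** The measurability of both partial integrals is part of the conclusion because the iterated
    integrals are themselves dominated afterwards. *)
Lemma cFubini (f : R * R -> C) M : cmeas f ->
  (forall x y, cabs (f (x, y)) <= M * ker x * ker y) ->
  [/\ cmeas (fun x => cI (fun y => f (x, y))),
      cmeas (fun y => cI (fun x => f (x, y))) &
  cI (fun x => cI (fun y => f (x, y))) = cI (fun y => cI (fun x => f (x, y)))].
Proof.
move=> [m1 m2] fM.
have ig := integrable_ker2 M.
have i1 : (mu \x mu)%E.-integrable setT (fun z => (Re (f z))%:E).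
  apply: le_integrable ig => //; first exact/measurable_EFinP.
  move=> [x y] _ /=; rewrite lee_fin; apply: le_trans (Re_le_cabs _) _.
  exact: le_trans (fM x y) (ler_norm _).
have i2 : (mu \x mu)%E.-integrable setT (fun z => (Im (f z))%:E).
  apply: le_integrable ig => //; first exact/measurable_EFinP.
  move=> [x y] _ /=; rewrite lee_fin; apply: le_trans (Im_le_cabs _) _.
  exact: le_trans (fM x y) (ler_norm _).
have mx x : cmeas (fun y => f (x, y)).
  by split; [exact: measurableT_comp m1 (pair1_measurable _)
            |exact: measurableT_comp m2 (pair1_measurable _)].
have my y : cmeas (fun x => f (x, y)).
  by split; [exact: measurableT_comp m1 (pair2_measurable _)
            |exact: measurableT_comp m2 (pair2_measurable _)].
have cx x : ci (fun y => f (x, y)).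
  by apply: (@ci_dom (M * ker x)) => // y; exact: fM.
have cy y : ci (fun x => f (x, y)).
  by apply: (@ci_dom (M * ker y)) => // x; rewrite mulrAC; exact: fM.
have F1 := Fubini i1; have F2 := Fubini i2.
have e1 x : (Re (cI (fun y => f (x, y))))%:E =
    (\int[mu]_y (Re (f (x, y)))%:E)%E.
  by rewrite /= fineK// integrable_fin_num//; have [] := cx x.
have e2 x : (Im (cI (fun y => f (x, y))))%:E =
    (\int[mu]_y (Im (f (x, y)))%:E)%E.
  by rewrite /= fineK// integrable_fin_num//; have [] := cx x.
have e3 y : (Re (cI (fun x => f (x, y))))%:E =
    (\int[mu]_x (Re (f (x, y)))%:E)%E.
  by rewrite /= fineK// integrable_fin_num//; have [] := cy y.
have e4 y : (Im (cI (fun x => f (x, y))))%:E =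
    (\int[mu]_x (Im (f (x, y)))%:E)%E.
  by rewrite /= fineK// integrable_fin_num//; have [] := cy y.
split.
- split; apply/measurable_EFinP.
  + by apply: eq_measurable_fun (measurable_fubini_F i1) => x _; rewrite /fubini_F -e1.
  + by apply: eq_measurable_fun (measurable_fubini_F i2) => x _; rewrite /fubini_F -e2.
- split; apply/measurable_EFinP.
  + by apply: eq_measurable_fun (measurable_fubini_G i1) => x _; rewrite /fubini_G -e3.
  + by apply: eq_measurable_fun (measurable_fubini_G i2) => x _; rewrite /fubini_G -e4.
- apply: cplx_ext => /=; congr fine.
  + under eq_integral do rewrite e1; under [RHS]eq_integral do rewrite e3.
    exact: F1.
  + under eq_integral do rewrite e2; under [RHS]eq_integral do rewrite e4.
    exact: F2.
Qed.

End Integral.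

(** * Integrals over intervals: fundamental theorem, substitution, exhaustion *)

Section Intervals.
Variable R : realType.
Local Notation C := (Cplx R).
Local Notation mu := (@lebesgue_measure R).
Implicit Types (f g : R -> C) (G : R -> R) (a b c M : R).

Definition rcon a b f := forall x : R, a <= x <= b ->
  {for x, continuous (fun t => Re (f t))} /\
  {for x, continuous (fun t => Im (f t))}.
Definition rcont f := forall a b, rcon a b f.

Lemma rcon_rderiv f g a b : (forall x, a <= x <= b -> rderiv f x (g x)) ->
  rcon a b f.
Proof. by move=> h x xab; exact: rderiv_cont (h x xab). Qed.

Lemma rcont_rderiv f g : (forall x, rderiv f x (g x)) -> rcont f.
Proof. by move=> h a b x _; exact: rderiv_cont (h x). Qed.

Lemma rcontP f x : rcont f ->
  {for x, continuous (fun t => Re (f t))} /\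
  {for x, continuous (fun t => Im (f t))}.
Proof. by move=> h; apply: (h x x); rewrite lexx. Qed.

Lemma cmeas_rcont f : rcont f -> cmeas f.
Proof.
move=> h; split; apply: continuous_measurable_fun => x; by have [] := rcontP x h.
Qed.

Lemma rconM a b f g : rcon a b f -> rcon a b g -> rcon a b (fun t => f t * g t).
Proof.
move=> hf hg x xab; have [f1 f2] := hf x xab; have [g1 g2] := hg x xab; split.
- rewrite (_ : (fun t => _) = (fun t => Re (f t) * Re (g t) - Im (f t) * Im (g t))); last by apply/funext => t; rewrite ReM.
  by apply: continuousB; apply: continuousM.
- rewrite (_ : (fun t => _) = (fun t => Re (f t) * Im (g t) + Im (f t) * Re (g t))); last by apply/funext => t; rewrite ImM.
  by apply: continuousD; apply: continuousM.
Qed.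

Lemma rcontM f g : rcont f -> rcont g -> rcont (fun t => f t * g t).
Proof. by move=> hf hg a b; exact: rconM. Qed.

Lemma rcont_real G : continuous G -> rcont (fun t => (G t)%:C).
Proof. by move=> h a b x _; split; [exact: h|exact: cst_continuous]. Qed.

Lemma rcont_comp f G : rcont f -> continuous G -> rcont (f \o G).
Proof.
move=> hf hG a b x _; have [f1 f2] := rcontP (G x) hf.
split.
- exact: (@continuous_comp _ _ _ G (fun t => Re (f t)) x (hG x) f1).
- exact: (@continuous_comp _ _ _ G (fun t => Im (f t)) x (hG x) f2).
Qed.

Definition rest a b f t : C := if a <= t <= b then f t else 0.
(** Encoded as an integral over the whole line of a function cut off outside [a, b], so that
    linearity, bounds and dominated convergence are inherited from [cI]. *)
Definition cint a b f : C := cI (rest a b f).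

Lemma cint_Re a b f : Re (cint a b f) = \int[mu]_(t in `[a, b]) Re (f t).
Proof.
rewrite /cint /cI /cintegral /= [RHS]Rintegral_mkcond.
apply: eq_Rintegral => t _; rewrite patchE /rest mem_setE in_itv /=.
by case: ifP.
Qed.

Lemma cint_Im a b f : Im (cint a b f) = \int[mu]_(t in `[a, b]) Im (f t).
Proof.
rewrite /cint /cI /cintegral /= [RHS]Rintegral_mkcond.
apply: eq_Rintegral => t _; rewrite patchE /rest mem_setE in_itv /=.
by case: ifP.
Qed.

Lemma rcon_within f a b : rcon a b f ->
  {within `[a, b], continuous (fun t => Re (f t))} /\
  {within `[a, b], continuous (fun t => Im (f t))}.
Proof.
by move=> h; split; apply: continuous_in_subspaceT => x; rewrite inE /= in_itv /= => /h[].
Qed.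

Lemma measurable_rest_cond a b : measurable_fun setT (fun t : R => (a <= t <= b)).
Proof.
apply: measurable_and; first exact: measurable_ge.
exact: (measurable_fun_ler (@measurable_id _ R setT) (measurable_cst b)).
Qed.

Lemma cmeas_rest a b f : cmeas f -> cmeas (rest a b f).
Proof.
by move=> h; apply: cmeas_if h _; [exact: measurable_rest_cond|exact: cmeas_cst].
Qed.

Lemma integrable_rest G a b : mu.-integrable `[a, b] (EFin \o G) ->
  mu.-integrable setT (EFin \o (fun t => if a <= t <= b then G t else 0)).
Proof.
move=> h.
have [/(_ h)] := @integrable_mkcond _ _ R mu `[a, b]%classic (EFin \o G) (measurable_itv _).
move=> h2 _; apply: eq_integrable h2 => // t _; rewrite /= patchE mem_setE in_itv/=.
by case: ifP.
Qed.

Lemma ci_rest a b f : rcon a b f -> ci (rest a b f).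
Proof.
move=> cf; have [c1 c2] := @rcon_within f a b cf; split.
- have h : mu.-integrable `[a, b] (EFin \o (fun t => Re (f t))).
    by apply: continuous_compact_integrable => //; exact: segment_compact.
  by apply: eq_integrable (integrable_rest h) => // t _; rewrite /rest /=; case: ifP.
- have h : mu.-integrable `[a, b] (EFin \o (fun t => Im (f t))).
    by apply: continuous_compact_integrable => //; exact: segment_compact.
  by apply: eq_integrable (integrable_rest h) => // t _; rewrite /rest /=; case: ifP.
Qed.

Lemma cint_eq a b f g : (forall t, a <= t <= b -> f t = g t) -> cint a b f = cint a b g.
Proof.
by move=> h; congr cI; apply/funext => t; rewrite /rest; case: ifP => // /h.
Qed.

Lemma cintZ a b f (c : C) : rcon a b f -> cint a b (fun t => c * f t) = c * cint a b f.
Proof.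
move=> cf; rewrite /cint -cIZ; last exact: ci_rest.
by congr cI; apply/funext => t; rewrite /rest; case: ifP => //; rewrite mulr0.
Qed.

Lemma cintB a b f g : rcon a b f -> rcon a b g ->
  cint a b (fun t => f t - g t) = cint a b f - cint a b g.
Proof.
move=> cf cg; rewrite /cint -cIB; [|exact: ci_rest..].
by congr cI; apply/funext => t; rewrite /rest; case: ifP => //; rewrite subr0.
Qed.

Lemma cint_split a c b f : a <= c -> c <= b -> rcon a b f ->
  cint a b f = cint a c f + cint c b f.
Proof.
move=> ac cb cf; have [c1 c2] := @rcon_within f a b cf.
have i1 : mu.-integrable `[a, b] (EFin \o (fun t => Re (f t))).
  by apply: continuous_compact_integrable => //; exact: segment_compact.
have i2 : mu.-integrable `[a, b] (EFin \o (fun t => Im (f t))).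
  by apply: continuous_compact_integrable => //; exact: segment_compact.
have sub : [set` `]c, b]] `<=` [set` `[a, b]].
  by move=> t; rewrite /= !in_itv/= => /andP[ct ->]; rewrite (le_trans ac (ltW ct)).
apply: cplx_ext; rewrite ?ReD ?ImD ?cint_Re ?cint_Im.
- have := @Rintegral_itvB R _ (BLeft a) (BRight b) c i1.
  rewrite !bnd_simp => /(_ ac cb) /eqP; rewrite subr_eq => /eqP ->.
  rewrite Rintegral_itv_obnd_cbnd 1?addrC//.
  by apply: integrableS i1 => //; exact: measurable_itv.
- have := @Rintegral_itvB R _ (BLeft a) (BRight b) c i2.
  rewrite !bnd_simp => /(_ ac cb) /eqP; rewrite subr_eq => /eqP ->.
  rewrite Rintegral_itv_obnd_cbnd 1?addrC//.
  by apply: integrableS i2 => //; exact: measurable_itv.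
Qed.

Lemma integral_cst_itv a b M : a <= b -> \int[mu]_(t in `[a, b]) M = M * (b - a).
Proof.
move=> ab; rewrite Rintegral_cst//; congr (_ * _).
by rewrite /= lebesgue_measure_itv/=; case: ifP => //; rewrite lte_fin => /negbT; rewrite -leNgt => ba; rewrite (@le_anti _ _ a b) ?subrr// ab ba.
Qed.

Lemma cint_bnd a b f M : a <= b -> rcon a b f ->
  (forall t, a <= t <= b -> cabs (f t) <= M) -> cabs (cint a b f) <= M * (b - a).
Proof.
move=> ab cf fM; rewrite -integral_cst_itv//.
rewrite Rintegral_mkcond.
apply: cI_bnd; first exact: ci_rest.
- have h : mu.-integrable `[a, b] (EFin \o (fun=> M)).
    apply: continuous_compact_integrable; first exact: segment_compact.
    by apply: continuous_subspaceT => x; exact: cst_continuous.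
  apply: eq_integrable (integrable_rest h) => // t _.
  by rewrite /= patchE mem_setE in_itv.
- move=> t; rewrite patchE mem_setE in_itv /= /rest; case: ifP => [/fM//|_].
  by rewrite cabs0.
Qed.

Lemma RFTC (F f : R -> R) a b : a <= b ->
  (forall x : R, a <= x <= b -> {for x, continuous f}) ->
  (forall x : R, a <= x <= b -> is_derive x 1 F (f x)) ->
  \int[mu]_(t in `[a, b]) f t = F b - F a.
Proof.
rewrite le_eqVlt => /predU1P[->|ab] cf dF; first by rewrite set_itv1 Rintegral_set1 subrr.
have cF x : a <= x <= b -> {for x, continuous F}.
  move=> xab; apply: differentiable_continuous; apply/derivable1_diffP.
  exact: (@ex_derive _ _ _ _ _ _ _ (dF x xab)).
have aa : a <= a <= b by rewrite lexx ltW.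
have bb : a <= b <= b by rewrite lexx ltW.
rewrite /Rintegral (@continuous_FTC2 _ f F)//.
- by apply: continuous_in_subspaceT => x; rewrite inE /= in_itv /=; exact: cf.
- split=> [x||].
  + rewrite in_itv/= => /andP[ax xb]; apply: (@ex_derive _ _ _ _ _ _ _ (dF x _)).
    by rewrite !ltW.
  + exact/cvg_at_right_filter/cF.
  + exact/cvg_at_left_filter/cF.
- move=> x; rewrite in_itv/= => /andP[ax xb].
  by rewrite derive1E; apply: (@derive_val _ _ _ _ _ _ _ (dF x _)); rewrite !ltW.
Qed.

Lemma cFTC f g a b : a <= b -> rcon a b g ->
  (forall x, a <= x <= b -> rderiv f x (g x)) ->
  cint a b g = f b - f a.
Proof.
move=> ab cg fg; apply: cplx_ext; rewrite ?cint_Re ?cint_Im ?ReB ?ImB.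
- apply: (@RFTC (fun t => Re (f t))) => // x xab; first by have [] := cg x xab.
  by have /rderivP[] := fg x xab.
- apply: (@RFTC (fun t => Im (f t))) => // x xab; first by have [] := cg x xab.
  by have /rderivP[] := fg x xab.
Qed.

Lemma eint_subst (h p p' : R -> R) a b : a <= b ->
  (forall x y, x < y -> p x < p y) -> continuous p' ->
  (forall x : R, is_derive x 1 p (p' x)) ->
  {within `[p a, p b], continuous h} ->
  (\int[mu]_(t in `[p a, p b]) (h t)%:E = \int[mu]_(t in `[a, b]) (h (p t) * p' t)%:E)%E.
Proof.
move=> ab ip cp' dp ch.
have cp : continuous p.
  move=> x; apply: differentiable_continuous; apply/derivable1_diffP.
  exact: (@ex_derive _ _ _ _ _ _ _ (dp x)).
have p'E : derive1 p = p'.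
  by apply/funext => x; rewrite derive1E; exact: (@derive_val _ _ _ _ _ _ _ (dp x)).
rewrite (@integration_by_substitution_increasing _ p h)//.
- by rewrite p'E.
- by move=> x y _ _; exact: ip.
- by rewrite p'E => x _; exact: cp'.
- by rewrite p'E; apply: cvgP; exact/cvg_at_right_filter/cp'.
- by rewrite p'E; apply: cvgP; exact/cvg_at_left_filter/cp'.
- split=> [x _||].
  + exact: (@ex_derive _ _ _ _ _ _ _ (dp x)).
  + exact/cvg_at_right_filter/cp.
  + exact/cvg_at_left_filter/cp.
Qed.

Lemma cint_subst f (p p' : R -> R) a b : a <= b ->
  (forall x y, x < y -> p x < p y) -> continuous p' ->
  (forall x : R, is_derive x 1 p (p' x)) -> rcon (p a) (p b) f ->
  cint (p a) (p b) f = cint a b (fun t => f (p t) * (p' t)%:C).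
Proof.
move=> ab ip cp' dp cf; have [w1 w2] := rcon_within cf.
apply: cplx_ext; rewrite ?cint_Re ?cint_Im /Rintegral.
- rewrite (eint_subst ab ip cp' dp w1).
  by congr fine; apply: eq_integral => t _; rewrite [f _ * _]mulrC ReMr mulrC.
- rewrite (eint_subst ab ip cp' dp w2).
  by congr fine; apply: eq_integral => t _; rewrite [f _ * _]mulrC ImMr mulrC.
Qed.

Lemma cI_exhaust f M (u v : nat -> R) : cmeas f -> dom M f ->
  (forall t, exists N, forall n, (N <= n)%N -> u n <= t <= v n) ->
  seq_lim (fun n => cint (u n) (v n) f) (cI f).
Proof.
move=> mf df uv; apply: (@cI_dct _ _ _ M) => //.
- by move=> n; exact: cmeas_rest.
- move=> n t; rewrite /rest; case: ifP => // _; rewrite cabs0.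
  by rewrite mulr_ge0 ?ker_ge0 ?(dom_ge0 df).
- move=> t e e0; have [N HN] := uv t; exists N => n /HN h.
  by rewrite /rest h subrr cabs0 ltW.
Qed.

Lemma nat_lt_bnd (x : R) : exists N, forall n, (N <= n)%N -> x <= n%:R.
Proof.
exists (Num.bound `|x|) => n hn; apply: le_trans (ler_norm _) _.
apply: le_trans (ltW (archi_boundP (normr_ge0 x))) _.
by rewrite ler_nat.
Qed.

Lemma cI_exhaustT f M : cmeas f -> dom M f ->
  seq_lim (fun n => cint (- n%:R) n%:R f) (cI f).
Proof.
move=> mf df; apply: cI_exhaust df _ => // t.
have [N1 h1] := nat_lt_bnd t; have [N2 h2] := nat_lt_bnd (- t).
exists (maxn N1 N2) => n; rewrite geq_max => /andP[/h1 a /h2 b].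
by rewrite a andbT lerNl.
Qed.

End Intervals.

(** * Cauchy's theorem and shifts of contours *)

Section Goursat.
Variable R : realType.
Local Notation C := (Cplx R).
Implicit Types (F P : C -> C) (a b c d s t e M : R).

Definition hol (D : set C) F := forall z, D z -> exists l, cderiv F z l.
Definition rect a b c d : set C :=
  [set z | a <= Re z <= b /\ c <= Im z <= d].

Lemma hol_sub (D E : set C) F : D `<=` E -> hol E F -> hol D F.
Proof. by move=> DE h z /DE; exact: h. Qed.

Lemma rderiv_hor F s t l : cderiv F (s +i* t) l ->
  rderiv (fun s => F (s +i* t)) s l.
Proof.
move=> h; rewrite -[l]mulr1; apply: (@rderiv_comp_cderiv _ F (fun s => s +i* t)) h _.
by apply/rderivP; split => /=; [exact: is_derive_id|exact: is_derive_cst].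
Qed.

Lemma rderiv_ver F s t l : cderiv F (s +i* t) l ->
  rderiv (fun t => F (s +i* t)) t (l * 'i).
Proof.
move=> h; apply: (@rderiv_comp_cderiv _ F (fun t => s +i* t)) h _.
by apply/rderivP; split => /=; [exact: is_derive_cst|exact: is_derive_id].
Qed.

Definition hedge F t a b : C := cint a b (fun s => F (s +i* t)).
Definition vedge F s c d : C := cint c d (fun t => F (s +i* t)).
(** Contour integral counterclockwise around the rectangle, starting with the bottom edge; dz = i dt
    on the vertical edges. *)
Definition bdry F a b c d : C :=
  hedge F c a b + 'i * vedge F b c d - hedge F d a b - 'i * vedge F a c d.

Lemma rcon_hor F a b c d t : hol (rect a b c d) F -> c <= t <= d ->
  rcon a b (fun s => F (s +i* t)).
Proof.
move=> h tcd s sab; have [|l hl] := h (s +i* t); first by [].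
exact: rderiv_cont (rderiv_hor hl).
Qed.

Lemma rcon_ver F a b c d s : hol (rect a b c d) F -> a <= s <= b ->
  rcon c d (fun t => F (s +i* t)).
Proof.
move=> h sab t tcd; have [|l hl] := h (s +i* t); first by [].
exact: rderiv_cont (rderiv_ver hl).
Qed.

Lemma bdry_hsplit F a m b c d : a <= m -> m <= b -> c <= d ->
  hol (rect a b c d) F ->
  bdry F a b c d = bdry F a m c d + bdry F m b c d.
Proof.
move=> am mb cd h; rewrite /bdry /hedge.
rewrite (@cint_split _ a m b (fun s => F (s +i* c)))//; last by apply: rcon_hor h _; rewrite lexx cd.
rewrite (@cint_split _ a m b (fun s => F (s +i* d)))//; last by apply: rcon_hor h _; rewrite lexx cd.
ring.
Qed.

Lemma bdry_vsplit F a b c m d : a <= b -> c <= m -> m <= d ->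
  hol (rect a b c d) F ->
  bdry F a b c d = bdry F a b c m + bdry F a b m d.
Proof.
move=> ab cm md h; rewrite /bdry /vedge.
rewrite (@cint_split _ c m d (fun s => F (a +i* s)))//; last by apply: rcon_ver h _; rewrite lexx ab.
rewrite (@cint_split _ c m d (fun s => F (b +i* s)))//; last by apply: rcon_ver h _; rewrite lexx ab.
ring.
Qed.

Lemma bdry_primitive P F a b c d : a <= b -> c <= d -> hol (rect a b c d) F ->
  (forall z, rect a b c d z -> cderiv P z (F z)) -> bdry F a b c d = 0.
Proof.
move=> ab cd hF dP.
have H t : c <= t <= d -> hedge F t a b = P (b +i* t) - P (a +i* t).
  move=> tcd; apply: (@cFTC _ (fun s => P (s +i* t))) => //; first exact: rcon_hor hF tcd.
  by move=> s sab; apply: rderiv_hor; exact: dP.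
have V s : a <= s <= b -> ('i : C) * vedge F s c d = P (s +i* d) - P (s +i* c).
  move=> sab; rewrite -cintZ; last exact: rcon_ver hF sab.
  apply: (@cFTC _ (fun t => P (s +i* t))) => //.
    apply: rconM; last exact: rcon_ver hF sab.
    by move=> x _; split; exact: cst_continuous.
  by move=> t tcd; rewrite mulrC; apply: rderiv_ver; exact: dP.
have E1 : ('i : C) * vedge F a c d - (P (a +i* d) - P (a +i* c)) = 0.
  by rewrite V ?lexx// subrr.
have E2 : ('i : C) * vedge F b c d - (P (b +i* d) - P (b +i* c)) = 0.
  by rewrite V ?lexx ?ab// subrr.
transitivity (('i * vedge F b c d - (P (b +i* d) - P (b +i* c))) -
  ('i * vedge F a c d - (P (a +i* d) - P (a +i* c)))); last by rewrite E1 E2 subrr.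
by rewrite /bdry !H ?lexx ?cd//; ring.
Qed.

Lemma bdry_bnd F a b c d M : a <= b -> c <= d -> hol (rect a b c d) F ->
  (forall z, rect a b c d z -> cabs (F z) <= M) ->
  cabs (bdry F a b c d) <= 2 * M * ((b - a) + (d - c)).
Proof.
move=> ab cd hF FM.
have H t : c <= t <= d -> cabs (hedge F t a b) <= M * (b - a).
  by move=> tcd; apply: cint_bnd => //; [exact: rcon_hor hF tcd|move=> s sab; exact: FM].
have V s : a <= s <= b -> cabs (vedge F s c d) <= M * (d - c).
  by move=> sab; apply: cint_bnd => //; [exact: rcon_ver hF sab|move=> t tcd; exact: FM].
rewrite /bdry.
have h1 := H c; have h2 := H d; have v1 := V a; have v2 := V b.
rewrite !lexx ab cd in h1 h2 v1 v2.
have e1 := h1 isT; have e2 := h2 isT; have e3 := v1 isT; have e4 := v2 isT.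
have -> : 2 * M * (b - a + (d - c)) = M * (b - a) + M * (d - c) + M * (b - a) + M * (d - c).
  by ring.
apply: le_trans (cabsB _ _) _; apply: lerD; last by rewrite cabsM cabs_i mul1r.
apply: le_trans (cabsB _ _) _; apply: lerD => //.
apply: le_trans (cabsD _ _) _; apply: lerD => //.
by rewrite cabsM cabs_i mul1r.
Qed.

Lemma bdryB F G a b c d : a <= b -> c <= d -> hol (rect a b c d) F -> hol (rect a b c d) G ->
  bdry (fun z => F z - G z) a b c d = bdry F a b c d - bdry G a b c d.
Proof.
move=> ab cd hF hG; rewrite /bdry /hedge /vedge.
rewrite !cintB; try by [apply: rcon_ver hF _; rewrite !lexx ?ab|apply: rcon_ver hG _; rewrite !lexx ?ab
  |apply: rcon_hor hF _; rewrite !lexx ?cd|apply: rcon_hor hG _; rewrite !lexx ?cd].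
ring.
Qed.

(** The affine part of F at z0 has a primitive and contributes 0. The rest is at most e times the
    sum of the sides, and the perimeter gives the second factor of that size. *)
Lemma bdry_local F a b c d (z0 l : C) e : a <= b -> c <= d -> 0 <= e ->
  hol (rect a b c d) F -> rect a b c d z0 ->
  (forall z, rect a b c d z -> cabs (F z - F z0 - l * (z - z0)) <= e * cabs (z - z0)) ->
  cabs (bdry F a b c d) <= 2 * e * ((b - a) + (d - c)) ^+ 2.
Proof.
move=> ab cd e0 hF hz0 H.
pose G z := F z0 + l * (z - z0).
pose P z := F z0 * z + l * ((z - z0) ^+ 2 / 2).
have dsub z : cderiv (fun w => w - z0) z 1.
  by have := hasdB (hasd_id setT z) (hasd_cst setT z0 z); rewrite subr0; exact.
have dG z : cderiv G z l.
  have := hasdD (hasd_cst setT (F z0) z) (hasdZ l (dsub z)).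
  by rewrite add0r mulr1; exact.
have dP z : cderiv P z (G z).
  have h1 := hasdZ (F z0) (hasd_id setT z).
  have h2 := hasdM (hasdX 1 (dsub z)) (hasd_cst setT (2^-1) z).
  have := hasdD h1 (hasdZ l h2).
  apply: hasd_eql; rewrite /G expr1; by field.
have hG : hol (rect a b c d) G by move=> z _; exists l; exact: dG.
have hr : hol (rect a b c d) (fun z => F z - G z).
  by move=> z /hF[m hm]; exists (m - l); exact: hasdB (dG z).
have := bdryB ab cd hF hG; rewrite (bdry_primitive ab cd hG (fun z _ => dP z)) subr0 => <-.
apply: le_trans (bdry_bnd (M := e * ((b - a) + (d - c))) ab cd hr _) _; last first.
  by rewrite le_eqVlt; apply/orP; left; apply/eqP; ring.
move=> z hz; rewrite /G opprD addrA; apply: le_trans (H z hz) _.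
rewrite ler_wpM2l//; apply: le_trans (cabs_le _) _; rewrite ReB ImB.
move: hz hz0 => [/andP[? ?] /andP[? ?]] [/andP[? ?] /andP[? ?]].
by apply: lerD; rewrite ler_norml; apply/andP; split; lra.
Qed.

Definition half (I : R * R) (k : bool) : R * R :=
  let m := (I.1 + I.2) / 2 in if k then (m, I.2) else (I.1, m).

Definition bQ F (Q : (R * R) * (R * R)) := bdry F Q.1.1 Q.1.2 Q.2.1 Q.2.2.
Definition rectQ (Q : (R * R) * (R * R)) := rect Q.1.1 Q.1.2 Q.2.1 Q.2.2.

(** Goursat's choice of a quarter that carries at least a fourth of the contour integral. The last
    quarter is the default: [qnext_ge] shows that it qualifies when the other three fail. *)
Definition qnext F (Q : (R * R) * (R * R)) : (R * R) * (R * R) :=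
  let good i j := cabs (bQ F Q) <= 4 * cabs (bQ F (half Q.1 i, half Q.2 j)) in
  if good false false then (half Q.1 false, half Q.2 false)
  else if good false true then (half Q.1 false, half Q.2 true)
  else if good true false then (half Q.1 true, half Q.2 false)
  else (half Q.1 true, half Q.2 true).

Lemma qnextE F Q : exists i j, qnext F Q = (half Q.1 i, half Q.2 j).
Proof.
rewrite /qnext; case: ifP => _; first by exists false, false.
case: ifP => _; first by exists false, true.
case: ifP => _; first by exists true, false.
by exists true, true.
Qed.

Lemma half_mid (I : R * R) : I.1 <= I.2 -> I.1 <= (I.1 + I.2) / 2 <= I.2.
Proof. by move=> h; apply/andP; split; lra. Qed.

Lemma half_spec (I : R * R) k : I.1 <= I.2 ->
  [/\ I.1 <= (half I k).1, (half I k).2 <= I.2, (half I k).1 <= (half I k).2 &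
   (half I k).2 - (half I k).1 = (I.2 - I.1) / 2].
Proof. by move=> h; case: k => /=; split; lra. Qed.

Lemma qnext_ge F Q : Q.1.1 <= Q.1.2 -> Q.2.1 <= Q.2.2 -> hol (rectQ Q) F ->
  cabs (bQ F Q) <= 4 * cabs (bQ F (qnext F Q)).
Proof.
case: Q => [[a b] [c d]] /= ab cd hF.
have [am mb] := andP (half_mid (I := (a, b)) ab).
have [cm md] := andP (half_mid (I := (c, d)) cd).
simpl in am, mb, cm, md.
rewrite /qnext /=; case: ifP => //= /negbT; rewrite -ltNge => h1.
case: ifP => //= /negbT; rewrite -ltNge => h2.
case: ifP => //= /negbT; rewrite -ltNge => h3.
rewrite leNgt; apply/negP => h4.
set B := bQ F (a, b, (c, d)) in h1 h2 h3 h4.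
have : B = bQ F (half (a, b) false, half (c, d) false) +
     bQ F (half (a, b) false, half (c, d) true) +
     (bQ F (half (a, b) true, half (c, d) false) +
     bQ F (half (a, b) true, half (c, d) true)).
  rewrite /B /bQ /= (bdry_hsplit am mb cd hF).
  rewrite (bdry_vsplit am cm md); last first.
    by apply: hol_sub hF => z [/andP[? ?] ?]; split=> //; apply/andP; split=> //; apply: le_trans mb.
  rewrite (bdry_vsplit mb cm md)//.
  by apply: hol_sub hF => z [/andP[? ?] ?]; split=> //; apply/andP; split=> //; apply: le_trans am _.
move=> /(congr1 (@cabs R)) hB.
have := cabsD (bQ F (half (a, b) false, half (c, d) false) +
     bQ F (half (a, b) false, half (c, d) true))
     (bQ F (half (a, b) true, half (c, d) false) +
     bQ F (half (a, b) true, half (c, d) true)).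
rewrite -hB.
have := cabsD (bQ F (half (a, b) false, half (c, d) false))
     (bQ F (half (a, b) false, half (c, d) true)).
have := cabsD (bQ F (half (a, b) true, half (c, d) false))
     (bQ F (half (a, b) true, half (c, d) true)).
move: h1 h2 h3 h4; lra.
Qed.

Lemma nested_point (u v : nat -> R) : (forall n, u n <= u n.+1) ->
  (forall n, v n.+1 <= v n) -> (forall n, u n <= v n) ->
  exists x, forall n, u n <= x <= v n.
Proof.
move=> hu hv uv.
have um n k : u n <= u (n + k)%N.
  by elim: k => [|k ih]; rewrite ?addn0// addnS (le_trans ih).
have vm n k : v (n + k)%N <= v n.
  by elim: k => [|k ih]; rewrite ?addn0// addnS (le_trans (hv _)).
have uvm n m : u n <= v m.
  by apply: le_trans (um n m) _; apply: le_trans (uv _) _; rewrite addnC.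
exists (sup (range u)) => n; apply/andP; split.
- apply: sup_upper_bound; last by exists n.
  by split; [exists (u 0%N), 0%N|exists (v 0%N) => _ [m _ <-]].
- by apply: ge_sup; [exists (u 0%N), 0%N|move=> _ [m _ <-]].
Qed.

(** After n bisections the integral has grown by at most 4^n relative to the chosen quarter, while
    [bdry_local] gains (2^-n)^2. Only the error e of the linear approximation at the common point
    survives. *)
Theorem goursat F a b c d : a <= b -> c <= d -> hol (rect a b c d) F ->
  bdry F a b c d = 0.
Proof.
move=> ab cd hF.
pose Q n := iter n (qnext F) ((a, b), (c, d)).
have Qord n : (Q n).1.1 <= (Q n).1.2 /\ (Q n).2.1 <= (Q n).2.2.
  elim: n => [//|n [i1 i2]]; rewrite /Q iterS -/(Q n).
  have [i [j ->]] := qnextE F (Q n).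
  by have [_ _ ? _] := half_spec i i1; have [_ _ ? _] := half_spec j i2.
have Qstep n : [/\ (Q n).1.1 <= (Q n.+1).1.1, (Q n.+1).1.2 <= (Q n).1.2,
    (Q n).2.1 <= (Q n.+1).2.1 & (Q n.+1).2.2 <= (Q n).2.2] /\
    ((Q n.+1).1.2 - (Q n.+1).1.1 = ((Q n).1.2 - (Q n).1.1) / 2 /\
    (Q n.+1).2.2 - (Q n.+1).2.1 = ((Q n).2.2 - (Q n).2.1) / 2).
  have [i1 i2] := Qord n; have -> : Q n.+1 = qnext F (Q n) by [].
  have [i [j ->]] := qnextE F (Q n).
  by have [? ? _ ?] := half_spec i i1; have [? ? _ ?] := half_spec j i2.
have Qsub n : rectQ (Q n) `<=` rect a b c d.
  elim: n => [//|n ih]; apply: subset_trans ih => z [/andP[? ?] /andP[? ?]].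
  have [[? ? ? ?] _] := Qstep n; split; apply/andP; split.
  - by apply: le_trans; first eassumption.
  - by apply: le_trans; last eassumption.
  - by apply: le_trans; first eassumption.
  - by apply: le_trans; last eassumption.
have Qhol n : hol (rectQ (Q n)) F by exact: hol_sub (@Qsub n) hF.
have Qb n : cabs (bdry F a b c d) <= 4 ^+ n * cabs (bQ F (Q n)).
  elim: n => [|n ih]; first by rewrite mul1r.
  apply: le_trans ih _; rewrite exprSr -mulrA ler_wpM2l ?exprn_ge0//.
  rewrite /Q iterS -/(Q n); have [i1 i2] := Qord n; exact: qnext_ge.
pose L := (b - a) + (d - c).
have QL n : ((Q n).1.2 - (Q n).1.1) + ((Q n).2.2 - (Q n).2.1) = L / 2 ^+ n.
  elim: n => [|n ih]; first by rewrite divr1.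
  have [_ [-> ->]] := Qstep n; rewrite -mulrDl ih exprSr invfM mulrA//.
have [|||x hx] := @nested_point (fun n => (Q n).1.1) (fun n => (Q n).1.2).
- by move=> n; have [[]] := Qstep n.
- by move=> n; have [[]] := Qstep n.
- by move=> n; have [] := Qord n.
have [|||y hy] := @nested_point (fun n => (Q n).2.1) (fun n => (Q n).2.2).
- by move=> n; have [[]] := Qstep n.
- by move=> n; have [[]] := Qstep n.
- by move=> n; have [] := Qord n.
pose z0 : C := x +i* y.
have z0Q n : rectQ (Q n) z0 by split; [exact: hx|exact: hy].
have [l hl] := hF z0 (Qsub 0%N _ (z0Q 0%N)).
apply/eqP; rewrite -cabs_eq0; apply/eqP/le_anti; rewrite cabs_ge0 andbT.
have L0 : 0 <= L by rewrite /L; move: ab cd; lra.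
apply/ler_addgt0Pl => e e0; rewrite addr0.
(* With [L ^+ 2 + 1] the quotient makes sense for a degenerate rectangle too, where L = 0; the final
   bound is e L^2 / (L^2 + 1) <= e. *)
have K0 : 0 < 2 * (L ^+ 2 + 1) by rewrite mulr_gt0// ltr_pwDr ?sqr_ge0.
have [dd dd0 hdd] := hl _ (divr_gt0 e0 K0).
have [n hn] : exists n, L / 2 ^+ n < dd.
  have [N HN] := nat_lt_bnd ((L + 1) / dd); exists N.
  rewrite ltr_pdivrMr ?exprn_gt0//; apply: (@lt_le_trans _ _ (dd * N%:R)).
    have := HN N (leqnn N); rewrite ler_pdivrMr// mulrC => h.
    by apply: lt_le_trans h; rewrite ltrDl.
  rewrite ler_pM2l// -natrX ler_nat; exact/ltnW/ltn_expl.
apply: le_trans (Qb n) _.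
have [i1 i2] := Qord n.
have hb : cabs (bQ F (Q n)) <= 2 * (e / (2 * (L ^+ 2 + 1))) * (L / 2 ^+ n) ^+ 2.
  rewrite -QL; apply: (@bdry_local _ _ _ _ _ z0 l) => //; first by rewrite ltW// divr_gt0.
    exact: Qhol.
  move=> z [zr zi]; have := hdd (z - z0) I.
  rewrite (_ : z0 + (z - z0) = z); last by ring.
  apply; apply: le_lt_trans hn; rewrite -QL.
  apply: le_trans (cabs_le _) _; rewrite ReB ImB.
  move: zr zi (hx n) (hy n) => /andP[? ?] /andP[? ?] /andP[? ?] /andP[? ?] /=.
  by apply: lerD; rewrite ler_norml; apply/andP; split; lra.
apply: le_trans (ler_wpM2l (exprn_ge0 n _) hb) _ => //.
have -> : 4 ^+ n * (2 * (e / (2 * (L ^+ 2 + 1))) * (L / 2 ^+ n) ^+ 2) = e * (L ^+ 2 / (L ^+ 2 + 1)).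
  have -> : 4 = 2 ^+ 2 :> R by rewrite expr2; ring.
  rewrite -exprM mulnC exprM.
  field; rewrite expf_neq0//= gt_eqF//.
  by rewrite ltr_pwDr ?sqr_ge0.
rewrite ler_piMr ?(ltW e0)// ler_pdivrMr ?mul1r ?lerDl// ltr_pwDr ?sqr_ge0//.
Qed.

End Goursat.

(** * Moving lines of integration and changing variables on the line *)

Section Shift.
Variable R : realType.
Local Notation C := (Cplx R).
Local Notation mu := (@lebesgue_measure R).
Implicit Types (F : C -> C) (a b c d s t e M : R).

Lemma ker_small e : 0 < e -> exists N, forall n, (N <= n)%N -> @ker R n%:R <= e.
Proof.
move=> e0; have [N HN] := nat_lt_bnd (e^-1); exists N => n /HN h.
have o0 : 0 < oneDsqr n%:R :> R by rewrite /oneDsqr ltr_pwDl ?sqr_ge0.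
rewrite /ker -[leRHS]invrK lef_pV2 ?posrE ?invr_gt0//.
apply: le_trans h _; rewrite /oneDsqr expr2.
by clear; case: n => [|n]; rewrite ?addr_ge0// ler_wpDl// ler_peMl// ler1n.
Qed.

Lemma ker_opp t : ker (- t) = ker t.
Proof. by rewrite /ker /oneDsqr sqrrN. Qed.

Lemma seq_lim_bnd (u : nat -> C) (l : C) (v : nat -> R) M :
  (forall n, cabs (u n - l) <= M * v n) -> (forall n, 0 <= v n) ->
  (forall e, 0 < e -> exists N, forall n, (N <= n)%N -> v n <= e) -> seq_lim u l.
Proof.
move=> H v0 hv e e0; have M0 : 0 < `|M| + 1 by rewrite ltr_wpDl.
have [N HN] := hv _ (divr_gt0 e0 M0); exists N => n /HN h.
apply: le_trans (H n) _; apply: (@le_trans _ _ ((`|M| + 1) * v n)).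
  rewrite ler_wpM2r//; apply: le_trans (ler_norm _) _; by rewrite lerDl.
by rewrite mulrC -ler_pdivlMr.
Qed.

(** Cauchy's theorem on [a, b] x [-n, n]: each horizontal edge is at most M (b - a) [ker] n and
    disappears in the limit. *)
Lemma shift_ver F a b M : a <= b ->
  hol [set z | a <= Re z <= b] F ->
  (forall s t, a <= s <= b -> cabs (F (s +i* t)) <= M * ker t) ->
  cI (fun t => F (a +i* t)) = cI (fun t => F (b +i* t)).
Proof.
move=> ab hF FM.
have hR n : hol (rect a b (- n) n) F by apply: hol_sub hF => z [].
have aab : a <= a <= b by rewrite lexx.
have bab : a <= b <= b by rewrite lexx ab.
have mF s : a <= s <= b -> cmeas (fun t => F (s +i* t)).
  move=> sab; apply: cmeas_rcont => c d t _.
  by have [|l hl] := hF (s +i* t); [|exact: rderiv_cont (rderiv_ver hl)].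
have la := cI_exhaustT (mF a aab) (fun t => FM a t aab).
have lb := cI_exhaustT (mF b bab) (fun t => FM b t bab).
have := seq_limB la lb; set A := cI _; set B := cI _ => l1.
apply/eqP; rewrite -subr_eq0; apply/eqP; apply: (seq_lim_unique l1).
apply: (@seq_lim_bnd _ _ (fun n => ker n%:R) (2 * (M * (b - a)))).
- move=> n; rewrite subr0.
  have nn : - n%:R <= n%:R :> R by rewrite lerNl (le_trans _ (ler0n _ n))// oppr_le0.
  have := goursat ab nn (hR n%:R); rewrite /bdry /vedge => hB.
  have -> : cint (- n%:R) n%:R (fun t => F (a +i* t)) - cint (- n%:R) n%:R (fun t => F (b +i* t)) =
    - 'i * (hedge F (- n%:R) a b - hedge F n%:R a b).
    have i2 : ('i : C) * 'i = -1 by rewrite -expr2 sqr_i.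
    move: hB; set X := cint _ _ _; set Y := cint _ _ _; set H1 := hedge _ _ _ _; set H2 := hedge _ _ _ _ => hB.
    have -> : H1 - H2 = 'i * Y - 'i * X.
      by apply/eqP; rewrite -subr_eq0; apply/eqP; rewrite -hB; ring.
    have -> : - 'i * ('i * Y - 'i * X) = - ('i * 'i) * (Y - X) by ring.
    by rewrite i2; ring.
  rewrite cabsM cabsN cabs_i mul1r; apply: le_trans (cabsB _ _) _.
  have hb t : t = n%:R \/ t = - n%:R -> cabs (hedge F t a b) <= M * (b - a) * ker n%:R.
    move=> ht; have tn : - n%:R <= t <= n%:R.
      by case: ht => ->; rewrite lexx ?nn.
    rewrite mulrAC; apply: cint_bnd => //; first exact: rcon_hor (hR n%:R) tn.
    move=> s /(FM s t); case: ht => -> //.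
    by rewrite ker_opp.
  have -> : 2 * (M * (b - a)) * ker n%:R = M * (b - a) * ker n%:R + M * (b - a) * ker n%:R :> R by ring.
  by apply: lerD; apply: hb; [right|left].
- by move=> n; exact: ker_ge0.
- exact: ker_small.
Qed.

Lemma shift_hor F c d M : c <= d ->
  hol [set z | c <= Im z <= d] F ->
  (forall s t, c <= t <= d -> cabs (F (s +i* t)) <= M * ker s) ->
  cI (fun s => F (s +i* c)) = cI (fun s => F (s +i* d)).
Proof.
move=> cd hF FM.
(* The rotation by - i exchanges horizontal and vertical lines. The line Im z = c becomes Re z = -
   c, so the order of the two lines is reversed. *)
pose G (z : C) := F (- ('i : C) * z).
have Gz s t : G (s +i* t) = F (t +i* (- s)).
  by rewrite /G; congr F; apply: cplx_ext; rewrite ?ReM ?ImM ReN ImN /=; ring.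
have := @shift_ver G (- d) (- c) M.
rewrite lerN2 => /(_ cd) H.
rewrite (_ : (fun s => F (s +i* c)) = (fun t => G (- c +i* t))); last first.
  by apply/funext => t; rewrite Gz opprK.
rewrite (_ : (fun s => F (s +i* d)) = (fun t => G (- d +i* t))); last first.
  by apply/funext => t; rewrite Gz opprK.
apply/esym/H.
- move=> z /andP[z1 z2]; have [|l hl] := hF (- ('i : C) * z).
    change (c <= Im (- ('i : C) * z) <= d).
    have -> : Im (- ('i : C) * z) = - Re z by rewrite ImM ReN ImN /=; ring.
    by apply/andP; split; lra.
  by exists (l * (- ('i : C) * 1)); apply: (hasd_comp hl); apply: hasdZ; exact: hasd_id.
- by move=> s t /andP[s1 s2]; rewrite Gz; apply: FM; apply/andP; split; lra.
Qed.

Lemma rcon_global (f : R -> C) : (forall x, exists l, rderiv f x l) -> rcont f.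
Proof. by move=> h a b x _; have [l hl] := h x; exact: rderiv_cont hl. Qed.

Lemma cI_subst (f : R -> C) (p p' : R -> R) M M' :
  rcont f -> dom M f -> dom M' (fun t => f (p t) * (p' t)%:C) ->
  (forall x y, x < y -> p x < p y) -> continuous p' ->
  (forall x : R, is_derive x 1 p (p' x)) ->
  (forall t, exists N, forall n, (N <= n)%N -> p (- n%:R) <= t <= p n%:R) ->
  cI f = cI (fun t => f (p t) * (p' t)%:C).
Proof.
move=> cf df dg ip cp' dp hp.
have cp : continuous p.
  move=> x; apply: differentiable_continuous; apply/derivable1_diffP.
  exact: (@ex_derive _ _ _ _ _ _ _ (dp x)).
have mg : cmeas (fun t => f (p t) * (p' t)%:C).
  apply: cmeasM; first exact: cmeas_rcont (rcont_comp cf cp).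
  exact: cmeas_rcont (rcont_real cp').
have l1 := cI_exhaust (cmeas_rcont cf) df hp.
have l2 := cI_exhaustT mg dg.
apply: seq_lim_unique l1 _; move: l2.
rewrite (_ : (fun n => cint (- n%:R) n%:R _) = (fun n => cint (p (- n%:R)) (p n%:R) f))//.
apply/funext => n; rewrite (@cint_subst _ f p p')//.
by rewrite lerNl (le_trans _ (ler0n _ n))// oppr_le0.
Qed.

Lemma cI_affine (f : R -> C) M M' a b : 0 < b -> rcont f -> dom M f ->
  dom M' (fun t => f (a + b * t)) ->
  cI f = b%:C * cI (fun t => f (a + b * t)).
Proof.
move=> b0 cf df dg.
have cp : continuous (fun t => a + b * t).
  move=> x; apply: continuousD; first exact: cst_continuous.
  by apply: continuousM; [exact: cst_continuous|exact: cvg_id].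
have mg : cmeas (fun t => f (a + b * t)) by exact: cmeas_rcont (rcont_comp cf cp).
rewrite -cIZ; last exact: ci_dom mg dg.
transitivity (cI (fun t => f (a + b * t) * b%:C)); last first.
  by congr cI; apply/funext => t; rewrite mulrC.
apply: (@cI_subst f (fun t => a + b * t) (fun=> b) M (M' * b) cf df).
- move=> t; by rewrite cabsM cabs_real (gtr0_norm b0) mulrAC ler_wpM2r ?(ltW b0)//; exact: dg.
- by move=> x y xy; rewrite ltrD2l ltr_pM2l.
- by move=> x; exact: cst_continuous.
- move=> x; apply/is_derive_epsP => e e0; exists 1 => // h _.
  rewrite (_ : _ - _ - _ = 0); last by ring.
  by rewrite normr0 mulr_ge0// ltW.
- move=> t; have [N1 h1] := nat_lt_bnd ((t - a) / b); have [N2 h2] := nat_lt_bnd ((a - t) / b).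
  exists (maxn N1 N2) => n; rewrite geq_max => /andP[/h1 + /h2].
  rewrite !ler_pdivrMr// => k1 k2; apply/andP; split; move: k1 k2; rewrite ?[b * _]mulrC; lra.
Qed.

Lemma cint_opp (f : R -> C) a b : rcont f ->
  cint (- b) (- a) f = cint a b (fun t => f (- t)).
Proof.
move=> cf; have [ab|ab] := leP a b; last first.
  rewrite /cint; congr cI; apply/funext => t; rewrite /rest.
  case: ifP => [/andP[h1 h2]|_]; first by move: (le_trans h1 h2); rewrite lerN2 leNgt ab.
  by case: ifP => // /andP[h1 h2]; move: (le_trans h1 h2); rewrite leNgt ab.
apply: cplx_ext; rewrite ?cint_Re ?cint_Im /Rintegral.
- congr fine; rewrite integration_by_substitution_oppr//.
  by have [] := rcon_within (cf (- b) (- a)).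
- congr fine; rewrite integration_by_substitution_oppr//.
  by have [] := rcon_within (cf (- b) (- a)).
Qed.

End Shift.

(** * Exponential decay measured against the majorant 1 / (1 + t^2) *)

Section Decay.
Variable R : realType.
Local Notation C := (Cplx R).
Implicit Types (a b c s t u x y : R).

Lemma expR_ge_pow n x : 0 <= x -> x ^+ n <= (n`!)%:R * expR x.
Proof.
case: n => [|n] x0; first by rewrite fact0 mul1r expr0 -expR0 ler_expR.
have := @expR_ge1Dxn R x n x0; have f0 : 0 < (n.+1`!)%:R :> R by rewrite ltr0n fact_gt0.
move=> h; rewrite mulrC -ler_pdivrMr//; apply: le_trans h.
by rewrite lerDr.
Qed.

Lemma pow_exp_ker n c : 0 < c -> exists M, forall t, 0 <= t ->
  t ^+ n * expR (- (c * t)) <= M * ker t.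
Proof.
(* The two constants bound t^n e^(-ct) and t^(n+2) e^(-ct), the two terms that arise on
   multiplication by 1 + t^2. *)
move=> c0; exists ((n`!)%:R / c ^+ n + (n.+2`!)%:R / c ^+ n.+2) => t t0.
rewrite /ker ler_pdivlMr; last by rewrite /oneDsqr ltr_pwDl ?sqr_ge0.
have H k : t ^+ k * expR (- (c * t)) <= (k`!)%:R / c ^+ k.
  rewrite expRN ler_pdivrMr ?expR_gt0// mulrAC ler_pdivlMr ?exprn_gt0//.
  by rewrite -exprMn [t * c]mulrC; apply: expR_ge_pow; rewrite mulr_ge0// ltW.
rewrite /oneDsqr mulrDr mulr1; apply: lerD => //.
by rewrite mulrAC -exprD addn2.
Qed.

Lemma exp_abs_ker c : 0 < c -> exists M, forall t, expR (- (c * `|t|)) <= M * ker t.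
Proof.
move=> /(pow_exp_ker 0)[M HM]; exists M => t.
have := HM `|t| (normr_ge0 t); rewrite expr0 mul1r => /le_trans; apply.
by rewrite /ker /oneDsqr real_normK ?num_real.
Qed.

(* The left-hand side is |t^r e^(-pt)| for t = e^s, a = Re r and c = Re p. *)
Lemma gamma_ker a c : 0 < a -> 0 < c -> exists M, forall s,
  expR (a * s - c * expR s) <= M * ker s.
Proof.
move=> a0 c0; have [M1 H1] := exp_abs_ker a0.
pose n := Num.bound a; have an : a <= n%:R by exact/ltW/archi_boundP/ltW.
have [M2 H2] := pow_exp_ker n c0.
have M10 : 0 <= M1.
  by have := le_trans (expR_ge0 _) (H1 0); rewrite pmulr_lge0 ?ker_gt0.
have M20 : 0 <= M2.
  have := le_trans (mulr_ge0 (exprn_ge0 n (lexx 0)) (expR_ge0 _)) (H2 0 (lexx _)).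
  by rewrite pmulr_lge0 ?ker_gt0.
exists (M1 + M2) => s; have k0 := ker_ge0 s; have [s0|s0] := leP s 0.
  apply: (@le_trans _ _ (M1 * ker s)); last by rewrite ler_wpM2r// lerDl.
  apply: le_trans (H1 s); rewrite ler_expR ler0_norm// mulrN opprK.
  by rewrite lerBlDr lerDl mulr_ge0 ?expR_ge0 ?ltW.
apply: (@le_trans _ _ (M2 * ker s)); last by rewrite ler_wpM2r// lerDr.
have es : s <= expR s by apply: le_trans (expR_ge1Dx s); rewrite lerDr.
apply: (@le_trans _ _ (M2 * ker (expR s))); last first.
  rewrite ler_wpM2l// /ker lef_pV2 ?posrE ?oneDsqr_gt0//.
  by rewrite /oneDsqr lerD2l !expr2 ler_pM// ltW.
apply: le_trans (H2 (expR s) (expR_ge0 s)).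
rewrite expRD ler_wpM2r ?expR_ge0// -expRM_natl ler_expR.
by rewrite ler_wpM2r// ltW.
Qed.

End Decay.

(** * Integrals over the half-line and the substitution t = e^s *)

Section HalfLineIntegral.
Variable R : realType.
Local Notation C := (Cplx R).
Local Notation mu := (@lebesgue_measure R).
Implicit Types (f g : R -> C) (a b c s t u x y M : R).

(** The half-line is open at 0 because integrands such as u^(r-1) may be singular there. *)
Definition onpos (f : R -> C) t : C := if 0 < t then f t else 0.

Lemma cmeas_onpos f : cmeas f -> cmeas (onpos f).
Proof.
by move=> mf; apply: cmeas_if; [exact: measurable_gt|exact: mf|exact: cmeas_cst].
Qed.

Lemma cI_FTC0 f g M : (forall x, 0 <= x -> rderiv f x (g x)) ->
  (forall b, rcon 0 b g) -> cmeas g -> dom M (onpos g) ->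
  (forall e : R, 0 < e -> exists N, forall n, (N <= n)%N -> cabs (f n%:R) <= e) ->
  cI (onpos g) = - f 0.
Proof.
move=> df cg mg dg f0.
have l1 : seq_lim (fun n => cint (- n%:R) n%:R (onpos g)) (cI (onpos g)).
  exact: cI_exhaustT (cmeas_onpos mg) dg.
apply: seq_lim_unique l1 _.
(* [onpos] omits the endpoint 0, which [rest 0 n] keeps: the integrands agree off the null set
   {0}. *)
have E n : cint (- n%:R) n%:R (onpos g) = f n%:R - f 0.
  have n0 : 0 <= n%:R :> R by rewrite ler0n.
  rewrite -(@cFTC _ f g 0 n%:R)//; last by move=> x /andP[x0 _]; exact: df.
  rewrite /cint /cI /cintegral; congr (_ +i* _); rewrite /Rintegral; congr fine.
  - apply: ae_eq_integral => //.
    + apply/measurable_EFinP; have [] // := cmeas_rest (- n%:R) n%:R (cmeas_onpos mg).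
    + apply/measurable_EFinP; have [] // := cmeas_rest 0 n%:R mg.
    + exists [set 0]; split; [exact: measurable_set1|exact: lebesgue_measure_set1|].
      move=> t /= ht; apply: contrapT => t0; apply: ht => _; rewrite /rest /onpos.
      congr (Re _)%:E; have [tn|tn] := leP t n%:R; rewrite ?andbF// !andbT.
      have [tp|tp] := ltP 0 t; first by rewrite (ltW tp) (le_trans _ (ltW tp))// lerNl oppr0.
      have [tz|tz] := leP 0 t; last by case: ifP.
      by exfalso; apply: t0; apply/eqP; rewrite eq_le tp tz.
  - apply: ae_eq_integral => //.
    + apply/measurable_EFinP; have [] // := cmeas_rest (- n%:R) n%:R (cmeas_onpos mg).
    + apply/measurable_EFinP; have [] // := cmeas_rest 0 n%:R mg.
    + exists [set 0]; split; [exact: measurable_set1|exact: lebesgue_measure_set1|].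
      move=> t /= ht; apply: contrapT => t0; apply: ht => _; rewrite /rest /onpos.
      congr (Im _)%:E; have [tn|tn] := leP t n%:R; rewrite ?andbF// !andbT.
      have [tp|tp] := ltP 0 t; first by rewrite (ltW tp) (le_trans _ (ltW tp))// lerNl oppr0.
      have [tz|tz] := leP 0 t; last by case: ifP.
      by exfalso; apply: t0; apply/eqP; rewrite eq_le tp tz.
move=> e e0; have [N HN] := f0 e e0; exists N => n /HN h.
by rewrite E opprK subrK.
Qed.

(* The substitution t = e^s, where only the transformed integrand is
   controlled: the integrand may be singular at 0. *)
Lemma R_subst_exp (h : R -> R) M : measurable_fun setT h ->
  (forall t, 0 < t -> {for t, continuous h}) -> (forall t, 0 <= h t) ->
  (forall s, h (expR s) * expR s <= M * ker s) ->
  mu.-integrable setT (EFin \o (fun t => if 0 < t then h t else 0)).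
Proof.
move=> mh ch h0 hM.
pose H t := if 0 < t then h t else 0.
(* Integrability is what has to be proved, so there is no majorant yet: the substitution is made on
   [e^(-n), e^n], and monotone convergence removes the truncation. *)
pose u n : R := expR (- n%:R); pose v n : R := expR n%:R.
pose g n t := if u n <= t <= v n then h t else 0.
have mH : measurable_fun setT H.
  by apply: measurable_fun_ifT => //; exact: measurable_gt.
have mg n : measurable_fun setT (g n).
  by apply: measurable_fun_ifT => //; exact: measurable_rest_cond.
have g0 n t : 0 <= g n t by rewrite /g; case: ifP.
have gn t : {homo (fun n => (g n t)%:E) : n m / (n <= m)%N >-> (n <= m)%E}.
  move=> n m nm; rewrite lee_fin /g; case: ifP => [/andP[h1 h2]|_]; last by case: ifP.
  rewrite ifT//; apply/andP; split; first by apply: le_trans h1; rewrite ler_expR lerN2 ler_nat.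
  by apply: le_trans h2 _; rewrite ler_expR ler_nat.
have gl t : (fun n => (g n t)%:E) @ \oo --> (H t)%:E.
  rewrite /H; have [t0|t0] := ltP 0 t.
    apply: cvg_near_cst; have [N1 n1] := nat_lt_bnd (ln t); have [N2 n2] := nat_lt_bnd (- ln t).
    exists (maxn N1 N2) => // n /=; rewrite geq_max => /andP[/n1 a1 /n2 a2].
    rewrite /g ifT// /u /v -{1 2}(lnK t0) !ler_expR a1 andbT.
    by rewrite lerNl.
  apply: cvg_near_cst; exists 0%N => // n _ /=; rewrite /g; case: ifP => // /andP[h1 _].
  by have := lt_le_trans (expR_gt0 _) (le_trans h1 t0); rewrite ltxx.
have gb n : (\int[mu]_t (g n t)%:E <= (M * pi)%:E)%E.
  have nn : - n%:R <= n%:R :> R by rewrite lerNl (le_trans _ (ler0n _ n))// oppr_le0.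
  have -> : (\int[mu]_t (g n t)%:E = \int[mu]_(t in `[u n, v n]) (h t)%:E)%E.
    rewrite [RHS]integral_mkcond; apply: eq_integral => t _.
    by rewrite patchE mem_setE in_itv /= /g; case: ifP.
  rewrite (@eint_subst R h expR expR)//; last 3 first.
  - by move=> x y xy; rewrite ltr_expR.
  - exact: continuous_expR.
  - apply: continuous_in_subspaceT => x; rewrite inE /= in_itv /= => /andP[ux _].
    by apply: ch; apply: lt_le_trans ux; exact: expR_gt0.
  apply: (@le_trans _ _ (\int[mu]_(t in `[(- n%:R)%R, n%:R%R]) (M * ker t)%:E)%E).
    apply: ge0_le_integral => //.
    - by move=> t _; rewrite lee_fin mulr_ge0 ?expR_ge0.
    - apply/measurable_EFinP; apply: measurable_funTS; apply: measurable_funM.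
        exact: (measurableT_comp mh (@measurable_expR R)).
      exact: measurable_expR.
    - apply/measurable_EFinP; apply: measurable_funTS; apply: measurable_funM => //.
      exact: measurable_ker.
    - by move=> t _; rewrite lee_fin.
  apply: (@le_trans _ _ (\int[mu]_t (M * ker t)%:E)%E).
    apply: ge0_subset_integral => //.
    - apply/measurable_EFinP; apply: measurable_funM => //; exact: measurable_ker.
    - by move=> t _; rewrite lee_fin; apply: le_trans (hM t); rewrite mulr_ge0 ?expR_ge0.
  have M0 : 0 <= M.
    have := le_trans (mulr_ge0 (h0 (expR 0)) (expR_ge0 0)) (hM 0).
    by rewrite pmulr_lge0 ?ker_gt0.
  under eq_integral do rewrite EFinM.
  rewrite ge0_integralZl//.
  - by rewrite eintegral_ker.
  - by apply/measurable_EFinP; exact: measurable_ker.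
  - by move=> t _; rewrite lee_fin ker_ge0.
apply/integrableP; split; first exact/measurable_EFinP.
have Habs t : `|(EFin \o H) t|%E = (H t)%:E.
  by rewrite /= ger0_norm// /H; case: ifP.
under eq_integral do rewrite Habs.
apply: (@le_lt_trans _ _ (M * pi)%:E); last by rewrite ltry.
have mgE n : measurable_fun setT (fun t => (g n t)%:E) by exact/measurable_EFinP.
have := @monotone_convergence _ _ R mu setT measurableT (fun n t => (g n t)%:E)
  mgE (fun n t _ => g0 n t) (fun t _ => gn t).
have := @cvg_monotone_convergence _ _ R mu setT measurableT (fun n t => (g n t)%:E)
  mgE (fun n t _ => g0 n t) (fun t _ => gn t).
under eq_integral => t _ do rewrite (cvg_lim _ (gl t))//.
move=> cv ->; apply: lime_le; first by apply/cvg_ex; eexists; exact: cv.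
by exists 0%N => // n _; exact: gb.
Qed.

(** Integrability comes first, from [R_subst_exp] for |Re f| and |Im f|. Their sum then dominates
    the truncations of f to [e^(-n), e^n]. *)
Lemma cI_subst_exp f M : cmeas f ->
  (forall a b, 0 < a -> rcon a b f) ->
  dom M (fun s => f (expR s) * (expR s)%:C) ->
  ci (onpos f) /\ cI (onpos f) = cI (fun s => f (expR s) * (expR s)%:C).
Proof.
move=> mf cf df.
have cf1 t : 0 < t -> {for t, continuous (fun t => `|Re (f t)|)}.
  move=> t0; have [|k _] := cf t t t0 t; first by rewrite lexx.
  by apply: (@continuous_comp _ _ _ (fun t => Re (f t)) (fun x => `|x|)) k _; exact: norm_continuous.
have cf2 t : 0 < t -> {for t, continuous (fun t => `|Im (f t)|)}.
  move=> t0; have [|_ k] := cf t t t0 t; first by rewrite lexx.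
  by apply: (@continuous_comp _ _ _ (fun t => Im (f t)) (fun x => `|x|)) k _; exact: norm_continuous.
have [m1 m2] := mf.
have i1 : mu.-integrable setT (EFin \o (fun t => if 0 < t then `|Re (f t)| else 0)).
  apply: (@R_subst_exp (fun t => `|Re (f t)|) M) => //.
  - exact: measurableT_comp.
  - move=> s; apply: le_trans (df s); rewrite cabsM cabs_real (ger0_norm (expR_ge0 _)).
    by rewrite ler_wpM2r ?expR_ge0// Re_le_cabs.
have i2 : mu.-integrable setT (EFin \o (fun t => if 0 < t then `|Im (f t)| else 0)).
  apply: (@R_subst_exp (fun t => `|Im (f t)|) M) => //.
  - exact: measurableT_comp.
  - move=> s; apply: le_trans (df s); rewrite cabsM cabs_real (ger0_norm (expR_ge0 _)).
    by rewrite ler_wpM2r ?expR_ge0// Im_le_cabs.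
pose G t := (if 0 < t then `|Re (f t)| else 0) + (if 0 < t then `|Im (f t)| else 0).
have iG : mu.-integrable setT (EFin \o G).
  by have := integrableD measurableT i1 i2; exact.
have fG t : cabs (onpos f t) <= G t.
  rewrite /onpos /G; case: ifP => _; first exact: cabs_le.
  by rewrite cabs0 addr0.
have mo := cmeas_onpos mf.
split; first exact: ci_bnd mo iG fG.
have mg : cmeas (fun s => f (expR s) * (expR s)%:C).
  apply: cmeasM; first exact: (cmeas_comp (@measurable_expR R) mf).
  by apply: cmeas_real; exact: measurable_expR.
have l2 := cI_exhaustT mg df.
apply: seq_lim_unique _ l2.
have G0 t : 0 <= G t by apply: le_trans (fG t); exact: cabs_ge0.
have l1 : seq_lim (fun n => cI (rest (expR (- n%:R)) (expR n%:R) (onpos f))) (cI (onpos f)).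
  apply: (@cI_dctg _ _ _ G) => //.
  - by move=> n; exact: cmeas_rest.
  - by move=> n t; rewrite /rest; case: ifP => // _; rewrite cabs0.
  - move=> t e e0; have [t0|t0] := ltP 0 t; last first.
      exists 0%N => n _; rewrite /rest /onpos ltNge t0 /=; case: ifP => _;
      by rewrite subrr cabs0 ltW.
    have [N1 n1] := nat_lt_bnd (ln t); have [N2 n2] := nat_lt_bnd (- ln t).
    exists (maxn N1 N2) => n; rewrite geq_max => /andP[/n1 a1 /n2 a2].
    by rewrite /rest -{1 2}(lnK t0) !ler_expR a1 lerNl a2 /= subrr cabs0 ltW.
move: l1; rewrite (_ : (fun n => cI (rest _ _ _)) =
  (fun n => cint (- n%:R) n%:R (fun s => f (expR s) * (expR s)%:C)))//.
apply/funext => n; rewrite -(@cint_subst _ f expR expR)//.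
- rewrite /cint; congr cI; apply/funext => t; rewrite /rest /onpos; case: ifP => // /andP[h1 _].
  by rewrite ifT//; apply: lt_le_trans h1; exact: expR_gt0.
- by rewrite lerNl (le_trans _ (ler0n _ n))// oppr_le0.
- by move=> x y xy; rewrite ltr_expR.
- exact: continuous_expR.
- by apply: cf; exact: expR_gt0.
Qed.

End HalfLineIntegral.

(** * Fourier inversion *)

Section Fourier.
Variable R : realType.
Local Notation C := (Cplx R).
Implicit Types (f g : R -> C) (a b c s t u x y e M : R).

Lemma realCM x y : (x * y)%:C = x%:C * y%:C :> C. Proof. by rewrite rmorphM. Qed.
Lemma realCD x y : (x + y)%:C = x%:C + y%:C :> C. Proof. by rewrite rmorphD. Qed.
Lemma realCN x : (- x)%:C = - x%:C :> C. Proof. by rewrite rmorphN. Qed.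
Lemma rderiv_cexp_aff (q w : C) t :
  rderiv (fun t : R => cexp (q + t%:C * w)) t (w * cexp (q + t%:C * w)).
Proof.
have h1 : rderiv (fun t : R => q + t%:C * w) t w.
  have := hasdD (hasd_cst _ q _) (hasdM (rderiv_real t) (hasd_cst _ w _)).
  by rewrite add0r mul1r mulr0 addr0; exact.
by rewrite mulrC; exact: rderiv_comp_cderiv (cderiv_cexp _) h1.
Qed.

Lemma abel_dom e : 0 < e -> exists2 M, 0 <= M & forall x, expR (- (e * `|x|)) <= M * ker x.
Proof.
move=> /exp_abs_ker[M HM]; exists M => //.
by have := le_trans (expR_ge0 _) (HM 0); rewrite pmulr_lge0 ?ker_gt0.
Qed.

Lemma cexp_small (q : C) : Re q < 0 ->
  seq_lim (fun n => cexp (n%:R%:C * q)) 0.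
Proof.
move=> q0; have q1 : 0 < - Re q by rewrite oppr_gt0.
have [M M0 HM] := abel_dom q1.
apply: (@seq_lim_bnd _ _ _ (fun n => ker n%:R) M).
- move=> n; rewrite subr0 cabs_cexp ReMr; apply: le_trans (HM n%:R).
  by rewrite ler_expR normr_nat mulrC mulNr opprK.
- by move=> n; exact: ker_ge0.
- exact: ker_small.
Qed.

(* The Poisson kernel, from the Abel regularization of the inversion integral. *)
Lemma abel_transform e s : 0 < e ->
  cI (fun x => cexp ('i * (x * s)%:C) * (expR (- (e * `|x|)))%:C) =
  (2 * e / (e ^+ 2 + s ^+ 2))%:C.
Proof.
move=> e0; have [M M0 HM] := abel_dom e0.
set f := (fun x => _).
have cf : rcont f.
  apply: rcontM.
    apply: (@rcont_rderiv _ _ (fun x => ('i * s%:C) * cexp (0 + x%:C * ('i * s%:C)))) => x.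
    apply: (hasd_ext (d0 := 1)) (rderiv_cexp_aff 0 ('i * s%:C) x) => //=.
    - by congr cexp; rewrite rmorphM; ring.
    - by move=> v _ _; congr cexp; rewrite rmorphM; ring.
  apply: rcont_real => x; apply: (@continuous_comp _ _ _ (fun x => - (e * `|x|)) expR).
    by apply: continuousN; apply: continuousM; [exact: cst_continuous|exact: norm_continuous].
  exact: continuous_expR.
have df : dom M f.
  move=> x; rewrite cabsM cabs_cexp cabs_real ger0_norm ?expR_ge0//.
  by rewrite ReM /= !mul0r mulr0 subrr expR0 mul1r.
apply: seq_lim_unique (cI_exhaustT (cmeas_rcont cf) df) _.
(* The integrand is e^(x q1) for x >= 0 and e^(x q2) for x <= 0, with q1 q2 = - (e^2 + s^2). *)
pose q1 : C := - e%:C + 'i * s%:C; pose q2 : C := e%:C + 'i * s%:C.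
have rq1 : Re q1 = - e by rewrite ReD ReN ReM /=; ring.
have rq2 : Re q2 = e by rewrite ReD ReM /=; ring.
have q10 : q1 != 0.
  by apply/eqP => h; move: rq1; rewrite h /= => /eqP; rewrite eq_sym oppr_eq0 gt_eqF.
have q20 : q2 != 0.
  by apply/eqP => h; move: rq2; rewrite h /= => /eqP; rewrite eq_sym gt_eqF.
have E n : cint (- n%:R) n%:R f =
    (1 - cexp (n%:R%:C * - q2)) / q2 + (cexp (n%:R%:C * q1) - 1) / q1.
  have n0 : 0 <= n%:R :> R by [].
  have nn : - n%:R <= 0 :> R by rewrite oppr_le0.
  rewrite (@cint_split _ _ 0)//; congr (_ + _).
  - rewrite (@cint_eq _ _ _ _ (fun x => cexp (0 + x%:C * q2))); last first.
      move=> t /andP[_ t0]; rewrite /f -cexp_real -cexpD; congr cexp.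
      by rewrite ler0_norm// /q2 !rmorphN !rmorphM !rmorphN /=; ring.
    rewrite (@cFTC _ (fun x => cexp (0 + x%:C * q2) / q2))//.
    + rewrite mulrDl mul0r !add0r cexp0 mulNr; congr (_ - cexp _ / _).
      by rewrite rmorphN; ring.
    + apply: (@rcon_rderiv _ _ (fun x => q2 * cexp (0 + x%:C * q2))) => x _; exact: rderiv_cexp_aff.
    + move=> x _; have := hasdM (rderiv_cexp_aff 0 q2 x) (hasd_cst _ (q2^-1) _).
      by apply: hasd_eql; rewrite mulr0 addr0 mulrC mulKf.
  - rewrite (@cint_eq _ _ _ _ (fun x => cexp (0 + x%:C * q1))); last first.
      move=> t /andP[t0 _]; rewrite /f -cexp_real -cexpD; congr cexp.
      by rewrite ger0_norm// /q1 !rmorphN !rmorphM /=; ring.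
    rewrite (@cFTC _ (fun x => cexp (0 + x%:C * q1) / q1))//.
    + by rewrite mulrDl mul0r !add0r cexp0 mulNr.
    + apply: (@rcon_rderiv _ _ (fun x => q1 * cexp (0 + x%:C * q1))) => x _; exact: rderiv_cexp_aff.
    + move=> x _; have := hasdM (rderiv_cexp_aff 0 q1 x) (hasd_cst _ (q1^-1) _).
      by apply: hasd_eql; rewrite mulr0 addr0 mulrC mulKf.
have := seq_limD
  (seq_limZ (q2^-1) (seq_limB (seq_lim_cst 1) (@cexp_small (- q2) _)))
  (seq_limZ (q1^-1) (seq_limB (@cexp_small q1 _) (seq_lim_cst 1))).
rewrite ReN rq1 rq2 oppr_lt0 => /(_ e0 e0).
have -> : q2^-1 * (1 - 0) + q1^-1 * (0 - 1) = (2 * e / (e ^+ 2 + s ^+ 2))%:C.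
  have es : e ^+ 2 + s ^+ 2 != 0.
    by rewrite gt_eqF// ltr_pwDl ?sqr_ge0 ?exprn_gt0.
  have qq : q1 * q2 = - (e ^+ 2 + s ^+ 2)%:C.
    have i2 : ('i : C) * 'i = -1 by rewrite -expr2 sqr_i.
    have -> : q1 * q2 = - (e%:C * e%:C) + ('i * 'i) * (s%:C * s%:C) by rewrite /q1 /q2; ring.
    by rewrite i2 rmorphD !rmorphXn !expr2; ring.
  have -> : q2^-1 * (1 - 0) + q1^-1 * (0 - 1) = (q1 - q2) / (q1 * q2).
    by field; rewrite q10 q20.
  have e2 : (2 * e)%:C = e%:C + e%:C :> C by rewrite -rmorphD -mulr2n mulr_natl.
  have E3 : (2 * e / (e ^+ 2 + s ^+ 2))%:C = (e%:C + e%:C) / (e ^+ 2 + s ^+ 2)%:C :> C.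
    by rewrite -e2 -realCV -rmorphM.
  rewrite qq E3 invrN mulrN -mulNr; congr (_ / _).
  by rewrite /q1 /q2; ring.
by under eq_fun do rewrite ![_^-1 * _]mulrC -E.
Qed.

Lemma rcont_at f x e : rcont f -> 0 < e -> exists2 d, 0 < d &
  forall h, `|h| < d -> cabs (f (x + h) - f x) <= e.
Proof.
move=> /(rcontP x)[/cvgrPdist_le h1 /cvgrPdist_le h2] e0.
have e2 : 0 < e / 2 by rewrite divr_gt0.
have /nbhs_ballP[d1 /= d10 k1] := h1 _ e2.
have /nbhs_ballP[d2 /= d20 k2] := h2 _ e2.
exists (Num.min d1 d2); first by rewrite lt_min d10.
move=> h; rewrite lt_min => /andP[hd1 hd2].
have b1 : ball x d1 (x + h) by rewrite /ball/= opprD addrA subrr sub0r normrN.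
have b2 : ball x d2 (x + h) by rewrite /ball/= opprD addrA subrr sub0r normrN.
apply: le_trans (cabs_le _) _; rewrite ReB ImB [e]splitr lerD//.
- by rewrite distrC; exact: k1 b1.
- by rewrite distrC; exact: k2 b2.
Qed.

Lemma cI_ker (c : C) : cI (fun t => c * (ker t)%:C) = c * pi%:C.
Proof.
have mk : cmeas (fun t : R => (ker t)%:C) by apply: cmeas_real; exact: measurable_ker.
have dk : dom 1 (fun t : R => (ker t)%:C).
  by move=> t; rewrite cabs_real mul1r ger0_norm// ker_ge0.
rewrite cIZ; last exact: ci_dom mk dk.
congr (_ * _); apply: cplx_ext => /=; first exact: integral_ker.
by rewrite Rintegral_cst// mul0r.
Qed.

Lemma expR_small (x : R) : seq_lim (fun n => (expR (- (n.+1%:R^-1 * `|x|)))%:C) 1.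
Proof.
move=> e e0; have [N HN] := nat_lt_bnd (`|x| / e); exists N => n nN.
rewrite -(rmorph1 (real_complex R)) -rmorphB cabs_real distrC ger0_norm; last first.
  rewrite subr_ge0 -expR0 ler_expR oppr_le0 mulr_ge0// invr_ge0//.
rewrite lerBlDr -lerBlDl; apply: le_trans (expR_ge1Dx _).
rewrite lerD2l lerN2 mulrC ler_pdivrMr ?ltr0n// mulrC -ler_pdivrMr//.
by apply: HN; apply: leq_trans nN _.
Qed.

Lemma bounded_dom f M : dom M f -> forall t, cabs (f t) <= M.
Proof.
move=> df t; apply: le_trans (df t) _.
by rewrite ler_piMr ?ker_le1// (dom_ge0 df).
Qed.

(** With the factor exp(- e |x|) inserted, Fubini's theorem produces the Poisson kernel, and t = t0
    + e u turns the result into the integral of 2 f(t0 + e u) / (1 + u^2). Then e = 1 / (n + 1)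
    tends to 0 by dominated convergence on both sides. The sign k = -1 serves to invert [lap], and k
    = 1 to invert [iL]. *)
Theorem fourier_inversion f M M' (k : R) t0 : k ^+ 2 = 1 -> rcont f -> dom M f ->
  dom M' (fun x => cI (fun t => f t * cexp ('i * (k * x * t)%:C))) ->
  cmeas (fun x => cI (fun t => f t * cexp ('i * (k * x * t)%:C))) /\
  cI (fun x => cI (fun t => f t * cexp ('i * (k * x * t)%:C)) *
      cexp (- 'i * (k * x * t0)%:C)) = (2 * pi)%:C * f t0.
Proof.
move=> k1 cf df dpsi; set psi := fun x => cI _ in dpsi *.
have mf := cmeas_rcont cf.
have M0 := dom_ge0 df.
have absi x : cabs (cexp ('i * x%:C)) = 1.
  by rewrite cabs_cexp ReM /= mul0r mulr0 subrr expR0.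
have absi' x : cabs (cexp (- 'i * x%:C)) = 1.
  by rewrite cabs_cexp ReM ReN ImN /= oppr0 mul0r mulr0 subrr expR0.
have mi (p : R * R -> R) : measurable_fun setT p -> cmeas (fun z => cexp ('i * (p z)%:C)).
  by move=> mp; apply: cmeas_exp; apply: cmeasM; [exact: cmeas_cst|exact: cmeas_real].
have mprod : measurable_fun setT (fun z : R * R => k * z.1 * z.2).
  by apply: measurable_funM => //; apply: measurable_funM.
have mprod0 : measurable_fun setT (fun z : R * R => k * z.1 * t0).
  by apply: measurable_funM => //; apply: measurable_funM.
have mf2 : cmeas (fun z : R * R => f z.2) by exact: cmeas_comp measurable_snd mf.
pose reg (e : R) (z : R * R) := f z.2 * cexp ('i * (z.1 * (k * (z.2 - t0)))%:C) * (expR (- (e * `|z.1|)))%:C.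
have mreg e : cmeas (reg e).
  apply: cmeasM; first apply: cmeasM => //.
    apply: mi; apply: measurable_funM => //; apply: measurable_funM => //.
    by apply: measurable_funB.
  apply: cmeas_real; apply: measurableT_comp; first exact: measurable_expR.
  apply: measurableT_comp => //; apply: measurable_funM => //.
  exact: measurableT_comp.
have Freg e : 0 < e -> cI (fun x => psi x * cexp (- 'i * (k * x * t0)%:C) * (expR (- (e * `|x|)))%:C) =
    cI (fun t => f t * (2 * e / (e ^+ 2 + (t - t0) ^+ 2))%:C).
  move=> e0; have [Me Me0 HMe] := abel_dom e0.
  have [|_ _] := @cFubini _ (reg e) (M * Me) (mreg e).
    move=> x t; rewrite /reg /= !cabsM absi mulr1 cabs_real ger0_norm ?expR_ge0//.
    have -> : M * Me * ker x * ker t = (M * ker t) * (Me * ker x) by ring.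
    by apply: ler_pM; rewrite ?cabs_ge0 ?expR_ge0//; exact: df.
  have -> : (fun x => cI (fun y => reg e (x, y))) = (fun x => psi x * cexp (- 'i * (k * x * t0)%:C) * (expR (- (e * `|x|)))%:C).
    apply/funext => x; rewrite /psi -mulrA [RHS]mulrC -cIZ; last first.
      apply: (ci_dom (M := M)).
        apply: cmeasM => //; apply: cmeas_exp; apply: cmeasM; first exact: cmeas_cst.
        by apply: cmeas_real; apply: measurable_funM.
      by move=> t; rewrite cabsM absi mulr1; exact: df.
    congr cI; apply/funext => t; rewrite /reg /=.
    have -> : cexp ('i * (x * (k * (t - t0)))%:C) = cexp ('i * (k * x * t)%:C) * cexp (- 'i * (k * x * t0)%:C).
      rewrite -cexpD; congr cexp; rewrite -mulrA; rewrite !rmorphM rmorphB; ring.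
    ring.
  move=> ->; congr cI; apply/funext => t; rewrite /reg /=.
  have := abel_transform (k * (t - t0)) e0; rewrite exprMn k1 mul1r => <-.
  rewrite -cIZ; last first.
    apply: (ci_dom (M := Me)).
      apply: cmeasM.
        apply: cmeas_exp; apply: cmeasM; first exact: cmeas_cst.
        by apply: cmeas_real; apply: measurable_funM.
      apply: cmeas_real; apply: measurableT_comp; first exact: measurable_expR.
      by apply: measurableT_comp => //; apply: measurable_funM.
    by move=> x; rewrite cabsM absi mul1r cabs_real ger0_norm ?expR_ge0.
  by congr cI; apply/funext => x; rewrite -[LHS]mulrA.
(* Fubini's theorem needs a majorant in both variables, and f t e^(ikxt) has none in x. A factor
   [ker] x provides it and is divided out afterwards. *)
have mpsi : cmeas psi.
  have [||mx _ _] := @cFubini _ (fun z => (ker z.1)%:C * (f z.2 * cexp ('i * (k * z.1 * z.2)%:C))) M.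
  - apply: cmeasM; last by apply: cmeasM => //; exact: mi.
    by apply: cmeas_real; exact: measurableT_comp (@measurable_ker R) measurable_fst.
  - move=> x y; rewrite /= !cabsM absi mulr1 cabs_real ger0_norm ?ker_ge0//.
    have -> : M * ker x * ker y = ker x * (M * ker y) by ring.
    by rewrite ler_wpM2l ?ker_ge0//; exact: df.
  have : cmeas (fun x => ((ker x)^-1)%:C * cI (fun y => (ker x)%:C * (f y * cexp ('i * (k * x * y)%:C)))).
    apply: cmeasM => //; apply: cmeas_real.
    apply: continuous_measurable_fun => x; rewrite /ker.
    rewrite (_ : (fun _ => _) = (@oneDsqr R)); first exact: continuous_oneDsqr.
    by apply/funext => y; rewrite invrK.
  congr cmeas; apply/funext => x; rewrite cIZ; last first.
    apply: (ci_dom (M := M)).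
      apply: cmeasM => //; apply: cmeas_exp; apply: cmeasM; first exact: cmeas_cst.
      by apply: cmeas_real; apply: measurable_funM.
    by move=> t; rewrite cabsM absi mulr1; exact: df.
  by rewrite mulrA -rmorphM mulVf ?mul1r// gt_eqF// ker_gt0.
split; first exact: mpsi.
have me0 : cmeas (fun x => cexp (- 'i * (k * x * t0)%:C)).
  apply: cmeas_exp; apply: cmeasM; first exact: cmeas_cst.
  by apply: cmeas_real; apply: measurable_funM => //; apply: measurable_funM.
have L1 : seq_lim (fun n => cI (fun x => psi x * cexp (- 'i * (k * x * t0)%:C) * (expR (- (n.+1%:R^-1 * `|x|)))%:C))
    (cI (fun x => psi x * cexp (- 'i * (k * x * t0)%:C))).
  apply: (cI_dct (M := M')).
  - move=> n; apply: cmeasM; first exact: cmeasM.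
    apply: cmeas_real; apply: measurableT_comp; first exact: measurable_expR.
    by apply: measurableT_comp => //; apply: measurable_funM.
  - exact: cmeasM.
  - move=> n x; rewrite !cabsM absi' mulr1 cabs_real ger0_norm ?expR_ge0//.
    apply: le_trans (dpsi x).
    by rewrite ler_piMr ?cabs_ge0// -expR0 ler_expR oppr_le0 ?mulr_ge0 ?invr_ge0.
  - move=> x; have := seq_limZ (psi x * cexp (- 'i * (k * x * t0)%:C)) (expR_small x).
    by rewrite mulr1.
apply: seq_lim_unique L1 _.
have E n : cI (fun x => psi x * cexp (- 'i * (k * x * t0)%:C) * (expR (- (n.+1%:R^-1 * `|x|)))%:C) =
    cI (fun u => 2%:C * f (t0 + n.+1%:R^-1 * u) * (ker u)%:C).
  have e0 : 0 < n.+1%:R^-1 :> R by rewrite invr_gt0.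
  rewrite Freg//; move: (n.+1%:R^-1) e0 => e e0.
  have en : e != 0 by rewrite gt_eqF.
  have pE t : 2 * e / (e ^+ 2 + (t - t0) ^+ 2) = 2 / e * ker ((t - t0) / e).
    rewrite /ker /oneDsqr; move: (t - t0) => v.
    have e2 : e ^+ 2 + v ^+ 2 != 0 by rewrite gt_eqF// ltr_pwDl ?sqr_ge0 ?exprn_gt0.
    have -> : 1 + (v / e) ^+ 2 = (e ^+ 2 + v ^+ 2) / e ^+ 2 by field.
    by field; rewrite e2 en.
  have -> : (fun t => f t * (2 * e / (e ^+ 2 + (t - t0) ^+ 2))%:C) =
      (fun t => f t * (2 / e * ker ((t - t0) / e))%:C).
    by apply/funext => t; rewrite pE.
  have ee : 0 < 2 / e by rewrite divr_gt0.
  have ck : continuous (fun t => 2 / e * ker ((t - t0) / e)).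
    move=> t; apply: (@continuousM _ _ (fun=> 2 / e) (fun t => ker ((t - t0) / e))); first exact: cst_continuous.
    apply: (@continuous_comp _ _ _ (fun t => (t - t0) / e) (@ker R)); last exact: continuous_ker.
    apply: (@continuousM _ _ (fun t => t - t0) (fun=> e^-1)); last exact: cst_continuous.
    by apply: continuousB; [exact: cvg_id|exact: cst_continuous].
  have k0 t : cabs (2 / e * ker t)%:C = 2 / e * ker t.
    by rewrite cabs_real ger0_norm// mulr_ge0 ?ker_ge0 ?(ltW ee).
  have uE u : (t0 + e * u - t0) / e = u by field.
  rewrite (@cI_affine _ (fun t => f t * (2 / e * ker ((t - t0) / e))%:C) (M * (2 / e)) (M * (2 / e)) t0 e)//.
  - rewrite -cIZ.
      congr cI; apply/funext => u; rewrite uE.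
      rewrite mulrCA -realCM (_ : e * (2 / e * ker u) = 2 * ker u); last by field.
      by rewrite realCM; ring.
    apply: (ci_dom (M := M * (2 / e))).
      apply: cmeas_rcont; apply: (rcont_comp (rcontM cf (rcont_real ck))) => u.
      apply: continuousD; first exact: cst_continuous.
      by apply: continuousM; [exact: cst_continuous|exact: cvg_id].
    move=> u; rewrite cabsM k0 uE mulrA ler_wpM2r ?ker_ge0// ler_wpM2r ?(ltW ee)//.
    exact: bounded_dom df _.
  - exact: rcontM cf (rcont_real ck).
  - move=> t; rewrite cabsM k0.
    have -> : M * (2 / e) * ker t = M * ker t * (2 / e) by ring.
    apply: ler_pM; [exact: cabs_ge0|by rewrite mulr_ge0 ?ker_ge0 ?(ltW ee)|exact: df|].
    by rewrite ler_piMr ?(ltW ee)// ker_le1.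
  - move=> u; rewrite cabsM k0 uE mulrA ler_wpM2r ?ker_ge0// ler_wpM2r ?(ltW ee)//.
    exact: bounded_dom df _.
have -> : (2 * pi)%:C * f t0 = cI (fun u => 2%:C * f t0 * (ker u)%:C).
  by rewrite cI_ker rmorphM; ring.
have ce n : continuous (fun u : R => t0 + n.+1%:R^-1 * u).
  move=> u; apply: continuousD; first exact: cst_continuous.
  by apply: continuousM; [exact: cst_continuous|exact: cvg_id].
rewrite (_ : (fun n => cI _) = (fun n => cI (fun u => 2%:C * f (t0 + n.+1%:R^-1 * u) * (ker u)%:C))); last first.
  by apply/funext => n; exact: E.
have mk : cmeas (fun t : R => (ker t)%:C) by apply: cmeas_real; exact: measurable_ker.
apply: (cI_dct (M := 2 * M)).
- move=> n; apply: cmeasM => //; apply: cmeasM; first exact: cmeas_cst.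
  exact: cmeas_rcont (rcont_comp cf (ce n)).
- by apply: cmeasM => //; exact: cmeas_cst.
- move=> n u; rewrite !cabsM !cabs_real (ger0_norm (ker_ge0 u)) ger0_norm//.
  rewrite ler_wpM2r ?ker_ge0// ler_wpM2l//; exact: bounded_dom df _.
- move=> u; rewrite /=.
  have hh : seq_lim (fun n => f (t0 + n.+1%:R^-1 * u)) (f t0).
    move=> e e0; have [d d0 hd] := rcont_at t0 cf e0.
    have [N HN] := nat_lt_bnd (`|u| / d); exists N => n nN; apply: hd.
    rewrite normrM ger0_norm ?invr_ge0// mulrC ltr_pdivrMr// -ltr_pdivrMl// mulrC.
    apply: le_lt_trans (HN n nN) _; by rewrite ltr_nat.
  have := seq_limZ (2%:C * (ker u)%:C) hh.
  by under eq_fun do rewrite mulrAC; rewrite mulrAC.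
Qed.

End Fourier.

(** * Identity theorem *)

Section Uniqueness.
Variable R : realType.
Local Notation C := (Cplx R).
Local Notation mu := (@lebesgue_measure R).
Implicit Types (F : C -> C) (f : R -> C) (a b c d e s t x M : R).

Lemma rcon_bounded a b f : a <= b -> rcon a b f ->
  exists2 M, 0 <= M & forall t, a <= t <= b -> cabs (f t) <= M.
Proof.
move=> ab /rcon_within[c1 c2].
have [x1 _ h1] := EVT_max ab c1; have [y1 _ k1] := EVT_min ab c1.
have [x2 _ h2] := EVT_max ab c2; have [y2 _ k2] := EVT_min ab c2.
pose M1 := `|Re (f x1)| + `|Re (f y1)|.
pose M2 := `|Im (f x2)| + `|Im (f y2)|.
exists (M1 + M2) => [|t tab]; first by rewrite !addr_ge0.
apply: le_trans (cabs_le _) _; apply: lerD.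
- have := h1 t; rewrite in_itv/= => /(_ tab) u1; have := k1 t; rewrite in_itv/= => /(_ tab) u2.
  rewrite ler_norml /M1; move: (ler_norm (Re (f x1))) (lerNnormlW (lexx `|Re (f y1)|)) (normr_ge0 (Re (f x1))) (normr_ge0 (Re (f y1))) => *; apply/andP; split; lra.
- have := h2 t; rewrite in_itv/= => /(_ tab) u1; have := k2 t; rewrite in_itv/= => /(_ tab) u2.
  rewrite ler_norml /M2; move: (ler_norm (Im (f x2))) (lerNnormlW (lexx `|Im (f y2)|)) (normr_ge0 (Im (f x2))) (normr_ge0 (Im (f y2))) => *; apply/andP; split; lra.
Qed.

Lemma cint_Re_ge a b f M : a <= b -> rcon a b f ->
  (forall t, a <= t <= b -> M <= Re (f t)) -> M * (b - a) <= Re (cint a b f).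
Proof.
move=> ab cf fM; rewrite cint_Re -integral_cst_itv//; have [c1 _] := rcon_within cf.
apply: le_Rintegral => //.
- apply: continuous_compact_integrable; first exact: segment_compact.
  by apply: continuous_subspaceT => x; exact: cst_continuous.
- by apply: continuous_compact_integrable => //; exact: segment_compact.
Qed.

(** Laplace's method. The part |t - y| <= d / 2, of width d, gives the left-hand side; the parts d /
    2 <= |t - y| <= d are nonnegative; the parts beyond d are at most B exp(- n d^2) times their
    length. *)
Lemma Re_cint_gauss g (y d T B n : R) : 0 < d -> d <= T -> 0 <= n ->
  rcont (fun t => g t * (expR (- (n * (t - y) ^+ 2)))%:C) ->
  (forall t, y - T <= t <= y + T -> cabs (g t) <= B) ->
  (forall t, y - d <= t <= y + d -> 2^-1 <= Re (g t)) ->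
  d / 2 * expR (- (n * (d / 2) ^+ 2)) <=
    Re (cint (y - T) (y + T) (fun t => g t * (expR (- (n * (t - y) ^+ 2)))%:C)) +
    B * (2 * T) * expR (- (n * d ^+ 2)).
Proof.
move=> d0 dT n0; set h : R -> C := fun t => _; move=> ch gB gRe.
have Reh t : Re (h t) = expR (- (n * (t - y) ^+ 2)) * Re (g t).
  by rewrite /h mulrC ReMr.
pose X := expR (- (n * d ^+ 2)); have X0 : 0 <= X by exact: expR_ge0.
have B0 : 0 <= B by apply: le_trans (cabs_ge0 _) (gB y _); apply/andP; split; lra.
have far u v : y - T <= u -> v <= y + T -> u <= v ->
    (forall t, u <= t <= v -> d <= `|t - y|) -> - (B * X * (v - u)) <= Re (cint u v h).
  move=> h1 h2 uv h3; rewrite lerNl; apply: le_trans (ler_norm _) _; rewrite normrN.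
  apply: le_trans (Re_le_cabs _) _; apply: cint_bnd => //.
  move=> t /andP[ut tv]; rewrite cabsM cabs_real ger0_norm ?expR_ge0//.
  apply: ler_pM; rewrite ?cabs_ge0 ?expR_ge0//.
    by apply: gB; rewrite (le_trans h1 ut) (le_trans tv h2).
  rewrite ler_expR lerN2 ler_wpM2l// -[leRHS]real_normK ?num_real//.
  by rewrite lerXn2r ?nnegrE ?(ltW d0)// h3// ut.
have near u v m : y - d <= u -> v <= y + d -> u <= v ->
    (forall t, u <= t <= v -> m <= expR (- (n * (t - y) ^+ 2))) -> 0 <= m ->
    2^-1 * m * (v - u) <= Re (cint u v h).
  move=> h1 h2 uv hm m0; apply: cint_Re_ge => //.
  move=> t /andP[ut tv]; rewrite Reh [2^-1 * m]mulrC; apply: ler_pM; rewrite ?invr_ge0//.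
    by apply: hm; rewrite ut.
  by apply: gRe; rewrite (le_trans h1 ut) (le_trans tv h2).
have p1 : - (B * X * (y - d - (y - T))) <= Re (cint (y - T) (y - d) h).
  apply: far; [lra|lra|lra|move=> t /andP[_ t2]].
  by rewrite ler0_norm; lra.
have p5 : - (B * X * (y + T - (y + d))) <= Re (cint (y + d) (y + T) h).
  apply: far; [lra|lra|lra|move=> t /andP[t1 _]].
  by rewrite ger0_norm; lra.
(* Here m = 0: on the intermediate pieces only the sign of the integrand is used. *)
have p2 : 2^-1 * 0 * (y - d / 2 - (y - d)) <= Re (cint (y - d) (y - d / 2) h).
  by apply: near; [lra|lra|lra|move=> t _; exact: expR_ge0|].
have p4 : 2^-1 * 0 * (y + d - (y + d / 2)) <= Re (cint (y + d / 2) (y + d) h).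
  by apply: near; [lra|lra|lra|move=> t _; exact: expR_ge0|].
have p3 : 2^-1 * expR (- (n * (d / 2) ^+ 2)) * (y + d / 2 - (y - d / 2)) <= Re (cint (y - d / 2) (y + d / 2) h).
  apply: near; [lra|lra|lra| |exact: expR_ge0].
  move=> t /andP[t1 t2]; rewrite ler_expR lerN2 ler_wpM2l// -[leLHS]real_normK ?num_real//.
  rewrite lerXn2r ?nnegrE ?divr_ge0 ?(ltW d0)// ler_norml; apply/andP; split; lra.
rewrite (@cint_split _ (y - T) (y - d)); [|lra|lra|exact: ch].
rewrite (@cint_split _ (y - d) (y + d)); [|lra|lra|exact: ch].
rewrite (@cint_split _ (y - d) (y - d / 2)); [|lra|lra|exact: ch].
rewrite (@cint_split _ (y - d / 2) (y + d / 2)); [|lra|lra|exact: ch].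
rewrite !ReD -/X; have BX : 0 <= B * X * d by rewrite !mulr_ge0// ltW.
move: p1 p2 p3 p4 p5 BX; set E := expR _.
move: (Re _) (Re _) (Re _) (Re _) (Re _) => A1 A2 A3 A4 A5; clearbody X E; clear -d0; nra.
Qed.

(* A zero near the right end of the rectangle propagates to the left edge: the
   weight e^{N(z-z1)^2} concentrates the left edge at z1 and is negligible on
   the horizontal edges. *)
Lemma vanish_left F (z1 : C) : (forall z, exists l, cderiv F z l) ->
  (forall z, 0 < Re z -> F z = 0) -> F z1 = 0.
Proof.
move=> hF F0; apply/eqP/negPn/negP => Fz1.
have [pos|neg] := ltP 0 (Re z1); first by move: Fz1; rewrite F0// eqxx.
set x1 := Re z1 in neg; pose y1 := Im z1.
have z1E : z1 = x1 +i* y1 by apply: cplx_ext.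
(* S puts the right edge on Re z = 1, where F vanishes. T = 2 S makes (s - x1)^2 - T^2 <= - 3 S^2 <=
   - d^2 on the horizontal edges. *)
pose S := 1 - x1; pose T := 2 * S.
have S1 : 1 <= S by rewrite /S; lra.
have S0 : 0 < S by lra.
pose G z := (F z1)^-1 * F z.
have hG z : exists l, cderiv G z l.
  by have [l hl] := hF z; exists ((F z1)^-1 * l); exact: hasdZ.
have G1 : G z1 = 1 by rewrite /G mulVf.
have G0 z : 0 < Re z -> G z = 0 by move=> /F0 h; rewrite /G h mulr0.
have cG s : rcont (fun t => G (s +i* t)).
  by move=> a b t _; have [l /rderiv_ver hl] := hG (s +i* t); exact: rderiv_cont hl.
have cG' t : rcont (fun s => G (s +i* t)).
  by move=> a b s _; have [l /rderiv_hor hl] := hG (s +i* t); exact: rderiv_cont hl.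
have yT : y1 - T <= y1 + T by rewrite /T; lra.
have xS : x1 <= x1 + S by lra.
have [B1 B10 HB1] := rcon_bounded yT (cG x1 (y1 - T) (y1 + T)).
have [B2 B20 HB2] := rcon_bounded xS (cG' (y1 - T) x1 (x1 + S)).
have [B3 B30 HB3] := rcon_bounded xS (cG' (y1 + T) x1 (x1 + S)).
have [d0 d00 Hd0] : exists2 d, 0 < d & forall h, `|h| < d -> cabs (G (x1 +i* (y1 + h)) - G (x1 +i* y1)) <= 2^-1.
  by apply: (@rcont_at _ (fun t => G (x1 +i* t))) => //; rewrite invr_gt0.
pose d := Num.min (d0 / 2) (S / 2).
have dd0 : 0 < d by rewrite lt_min !divr_gt0.
have dlt : d < d0 by rewrite gt_min ltr_pdivrMr// ltr_pMr// ltr1n.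
have dS : d <= S / 2 by rewrite ge_min lexx orbT.
have ReG h : `|h| <= d -> 2^-1 <= Re (G (x1 +i* (y1 + h))).
  move=> hd; have := Hd0 h (le_lt_trans hd dlt); rewrite -z1E G1 => k.
  have := le_trans (Re_le_cabs _) k; rewrite ReB /= ler_norml => /andP[]; lra.
pose W N z : C := cexp ((N%:R)%:C * (z - z1) ^+ 2).
pose H N z := G z * W N z.
have dsub z : cderiv (fun w => w - z1) z 1.
  by have := hasdB (hasd_id setT z) (hasd_cst setT z1 z); rewrite subr0; exact.
have hW N z : exists l, cderiv (W N) z l.
  eexists; apply: (@hasd_comp _ _ (@cexp R) (fun z => (N%:R)%:C * (z - z1) ^+ 2)); first exact: cderiv_cexp.
  apply: hasdZ; exact: (hasdX 1 (dsub z)).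
have hH N : hol setT (H N).
  move=> z _; have [l hl] := hG z; have [m hm] := hW N z.
  by eexists; exact: hasdM hl hm.
have WE N s t : cabs (W N (s +i* t)) = expR (N%:R * ((s - x1) ^+ 2 - (t - y1) ^+ 2)).
  rewrite cabs_cexp ReMr z1E expr2 ReM ?ReB ?ImB /=; congr expR; ring.
have WR N t : W N (x1 +i* t) = (expR (- (N%:R * (t - y1) ^+ 2)))%:C.
  have E : (x1 +i* t : C) - z1 = 'i * (t - y1)%:C.
    by rewrite z1E; apply: cplx_ext; rewrite ?ReB ?ImB ?ReM ?ImM /=; ring.
  have i2 : ('i : C) * 'i = -1 by rewrite -expr2 sqr_i.
  rewrite /W E -cexp_real; congr cexp.
  have -> : ('i * (t - y1)%:C) ^+ 2 = ('i * 'i) * ((t - y1)%:C * (t - y1)%:C) :> C by ring.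
  by rewrite i2 realCN expr2 !realCM; ring.
have cW N : rcont (fun t => H N (x1 +i* t)).
  by move=> a b t _; have [|l /rderiv_ver hl] := hH N (x1 +i* t); [|exact: rderiv_cont hl].
(* The left edge contributes at least the left-hand side, everything else at
   most the right-hand side; this is absurd for large N. *)
have main N : d / 2 * expR (- (N%:R * (d / 2) ^+ 2)) <=
   (B1 * (2 * T) + B2 * S + B3 * S) * expR (- (N%:R * d ^+ 2)).
  have hR : hol (rect x1 (x1 + S) (y1 - T) (y1 + T)) (H N) by apply: hol_sub (hH N).
  have := goursat xS yT hR; rewrite /bdry.
  have -> : vedge (H N) (x1 + S) (y1 - T) (y1 + T) = 0.
    rewrite /vedge (@cint_eq _ _ _ _ (fun=> 0 * 0)).
      rewrite (@cintZ _ _ _ (fun=> 0) 0) ?mul0r//.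
      by move=> t _; split; exact: cst_continuous.
    move=> t _; rewrite mul0r /H G0 ?mul0r//= /S; lra.
  rewrite mulr0 addr0 => hB.
  have E : 'i * vedge (H N) x1 (y1 - T) (y1 + T) = hedge (H N) (y1 - T) x1 (x1 + S) - hedge (H N) (y1 + T) x1 (x1 + S).
    by apply/eqP; rewrite eq_sym -subr_eq0; apply/eqP; rewrite -hB; ring.
  have hor t B : (t = y1 - T \/ t = y1 + T) -> 0 <= B ->
      (forall s, x1 <= s <= x1 + S -> cabs (G (s +i* t)) <= B) ->
      cabs (hedge (H N) t x1 (x1 + S)) <= B * S * expR (- (N%:R * d ^+ 2)).
    move=> ht B0 HB; have -> : B * S * expR (- (N%:R * d ^+ 2)) = B * expR (- (N%:R * d ^+ 2)) * (x1 + S - x1) by ring.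
    apply: cint_bnd; [exact: xS| |].
      by move=> s _; have [|l /rderiv_hor hl] := hH N (s +i* t); [|exact: rderiv_cont hl].
    move=> s sx; rewrite cabsM WE; apply: ler_pM; rewrite ?cabs_ge0 ?expR_ge0//; first exact: HB.
    rewrite ler_expR (_ : - (N%:R * d ^+ 2) = N%:R * - (d ^+ 2)); last by ring.
    rewrite ler_wpM2l//.
    have -> : (t - y1) ^+ 2 = T ^+ 2 by case: ht => ->; ring.
    have s1 : (s - x1) ^+ 2 <= S ^+ 2.
      move: sx => /andP[sx1 sx2].
      have u0 : 0 <= s - x1 by rewrite subr_ge0.
      have uS : s - x1 <= S by rewrite lerBlDl.
      by rewrite !expr2; exact: ler_pM.
    have d2 : d ^+ 2 <= S ^+ 2.
      have d1 : d <= S by apply: le_trans dS _; rewrite ler_pdivrMr// ler_peMr ?(ltW S0)// ler1n.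
      by rewrite !expr2; apply: ler_pM => //; exact: ltW.
    by rewrite /T exprMn; move: s1 d2; rewrite (_ : 2 ^+ 2 = 4 :> R); [have := sqr_ge0 S; lra|ring].
  have up : cabs (vedge (H N) x1 (y1 - T) (y1 + T)) <= (B2 * S + B3 * S) * expR (- (N%:R * d ^+ 2)).
    have -> : cabs (vedge (H N) x1 (y1 - T) (y1 + T)) = cabs ('i * vedge (H N) x1 (y1 - T) (y1 + T)).
      by rewrite cabsM cabs_i mul1r.
    rewrite E mulrDl; apply: le_trans (cabsB _ _) _.
    by apply: lerD; apply: hor => //; [left|right].
  have hE : (fun t => G (x1 +i* t) * (expR (- (N%:R * (t - y1) ^+ 2)))%:C) = (fun t => H N (x1 +i* t)).
    by apply/funext => t; rewrite /H WR.
  have := @Re_cint_gauss (fun t => G (x1 +i* t)) y1 d T B1 N%:R dd0.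
  rewrite hE => h; apply: le_trans (h _ _ (cW N) HB1 _) _.
  - by rewrite /T; lra.
  - exact: ler0n.
  - move=> t tx; have := ReG (t - y1); rewrite (_ : y1 + (t - y1) = t); last by ring.
    apply; by rewrite ler_norml; move: tx => /andP[t1 t2]; apply/andP; split; lra.
  have := le_trans (cabs_Re_ge _) up; rewrite /vedge; set A := Re _.
  by rewrite mulrDl; lra.
pose K := B1 * (2 * T) + B2 * S + B3 * S.
have K0 : 0 <= K by rewrite /K /T !addr_ge0 ?mulr_ge0// ltW.
(* q is the gap between the decay rates of the two sides of [main]; exp(N q) >= N q eventually beats
   the constant K. *)
pose q := d ^+ 2 - (d / 2) ^+ 2.
have q0 : 0 < q.
  have -> : q = 3 / 4 * d ^+ 2 by rewrite /q; field.
  by rewrite mulr_gt0 ?divr_gt0 ?exprn_gt0.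
have [N HN] := nat_lt_bnd (2 * (K + 1) / d / q).
have := main N; rewrite -/K.
have -> : expR (- (N%:R * (d / 2) ^+ 2)) = expR (N%:R * q) * expR (- (N%:R * d ^+ 2)).
  by rewrite -expRD; congr expR; rewrite /q; ring.
rewrite mulrA ler_pM2r ?expR_gt0// leNgt => /negP; apply.
have := HN N (leqnn N); rewrite ler_pdivrMr// ler_pdivrMr// => h.
have := expR_ge1Dx (N%:R * q) => h2.
have h3 : (K + 1) <= d / 2 * (N%:R * q) by move: h; lra.
apply: lt_le_trans (_ : K + 1 <= _); first by rewrite ltrDl.
apply: le_trans h3 _; rewrite ler_wpM2l ?divr_ge0 ?(ltW dd0)//.
by apply: le_trans h2; rewrite lerDr.
Qed.

Theorem entire_unique (F G : C -> C) : entire F -> entire G ->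
  (forall z, 0 < Re z -> F z = G z) -> F = G.
Proof.
move=> eF eG FG; apply/funext => z; apply/eqP; rewrite -subr_eq0; apply/eqP.
apply: (@vanish_left (fun z => F z - G z)).
- move=> w; have /derivable_cderivP[l hl] := eF w; have /derivable_cderivP[m hm] := eG w.
  by exists (l - m); exact: hasdB.
- by move=> w /FG ->; rewrite subrr.
Qed.

End Uniqueness.

(** * The space P and the Laplace transform *)

Section SpaceP.
Variable R : realType.
Local Notation C := (Cplx R).
Implicit Types (f g : R -> C) (x y e t : R) (l : C).

Lemma within_proper x : 0 <= x -> ProperFilter (within `[0, +oo[ x^').
Proof.
move=> x0; split; last exact: within_filter.
rewrite /within /= => /nbhs_ballP[d /= d0 hd].
have := hd (x + d / 2); apply.
- by rewrite /ball/= opprD addrA subrr sub0r normrN ger0_norm ?divr_ge0 ?(ltW d0)// ltr_pdivrMr// ltr_pMr// ltr1n.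
- by rewrite /= gt_eqF// ltrDl divr_gt0.
- by rewrite /= in_itv/= andbT addr_ge0// divr_ge0// ltW.
Qed.

Lemma hquot_cvgP f x l : (hquot f x @ within `[0, +oo[ x^') --> l <->
  (forall e, 0 < e -> exists2 d, 0 < d & forall y, 0 <= y -> `|y - x| < d ->
    cabs (f y - f x - l * (y - x)%:C) <= e * `|y - x|).
Proof.
have key y : y != x -> forall e, (cabs (l - hquot f x y) <= e) =
   (cabs (f y - f x - l * (y - x)%:C) <= e * `|y - x|).
  move=> yx e; have yx0 : y - x != 0 by rewrite subr_eq0.
  have yc0 : (y - x)%:C != 0 :> C by rewrite -cabs_eq0 cabs_real normr_eq0.
  have -> : l - hquot f x y = - ((y - x)%:C)^-1 * (f y - f x - l * (y - x)%:C).
    rewrite /hquot realCV; move: (f y - f x) ((y - x)%:C : C) yc0 => u w w0.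
    by field.
  by rewrite cabsM cabsN cabsV cabs_real mulrC ler_pdivrMr ?normr_gt0.
split=> [cv e e0|H].
  have e0' : 0 < e%:C :> C by rewrite ltcR.
  move/cvgrPdist_le : cv => /(_ _ e0') /=; rewrite /within /= => /nbhs_ballP[d /= d0 hd].
  exists d => // y y0 yd; have [->|yx] := eqVneq y x.
    by rewrite !subrr mulr0 subrr cabs0 normr0 mulr0.
  rewrite -key//; rewrite -lecR -normE.
  apply: hd => //; first by rewrite /ball/= distrC.
  by rewrite /= in_itv/= y0.
apply/cvgrPdist_le => /= e e0.
have [eR e0'] := cplx_gt0 e0.
have [d d0 hd] := H _ e0'.
rewrite /within /=; apply/nbhs_ballP; exists d => //= y.
rewrite /ball/= distrC => yd yx; rewrite in_itv/= andbT => y0.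
by rewrite eR normE lecR key//; exact: hd.
Qed.

Lemma hderivable_eps f x : hderivable f x ->
  forall e, 0 < e -> exists2 d, 0 < d & forall y, 0 <= y -> `|y - x| < d ->
    cabs (f y - f x - hderive f x * (y - x)%:C) <= e * `|y - x|.
Proof. by move=> h; apply/hquot_cvgP; exact: h. Qed.

Lemma eps_hderivable f x l : 0 <= x ->
  (forall e, 0 < e -> exists2 d, 0 < d & forall y, 0 <= y -> `|y - x| < d ->
    cabs (f y - f x - l * (y - x)%:C) <= e * `|y - x|) ->
  hderivable f x /\ hderive f x = l.
Proof.
move=> x0 /hquot_cvgP h; have PF := within_proper x0.
split; first by apply/cvg_ex; exists l.
exact: cvg_lim h.
Qed.

Lemma cvg_pinftyP (g : R -> C) l : g x @[x --> +oo] --> l <->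
  (forall e, 0 < e -> exists X, forall x, X < x -> cabs (g x - l) <= e).
Proof.
split=> [cv e e0|H].
  have e0' : 0 < e%:C :> C by rewrite ltcR.
  move/cvgrPdist_le : cv => /(_ _ e0') /= [X [_ hX]].
  by exists X => x /hX /=; rewrite normE lecR cabs_distC.
apply/cvgrPdist_le => /= e e0.
have [eR e0'] := cplx_gt0 e0.
have [X hX] := H _ e0'; exists X; split; first exact: num_real.
by move=> x /= /hX; rewrite eR normE lecR cabs_distC.
Qed.

Lemma growth_cvg (g : R -> C) : (forall e, 0 < e -> exists M, forall x, 0 <= x ->
    cabs (g x) <= M * expR (e * x)) ->
  forall e, 0 < e -> (g x * (expR (- (e * x)))%:C) @[x --> +oo] --> (0 : C).
Proof.
move=> H e e0; apply/cvg_pinftyP => d d0.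
have e2 : 0 < e / 2 by rewrite divr_gt0.
have [M HM] := H _ e2.
exists (Num.max 0 (`|M| / d / (e / 2))) => x; rewrite gt_max => /andP[x0 xM].
rewrite subr0 cabsM cabs_real ger0_norm ?expR_ge0//.
apply: (@le_trans _ _ (M * expR (e / 2 * x) * expR (- (e * x)))).
  by rewrite ler_wpM2r ?expR_ge0// HM// ltW.
rewrite -mulrA -expRD.
have -> : e / 2 * x - e * x = - (e / 2 * x) by field.
rewrite expRN ler_pdivrMr ?expR_gt0//.
apply: le_trans (ler_norm M) _.
apply: (@le_trans _ _ (d * (e / 2 * x))).
  rewrite ltr_pdivrMr// in xM.
  by move: (ltW xM); rewrite ler_pdivrMr//; lra.
rewrite ler_wpM2l ?(ltW d0)//; apply: le_trans (expR_ge1Dx _); by rewrite lerDr.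
Qed.

Definition zext f x : C := if 0 <= x then f x else 0.

(** As f and f' vanish at 0, gluing with zero stays differentiable there. Iterated over all
    derivatives this makes the extension of an element of P smooth on the whole line. *)
Lemma zext_rderiv f g : (forall x, 0 <= x -> hderivable f x) ->
  (forall x, 0 <= x -> g x = hderive f x) ->
  f 0 = 0 -> g 0 = 0 -> forall x, rderiv (zext f) x (zext g x).
Proof.
move=> df gE f0 g0 x; apply/rderiv_epsP => e e0.
have [x0|x0] := ltP x 0.
  exists (- x); first by rewrite oppr_gt0.
  move=> h; rewrite ltr_norml opprK => /andP[_ hx].
  have xh : (0 <= x + h) = false by apply/negbTE; rewrite -ltNge; lra.
  by rewrite /zext (leNgt 0 x) x0 xh /= mul0r !subr0 cabs0 mulr_ge0// ltW.
have [d d0 hd] := hderivable_eps (df x x0) e0.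
have [xz|xp] := eqVneq x 0.
  exists d => // h hlt; rewrite xz /zext add0r lexx f0 g0 mul0r !subr0.
  case: ifP => h0; last by rewrite cabs0 mulr_ge0// ltW.
  have := hd h h0; rewrite xz subr0 => /(_ hlt).
  by rewrite f0 subr0 -gE// g0 mul0r subr0.
exists (Num.min d x); first by rewrite lt_min d0 lt_def xp.
move=> h; rewrite lt_min => /andP[hlt]; rewrite ltr_norml => /andP[h1 h2].
have xh : 0 <= x + h by lra.
rewrite /zext x0 xh gE//; have := hd (x + h) xh.
by rewrite (_ : x + h - x = h); [exact|ring].
Qed.

Lemma zext_ge f x : 0 <= x -> zext f x = f x.
Proof. by rewrite /zext => ->. Qed.
Lemma zext_lt f x : x < 0 -> zext f x = 0.
Proof. by rewrite /zext ltNge => /negbTE ->. Qed.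

Lemma hderiveS n f : hderiven n.+1 f = hderive (hderiven n f).
Proof. by []. Qed.

Lemma spaceP_rderiv f : spaceP f ->
  forall n x, rderiv (zext (hderiven n f)) x (zext (hderiven n.+1 f) x).
Proof. by move=> [d1 d2 _] n x; apply: zext_rderiv => //; exact: d1. Qed.

(** The limit condition bounds the function beyond some Y, and continuity bounds it on [0, Y]. *)
Lemma spaceP_growth f : spaceP f -> forall n e, 0 < e -> exists2 M, 0 <= M &
  forall x, cabs (zext (hderiven n f) x) <= M * expR (e * x).
Proof.
move=> Pf n e e0; have [_ _ d3] := Pf.
have /cvg_pinftyP /(_ 1 ltr01)[X HX] := d3 e n e0.
have cf : rcont (zext (hderiven n f)) := rcont_rderiv (spaceP_rderiv Pf n).
pose Y := Num.max 0 X.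
have Y0 : 0 <= Y by rewrite le_max lexx.
have [c1 c2] := rcon_within (cf 0 Y).
have [x1 _ h1] := EVT_max Y0 c1; have [y1 _ k1] := EVT_min Y0 c1.
have [x2 _ h2] := EVT_max Y0 c2; have [y2 _ k2] := EVT_min Y0 c2.
set F := zext _ in cf c1 c2 h1 k1 h2 k2 *.
pose B := `|Re (F x1)| + `|Re (F y1)| + (`|Im (F x2)| + `|Im (F y2)|).
have B0 : 0 <= B by rewrite !addr_ge0.
exists (B + 1) => [|x]; first by rewrite addr_ge0.
have [x0|x0] := ltP x 0; first by rewrite /F zext_lt// cabs0 mulr_ge0 ?expR_ge0// addr_ge0.
have ex1 : 1 <= expR (e * x) by rewrite -expR0 ler_expR mulr_ge0// ltW.
have [xY|xY] := leP x Y.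
  apply: (@le_trans _ _ B); last first.
    by apply: (@le_trans _ _ ((B + 1) * 1)); [rewrite mulr1 lerDl|rewrite ler_wpM2l// addr_ge0].
  have xi : x \in `[0, Y] by rewrite in_itv/= x0.
  apply: le_trans (cabs_le _) _; apply: lerD.
  - have u1 := h1 x xi; have u2 := k1 x xi; rewrite ler_norml.
    have := ler_norm (Re (F x1)); have := lerNnormlW (lexx `|Re (F y1)|).
    have := normr_ge0 (Re (F x1)); have := normr_ge0 (Re (F y1)).
    by move=> *; apply/andP; split; lra.
  - have u1 := h2 x xi; have u2 := k2 x xi; rewrite ler_norml.
    have := ler_norm (Im (F x2)); have := lerNnormlW (lexx `|Im (F y2)|).
    have := normr_ge0 (Im (F x2)); have := normr_ge0 (Im (F y2)).
    by move=> *; apply/andP; split; lra.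
have xX : X < x by apply: le_lt_trans xY; rewrite le_max lexx orbT.
have := HX x xX; rewrite subr0 cabsM cabs_real ger0_norm ?expR_ge0// expRN.
rewrite ler_pdivrMr ?expR_gt0// mul1r /F zext_ge// => h.
by apply: le_trans h _; rewrite ler_peMl ?expR_ge0// lerDr.
Qed.

Lemma rderiv_eps_half f F x l : 0 <= x -> (forall y, 0 <= y -> f y = F y) ->
  rderiv F x l -> hderivable f x /\ hderive f x = l.
Proof.
move=> x0 fF /rderiv_epsP H; apply: eps_hderivable => // e /H[d d0 hd].
exists d => // y y0 yx; rewrite !fF//.
by have := hd (y - x) yx; rewrite (_ : x + (y - x) = y)//; ring.
Qed.

Lemma spaceP_intro f (F : nat -> R -> C) : (forall x, 0 <= x -> f x = F 0%N x) ->
  (forall n x, rderiv (F n) x (F n.+1 x)) -> (forall n, F n 0 = 0) ->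
  (forall n e, 0 < e -> exists M, forall x, 0 <= x -> cabs (F n x) <= M * expR (e * x)) ->
  spaceP f /\ forall n x, 0 <= x -> hderiven n f x = F n x.
Proof.
move=> fF dF F0 gF.
have E n : forall x, 0 <= x -> hderiven n f x = F n x.
  elim: n => [//|n ih] x x0; rewrite hderiveS.
  by have [] := rderiv_eps_half x0 ih (dF n x).
split=> //; split.
- by move=> n x x0; have [] := rderiv_eps_half x0 (E n) (dF n x).
- by move=> n; rewrite E.
- move=> e n e0; apply: growth_cvg => // d /(gF n)[M HM].
  by exists M => x x0; rewrite E// HM.
Qed.

End SpaceP.

(** * Rapidly decreasing holomorphic functions and their Bromwich integrals *)

Section Symbols.
Variable R : realType.
Local Notation C := (Cplx R).
Implicit Types (F G : C -> C) (x y e s t M : R) (p : C).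

(* The Laplace transforms of the elements of P; see [lap_sym] and [iL_spaceP]. *)
Definition sym F : Prop :=
  (forall p, 0 < Re p -> exists l, cderiv F p l) /\
  (forall s, 0 < s -> forall n : nat, exists M, forall p, s <= Re p ->
     cabs (F p) * cabs p ^+ n <= M).

(** The bounds of orders n and n + 2 add up to a bound with the factor 1 + (Im p)^2, since (Im p)^2
    <= |p|^2. *)
Lemma sym_ker F s n : sym F -> 0 < s -> exists2 M, 0 <= M & forall p,
  s <= Re p -> cabs (F p) * cabs p ^+ n <= M * ker (Im p).
Proof.
move=> [_ dF] s0; have [M1 H1] := dF s s0 n; have [M2 H2] := dF s s0 n.+2.
have H p : s <= Re p -> cabs (F p) * cabs p ^+ n <= (M1 + M2) * ker (Im p).
  move=> sp; rewrite /ker ler_pdivlMr; last by rewrite /oneDsqr ltr_pwDl ?sqr_ge0.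
  rewrite /oneDsqr mulrDr mulr1; apply: lerD; first exact: H1.
  apply: le_trans (H2 p sp).
  have -> : cabs (F p) * cabs p ^+ n.+2 = cabs (F p) * cabs p ^+ n * cabs p ^+ 2.
    by rewrite -mulrA -exprD addn2.
  by rewrite ler_wpM2l ?mulr_ge0 ?cabs_ge0 ?exprn_ge0 ?cabs_ge0// cabs_sqr lerDr sqr_ge0.
exists (M1 + M2) => //.
have := le_trans (mulr_ge0 (cabs_ge0 _) (exprn_ge0 n (cabs_ge0 _))) (H s%:C (lexx _)).
by rewrite pmulr_lge0 ?ker_gt0.
Qed.

Lemma symX F : sym F -> sym (fun p => p * F p).
Proof.
move=> [hF dF]; split.
  by move=> p /hF[l hl]; eexists; exact: hasdM (hasd_id _ _) hl.
move=> s s0 n; have [M H] := dF s s0 n.+1; exists M => p /H; rewrite cabsM exprS.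
by rewrite mulrCA mulrA.
Qed.

Lemma symXn F n : sym F -> sym (fun p => p ^+ n * F p).
Proof.
move=> sF; elim: n => [|n ih]; first by under eq_fun do rewrite expr0 mul1r.
by under eq_fun do rewrite exprS -mulrA; exact: symX.
Qed.

Definition lint F s x : C := cI (fun t => F (s +i* t) * cexp (x%:C * (s +i* t))).
(** On Re p = 1 one has dp = i dt, so the factor i cancels against 1 / (2 i pi). *)
Definition iL F x : C := ((2 * pi)^-1)%:C * lint F 1 x.

Lemma lint_cont F s x : 0 < s -> sym F ->
  rcont (fun t => F (s +i* t) * cexp (x%:C * (s +i* t))).
Proof.
move=> s0 [hF _]; apply: rcon_global => t.
have [|l hl] := hF (s +i* t); first by [].
have h2 : cderiv (fun p => cexp (x%:C * p)) (s +i* t) (cexp (x%:C * (s +i* t)) * (x%:C * 1)).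
  apply: (@hasd_comp _ _ (@cexp R) (fun p => x%:C * p)); first exact: cderiv_cexp.
  by apply: hasdZ; exact: hasd_id.
have := rderiv_ver (hasdM hl h2); by eexists; eassumption.
Qed.

Lemma lint_dom F s x : 0 < s -> sym F -> exists2 M, 0 <= M &
  forall s' t y, s <= s' -> cabs (F (s' +i* t) * cexp (y%:C * (s' +i* t))) <= M * expR (y * s') * ker t.
Proof.
move=> s0 sF; have [M M0 HM] := sym_ker 0 sF s0; exists M => // s' t y ss.
rewrite cabsM cabs_cexp ReMr /= mulrAC ler_wpM2r ?expR_ge0//.
by have := HM (s' +i* t) ss; rewrite expr0 mulr1.
Qed.

Lemma lint_line F s s' x : 0 < s -> s <= s' -> sym F -> lint F s x = lint F s' x.
Proof.
move=> s0 ss sF; have [M M0 HM] := lint_dom x s0 sF.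
apply: (@shift_ver R (fun p => F p * cexp (x%:C * p)) s s' (M * expR (`|x| * s'))) => //.
- move=> p /andP[p0 _]; have [hF _] := sF.
  have [l hl] := hF p (lt_le_trans s0 p0).
  eexists; apply: hasdM hl _.
  apply: (@hasd_comp _ _ (@cexp R) (fun p => x%:C * p)); first exact: cderiv_cexp.
  by apply: hasdZ; exact: hasd_id.
- move=> u t /andP[u1 u2]; apply: le_trans (HM u t x u1) _.
  rewrite ler_wpM2r ?ker_ge0// ler_wpM2l// ler_expR.
  apply: (@le_trans _ _ (`|x| * u)); last by rewrite ler_wpM2l.
  by rewrite ler_wpM2r ?ler_norm// (le_trans (ltW s0)).
Qed.

Lemma iL_line F s x : 0 < s -> sym F -> iL F x = ((2 * pi)^-1)%:C * lint F s x.
Proof.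
move=> s0 sF; congr (_ * _); have [s1|s1] := leP s 1.
  by rewrite (lint_line x s0 s1 sF).
by rewrite (lint_line x ltr01 (ltW s1) sF).
Qed.

Lemma cabs_2pi : cabs ((2 * pi)^-1)%:C = (2 * pi)^-1 :> R.
Proof. by rewrite cabs_real ger0_norm// invr_ge0 mulr_ge0 ?pi_ge0. Qed.

(** The line of integration is moved to Re p = s. As s is arbitrarily small, this is the
    subexponential growth required by P. *)
Lemma iL_bnd F s : 0 < s -> sym F -> exists2 M, 0 <= M &
  forall x, cabs (iL F x) <= M * expR (s * x).
Proof.
move=> s0 sF; have [M M0 HM] := lint_dom 0 s0 sF.
have p0 : 0 <= (2 * pi)^-1 :> R by rewrite invr_ge0 mulr_ge0 ?pi_ge0.
exists ((2 * pi)^-1 * (M * pi)) => [|x]; first by rewrite !mulr_ge0 ?pi_ge0.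
rewrite (iL_line x s0 sF) cabsM cabs_2pi -mulrA ler_wpM2l//.
have := @cI_dom R (M * expR (x * s)) (fun t => F (s +i* t) * cexp (x%:C * (s +i* t))) _ _.
rewrite -/(lint F s x) [s * x]mulrC => h.
have -> : M * pi * expR (x * s) = M * expR (x * s) * pi by ring.
apply: h; first exact: cmeas_rcont (lint_cont x s0 sF).
by move=> t; exact: HM.
Qed.

(** The line is pushed to Re p = s with s large: |e^(xp)| <= 1 there, and one spare power of |p| >=
    s leaves a bound of order 1 / s. Applied to p^n F at x = 0, this gives the flatness of
    [iL F]. *)
Lemma iL_neg F x : x <= 0 -> sym F -> iL F x = 0.
Proof.
move=> x0 sF; apply/eqP; rewrite -cabs_eq0; apply/eqP/le_anti; rewrite cabs_ge0 andbT.
have [M M0 HM] := sym_ker 1 sF ltr01.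
have p0 : 0 <= (2 * pi)^-1 :> R by rewrite invr_ge0 mulr_ge0 ?pi_ge0.
apply/ler_addgt0Pl => e e0; rewrite addr0.
pose s := Num.max 1 ((2 * pi)^-1 * (M * pi) / e).
have s1 : 1 <= s by rewrite le_max lexx.
have s0 : 0 < s by apply: lt_le_trans s1.
rewrite (iL_line x s0 sF) cabsM cabs_2pi.
have h : cabs (lint F s x) <= M / s * pi.
  apply: cI_dom; first exact: cmeas_rcont (lint_cont x s0 sF).
  move=> t; rewrite cabsM cabs_cexp ReMr /=.
  apply: (@le_trans _ _ (cabs (F (s +i* t)))).
    rewrite ler_piMr ?cabs_ge0// -expR0 ler_expR.
    by rewrite mulr_le0_ge0// ltW.
  rewrite mulrAC ler_pdivlMr//; apply: le_trans (HM (s +i* t) s1).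
  by rewrite expr1 ler_wpM2l ?cabs_ge0//; exact: (cabs_Re_ge (s +i* t)).
apply: le_trans (ler_wpM2l p0 h) _.
have -> : (2 * pi)^-1 * (M / s * pi) = (2 * pi)^-1 * (M * pi) / s by ring.
rewrite ler_pdivrMr// [e * s]mulrC -ler_pdivrMr//.
by rewrite le_max lexx orbT.
Qed.

(** The second-order remainder of e^(hp) costs a factor |p|^2, which the decay of order 2 of F pays
    for. *)
Lemma iL_rderiv F x : sym F -> rderiv (iL F) x (iL (fun p => p * F p) x).
Proof.
move=> sF; have sF1 := symX sF.
have p0 : 0 <= (2 * pi)^-1 :> R by rewrite invr_ge0 mulr_ge0 ?pi_ge0.
have [M M0 HM] := sym_ker 2 sF ltr01.
pose K := (2 * pi)^-1 * (M * expR (`|x| + 1) * pi).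
have K0 : 0 <= K by rewrite !mulr_ge0 ?expR_ge0 ?pi_ge0.
have key h : `|h| <= 1 -> cabs (iL F (x + h) - iL F x - iL (fun p => p * F p) x * h%:C) <= K * `|h| ^+ 2.
  move=> h1.
  have c1 y := lint_cont y ltr01 sF; have c2 := lint_cont x ltr01 sF1.
  have [M1 _ D1] := lint_dom 0 ltr01 sF; have [M2 _ D2] := lint_dom 0 ltr01 sF1.
  have i1 y : ci (fun t => F (1 +i* t) * cexp (y%:C * (1 +i* t))).
    by apply: (@ci_dom _ (M1 * expR (y * 1))); [exact: cmeas_rcont|move=> t; exact: D1].
  have i2 : ci (fun t => (1 +i* t) * F (1 +i* t) * cexp (x%:C * (1 +i* t))).
    by apply: (@ci_dom _ (M2 * expR (x * 1))); [exact: cmeas_rcont|move=> t; exact: D2].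
  rewrite /iL /lint.
  have -> : forall a b c d k : C, k * a - k * b - k * c * d = k * (a - b - d * c) by move=> *; ring.
  rewrite -cIB// -[h%:C * _]cIZ// -cIB//; last 2 first.
  - exact: ciB.
  - exact: ciZ.
  rewrite cabsM cabs_2pi /K -mulrA ler_wpM2l//.
  have -> : M * expR (`|x| + 1) * pi * `|h| ^+ 2 = M * expR (`|x| + 1) * `|h| ^+ 2 * pi by ring.
  apply: cI_dom.
    apply: cmeasB; first by apply: cmeasB; exact: cmeas_rcont.
    by apply: cmeasM; [exact: cmeas_cst|exact: cmeas_rcont].
  move=> t; set p : C := 1 +i* t.
  have -> : F p * cexp ((x + h)%:C * p) - F p * cexp (x%:C * p) - h%:C * (p * F p * cexp (x%:C * p)) =
     F p * cexp (x%:C * p) * (cexp (h%:C * p) - 1 - h%:C * p).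
    by rewrite realCD mulrDl cexpD; ring.
  rewrite !cabsM cabs_cexp ReMr mulr1.
  apply: (@le_trans _ _ (cabs (F p) * expR x * (cabs (h%:C * p) ^+ 2 * expR `|Re (h%:C * p)|))).
    by rewrite ler_wpM2l ?mulr_ge0 ?cabs_ge0 ?expR_ge0//; exact: cexp_taylor2.
  rewrite cabsM cabs_real ReMr /= mulr1 exprMn.
  have -> : cabs (F p) * expR x * (`|h| ^+ 2 * cabs p ^+ 2 * expR `|h|) =
    (cabs (F p) * cabs p ^+ 2) * (expR x * expR `|h| * `|h| ^+ 2) by ring.
  have -> : M * expR (`|x| + 1) * `|h| ^+ 2 * ker t = M * ker t * (expR (`|x| + 1) * `|h| ^+ 2) by ring.
  apply: ler_pM; rewrite ?mulr_ge0 ?cabs_ge0 ?expR_ge0 ?exprn_ge0 ?cabs_ge0//; first exact: HM.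
  by rewrite ler_wpM2r ?exprn_ge0// -expRD ler_expR lerD// ler_norm.
apply/rderiv_epsP => e e0.
exists (Num.min 1 (e / (K + 1))); first by rewrite lt_min ltr01 divr_gt0// ltr_wpDl.
move=> h; rewrite lt_min => /andP[h1 h2]; apply: le_trans (key h (ltW h1)) _.
rewrite expr2 mulrA ler_wpM2r//.
apply: (@le_trans _ _ ((K + 1) * `|h|)); first by rewrite ler_wpM2r// lerDl.
by rewrite mulrC -ler_pdivlMr ?ltr_wpDl// ltW.
Qed.

Lemma iL_spaceP F (f : R -> C) : sym F -> (forall x, 0 <= x -> f x = iL F x) ->
  spaceP f.
Proof.
move=> sF fE.
have [] // := @spaceP_intro R f (fun n => iL (fun p => p ^+ n * F p)).
- move=> x x0; rewrite fE//; congr (iL _ x); apply/funext => p; by rewrite expr0 mul1r.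
- move=> n x; have := iL_rderiv x (symXn n sF).
  by under [X in rderiv _ _ (iL X _)]eq_fun do rewrite mulrA -exprS.
- by move=> n; apply: iL_neg => //; exact: symXn.
- move=> n e e0; have [M _ HM] := iL_bnd e0 (symXn n sF).
  by exists M => x _; exact: HM.
Qed.

Lemma iL_eq F G x : (forall p, 0 < Re p -> F p = G p) -> iL F x = iL G x.
Proof. by move=> FG; congr (_ * _); congr cI; apply/funext => t; rewrite FG. Qed.

Definition lap (f : R -> C) p : C := cI (fun y => zext f y * cexp (- p * y%:C)).

Lemma growth_ker s : 0 < s -> exists2 M, 0 <= M & forall y, 0 <= y -> expR (- (s * y)) <= M * ker y.
Proof.
move=> s0; have [M M0 HM] := abel_dom s0; exists M => // y y0.
by have := HM y; rewrite ger0_norm.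
Qed.

(** The power k = 0 serves the transform itself, k = 1 its derivative in p, and k = 2 the quadratic
    remainder. Growth e^(sy/4) of the function against e^(-sy) leaves more than the decay e^(-sy/2)
    that is used. *)
Lemma lap_dom f n s : spaceP f -> 0 < s -> exists2 M, 0 <= M & forall k p y,
  (k <= 2)%N -> s <= Re p ->
  cabs (zext (hderiven n f) y * cexp (- p * y%:C)) * `|y| ^+ k <= M * ker y.
Proof.
move=> Pf s0; have s2 : 0 < s / 2 by rewrite divr_gt0.
have s4 : 0 < s / 2 / 2 by rewrite divr_gt0.
have [M1 M10 H1] := spaceP_growth Pf n s4.
have H k : exists2 M, 0 <= M & forall y, 0 <= y -> y ^+ k * expR (- (s / 2 * y)) <= M * ker y.
  have [M HM] := pow_exp_ker k s2; exists M => //.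
  have := le_trans (mulr_ge0 (exprn_ge0 k (lexx 0)) (expR_ge0 _)) (HM 0 (lexx _)).
  by rewrite pmulr_lge0 ?ker_gt0.
have [A0 A00 HA0] := H 0%N; have [A1 A10 HA1] := H 1%N; have [A2 A20 HA2] := H 2%N.
exists (M1 * (A0 + A1 + A2)) => [|k p y k2 sp]; first by rewrite mulr_ge0// !addr_ge0.
have [y0|y0] := ltP y 0.
  by rewrite zext_lt// mul0r cabs0 mul0r !mulr_ge0 ?ker_ge0// !addr_ge0.
rewrite cabsM cabs_cexp mulNr ReN mulrC -mulrA mulrC [p * _]mulrC ReMr.
rewrite (ger0_norm y0).
apply: (@le_trans _ _ (M1 * expR (s / 2 / 2 * y) * (expR (- (s * y)) * y ^+ k))).
  rewrite -[leLHS]mulrA; apply: ler_pM; rewrite ?cabs_ge0 ?mulr_ge0 ?expR_ge0 ?exprn_ge0 ?H1//.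
  by rewrite ler_wpM2r ?exprn_ge0// ler_expR lerN2 mulrC ler_wpM2l.
rewrite -[X in X <= _]mulrA ler_wpM2l//.
apply: (@le_trans _ _ (y ^+ k * expR (- (s / 2 * y)))).
  rewrite mulrA -expRD mulrC ler_wpM2l ?exprn_ge0// ler_expR.
  by have : 0 <= s * y by [rewrite mulr_ge0// ltW]; lra.
have k0 := ker_ge0 y.
apply: (@le_trans _ _ ((A0 + A1 + A2) * ker y)); last by [].
case: k k2 => [|[|[|//]]] _.
- apply: le_trans (HA0 y y0) _; rewrite ler_wpM2r// -addrA lerDl addr_ge0//.
- by apply: le_trans (HA1 y y0) _; rewrite ler_wpM2r// addrAC lerDr addr_ge0//.
- by apply: le_trans (HA2 y y0) _; rewrite ler_wpM2r// lerDr addr_ge0//.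
Qed.

End Symbols.

(** * The Laplace transform as a bijection from P onto the symbols *)

Section LaplaceInversion.
Variable R : realType.
Local Notation C := (Cplx R).
Implicit Types (F G : C -> C) (f : R -> C) (x y e s t M : R) (p : C).

Lemma rderiv_lap_exp p y : rderiv (fun y => cexp (- p * y%:C)) y (- p * cexp (- p * y%:C)).
Proof.
rewrite (_ : (fun y => cexp (- p * y%:C)) = (fun y => cexp (y%:C * - p))); last first.
  by apply/funext => u; rewrite mulrC.
have := rderiv_cexp_lin (- p) y; congr (rderiv _ _ _); rewrite [y%:C * _]mulrC.
by rewrite // mulrC.
Qed.

Lemma lap_cont f n p : spaceP f -> rcont (fun y => zext (hderiven n f) y * cexp (- p * y%:C)).
Proof.
move=> Pf; apply: rcon_global => y; eexists.
exact: hasdM (spaceP_rderiv Pf n y) (rderiv_lap_exp p y).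
Qed.

Lemma lap_ci f n p : spaceP f -> 0 < Re p ->
  ci (fun y => zext (hderiven n f) y * cexp (- p * y%:C)).
Proof.
move=> Pf p0; have [M M0 HM] := lap_dom n Pf p0.
apply: (ci_dom (M := M)); first exact: cmeas_rcont (lap_cont n p Pf).
by move=> y; have := HM 0%N p y isT (lexx _); rewrite expr0 mulr1.
Qed.

(** Integration by parts: the difference of the two sides is the integral of the derivative of
    f^(n)(y) e^(-py), whose boundary terms vanish at 0 by flatness and at infinity by decay. *)
Lemma lap_deriv f n p : spaceP f -> 0 < Re p ->
  lap (hderiven n.+1 f) p = p * lap (hderiven n f) p.
Proof.
move=> Pf p0; apply/eqP; rewrite -subr_eq0; apply/eqP.
rewrite /lap -cIZ; last exact: lap_ci.
rewrite -cIB; [|exact: lap_ci|exact/ciZ/lap_ci].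
pose F y : C := zext (hderiven n f) y * cexp (- p * y%:C).
pose g y : C := zext (hderiven n.+1 f) y * cexp (- p * y%:C) - p * (zext (hderiven n f) y * cexp (- p * y%:C)).
have [M M0 HM] := lap_dom n Pf p0; have [M' M0' HM'] := lap_dom n.+1 Pf p0.
have dF y : rderiv F y (g y).
  apply: hasd_eql (hasdM (spaceP_rderiv Pf n y) (rderiv_lap_exp p y)).
  by rewrite /g /=; ring.
have cg : rcont g.
  apply: rcon_global => y; eexists; apply: hasdB.
    exact: hasdM (spaceP_rderiv Pf n.+1 y) (rderiv_lap_exp p y).
  apply: hasdZ; exact: hasdM (spaceP_rderiv Pf n y) (rderiv_lap_exp p y).
have [_ Z _] := Pf.
have g0 y : y <= 0 -> g y = 0.
  rewrite le_eqVlt => /predU1P[->|y0]; last by rewrite /g !zext_lt// !mul0r mulr0 subrr.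
  by rewrite /g !zext_ge// !Z !mul0r mulr0 subrr.
have gE : onpos g = g.
  by apply/funext => y; rewrite /onpos; case: ltP => // /g0 ->.
have dg : dom (M' + cabs p * M) g.
  move=> y; rewrite /g; apply: le_trans (cabsB _ _) _; rewrite mulrDl; apply: lerD.
    by have := HM' 0%N p y isT (lexx _); rewrite expr0 mulr1.
  rewrite cabsM -mulrA ler_wpM2l ?cabs_ge0//.
  by have := HM 0%N p y isT (lexx _); rewrite expr0 mulr1.
have := @cI_FTC0 R F g (M' + cabs p * M) (fun x _ => dF x) (cg 0) (cmeas_rcont cg).
rewrite gE => /(_ dg) h; rewrite -/g h.
  by rewrite /F zext_ge// Z mul0r oppr0.
have M1 : 0 < M + 1 by rewrite ltr_wpDl.
move=> e e0; have [N HN] := ker_small (divr_gt0 e0 M1); exists N => k /HN hk.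
apply: (@le_trans _ _ (M * ker k%:R)).
  by have := HM 0%N p k%:R isT (lexx _); rewrite expr0 mulr1.
apply: (@le_trans _ _ ((M + 1) * ker k%:R)); first by rewrite ler_wpM2r ?ker_ge0// lerDl.
by rewrite mulrC -ler_pdivlMr.
Qed.

Lemma lap_derivn f n p : spaceP f -> 0 < Re p ->
  lap (hderiven n f) p = p ^+ n * lap f p.
Proof.
move=> Pf p0; elim: n => [|n ih]; first by rewrite mul1r.
by rewrite lap_deriv// ih exprS mulrA.
Qed.

(** Decay holds because p^n times the transform is the transform of f^(n), bounded on Re p >= s;
    holomorphy by differentiation under the integral sign. *)
Lemma lap_sym f : spaceP f -> sym (lap f).
Proof.
move=> Pf; split=> [p p0|s s0 n]; last first.
  have [M M0 HM] := lap_dom n Pf s0; exists (M * pi) => p sp.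
  rewrite mulrC -cabsX -cabsM -lap_derivn//; last exact: lt_le_trans sp.
  apply: cI_dom; first exact: cmeas_rcont (lap_cont n p Pf).
  by move=> y; have := HM 0%N p y isT sp; rewrite expr0 mulr1.
pose s := Re p / 2; have s0 : 0 < s by rewrite divr_gt0.
have [M M0 HM] := lap_dom 0 Pf s0.
pose d : C := cI (fun y => zext f y * cexp (- p * y%:C) * - y%:C).
have sp : s <= Re p by rewrite /s; lra.
have cd : cmeas (fun y => zext f y * cexp (- p * y%:C) * - y%:C).
  apply: cmeasM; first exact: cmeas_rcont (lap_cont 0 p Pf).
  by apply: cmeasN; apply: cmeas_real.
have id1 : ci (fun y => zext f y * cexp (- p * y%:C) * - y%:C).
  apply: (ci_dom cd (M := M)) => y; rewrite cabsM cabsN cabs_real.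
  by have := HM 1%N p y isT sp; rewrite expr1.
have key u : cabs u <= s -> cabs (lap f (p + u) - lap f p - d * u) <= M * pi * cabs u ^+ 2.
  move=> us; have pu : 0 < Re (p + u).
    rewrite ReD; have := le_trans (Re_le_cabs u) us; rewrite ler_norml /s => /andP[]; move: p0; lra.
  rewrite /lap /d [_ * u]mulrC -cIZ// -cIB; [|exact: (@lap_ci f 0)|exact: (@lap_ci f 0)].
  rewrite -cIB; [|apply: ciB; exact: (@lap_ci f 0)|exact: ciZ].
  rewrite mulrAC; apply: cI_dom.
    apply: cmeasB; first by apply: cmeasB; exact: cmeas_rcont (@lap_cont f 0 _ Pf).
    by apply: cmeasM => //; exact: cmeas_cst.
  move=> y.
  have -> : zext f y * cexp (- (p + u) * y%:C) - zext f y * cexp (- p * y%:C) -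
      u * (zext f y * cexp (- p * y%:C) * - y%:C) =
      zext f y * cexp (- p * y%:C) * (cexp (- u * y%:C) - 1 - - u * y%:C).
    by rewrite opprD mulrDl cexpD; ring.
  rewrite cabsM.
  apply: (@le_trans _ _ (cabs (zext f y * cexp (- p * y%:C)) * (cabs (- u * y%:C) ^+ 2 * expR `|Re (- u * y%:C)|))).
    by rewrite ler_wpM2l ?cabs_ge0//; exact: cexp_taylor2.
  have [y0|y0] := ltP y 0.
    by rewrite zext_lt// mul0r cabs0 mul0r !mulr_ge0 ?ker_ge0 ?exprn_ge0 ?cabs_ge0.
  apply: (@le_trans _ _ (cabs (zext f y * cexp (- p * y%:C)) * (cabs (- u * y%:C) ^+ 2 * expR (cabs u * y)))).
    rewrite ler_wpM2l ?cabs_ge0// ler_wpM2l ?exprn_ge0 ?cabs_ge0// ler_expR.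
    apply: le_trans (Re_le_cabs _) _; by rewrite cabsM cabsN cabs_real ger0_norm.
  (* The factor e^(|u| y) of the Taylor remainder is absorbed by moving p to p - |u|, which still
     has real part at least s because |u| <= s = Re p / 2. *)
  have h := HM 2%N (p - (cabs u)%:C) y isT.
  have -> : cabs (zext f y * cexp (- p * y%:C)) * (cabs (- u * y%:C) ^+ 2 * expR (cabs u * y)) =
     cabs u ^+ 2 * (cabs (zext f y * cexp (- (p - (cabs u)%:C) * y%:C)) * `|y| ^+ 2).
    rewrite !cabsM !cabs_cexp cabsN cabs_real exprMn.
    have -> : Re (- (p - (cabs u)%:C) * y%:C) = Re (- p * y%:C) + cabs u * y.
      by rewrite [_ * y%:C]mulrC ReMr [- p * _]mulrC ReMr !ReN ReB /=; ring.
    by rewrite expRD; ring.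
  have -> : M * cabs u ^+ 2 * ker y = cabs u ^+ 2 * (M * ker y) by ring.
  rewrite ler_wpM2l ?exprn_ge0 ?cabs_ge0//; apply: h.
  by rewrite ReB /=; move: us; rewrite /s; lra.
exists d => e e0.
have K0 : 0 < M * pi + 1 by rewrite ltr_wpDl// mulr_ge0// pi_ge0.
exists (Num.min s (e / (M * pi + 1))); first by rewrite lt_min s0 divr_gt0.
move=> u _; rewrite lt_min => /andP[/ltW us ue]; apply: le_trans (key u us) _.
rewrite expr2 mulrA ler_wpM2r ?cabs_ge0//.
apply: (@le_trans _ _ ((M * pi + 1) * cabs u)); first by rewrite ler_wpM2r ?cabs_ge0// lerDl.
by rewrite mulrC -ler_pdivlMr// ltW.
Qed.

(** Fourier inversion for y -> f(y) e^(-y), whose transform at w is the Laplace transform at 1 + i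
    w. *)
Lemma iL_lap f x : spaceP f -> 0 <= x -> iL (lap f) x = f x.
Proof.
move=> Pf x0; have sf := lap_sym Pf.
pose phi y : C := zext f y * cexp (- 1 * y%:C).
have [M M0 HM] := lap_dom 0 Pf ltr01.
have [M' M0' HM'] := sym_ker 0 sf ltr01.
have psiE w : cI (fun t => phi t * cexp ('i * (- 1 * w * t)%:C)) = lap f (1 +i* w).
  congr cI; apply/funext => t; rewrite /phi -mulrA -cexpD; congr (_ * cexp _).
  by apply: cplx_ext; rewrite ?ReD ?ImD ?ReM ?ImM ?ReN ?ImN /=; ring.
have [] := @fourier_inversion R phi M M' (-1) x.
- by rewrite sqrrN expr1n.
- exact: (@lap_cont f 0 1 Pf).
- by move=> y; have := HM 0%N 1 y isT (lexx _); rewrite expr0 mulr1.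
- by move=> w; rewrite psiE; have := HM' (1 +i* w) (lexx _); rewrite expr0 mulr1.
move=> _; rewrite (_ : (fun w => cI _ * _) = (fun w => cexp (- x%:C) * (lap f (1 +i* w) * cexp (x%:C * (1 +i* w))))); last first.
  apply/funext => w; rewrite psiE mulrCA -cexpD; congr (_ * cexp _).
  by apply: cplx_ext; rewrite ?ReD ?ImD ?ReM ?ImM ?ReN ?ImN /=; ring.
have [M2 M20 D2] := lint_dom 0 ltr01 sf.
rewrite cIZ; last first.
  apply: (@ci_dom _ (M2 * expR (x * 1))); first exact: cmeas_rcont (lint_cont x ltr01 sf).
  by move=> t; exact: D2.
rewrite -/(lint (lap f) 1 x) /iL /phi zext_ge// => h.
have pn : (2 * pi)%:C != 0 :> C by rewrite -cabs_eq0 cabs_real normr_eq0 gt_eqF// mulr_gt0// pi_gt0.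
rewrite realCV; apply: (mulfI pn); rewrite mulVKf//.
apply: (mulfI (cexp_neq0 (- x%:C))); rewrite h mulN1r; ring.
Qed.

(** Fourier inversion on the vertical line through p. The transform there is 2 pi e^(-sx) times
    [iL F x]; it is integrable since [iL F] vanishes for x <= 0 and is O(e^(sx/2)). *)
Lemma lap_iL F p : sym F -> 0 < Re p -> lap (iL F) p = F p.
Proof.
move=> sF p0; set s := Re p in p0.
pose t0 := Im p; have pE : p = s +i* t0 by apply: cplx_ext.
have s2 : 0 < s / 2 by rewrite divr_gt0.
pose phi t : C := F (s +i* t).
have pn : (2 * pi)%:C != 0 :> C by rewrite -cabs_eq0 cabs_real normr_eq0 gt_eqF// mulr_gt0// pi_gt0.
have psiE x : cI (fun t => phi t * cexp ('i * (1 * x * t)%:C)) = (2 * pi)%:C * (cexp (- (s * x)%:C) * iL F x).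
  rewrite (iL_line x p0 sF) realCV.
  have -> : forall E L : C, (2 * pi)%:C * (E * ((2 * pi)%:C^-1 * L)) = E * L.
    by move=> E L; rewrite mulrCA; congr (_ * _); rewrite mulVKf.
  rewrite /lint -cIZ; last first.
    have [M2 M20 D2] := lint_dom 0 p0 sF.
    apply: (@ci_dom _ (M2 * expR (x * s))); first exact: cmeas_rcont (lint_cont x p0 sF).
    by move=> t; exact: D2.
  congr cI; apply/funext => t; rewrite /phi mulrCA -cexpD; congr (_ * cexp _).
  by apply: cplx_ext; rewrite ?ReD ?ImD ?ReM ?ImM ?ReN ?ImN /=; ring.
have [M M0 HM] := sym_ker 0 sF p0.
have [M1 M10 HM1] := iL_bnd s2 sF.
have [M2 M20 HM2] := growth_ker s2.
have pi2 : 0 <= 2 * pi :> R by rewrite mulr_ge0// pi_ge0.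
have [] := @fourier_inversion R phi M (2 * pi * (M1 * M2)) 1 t0.
- by rewrite expr1n.
- apply: rcon_global => t; have [hF _] := sF; have [|l hl] := hF (s +i* t); first by [].
  by eexists; exact: rderiv_ver hl.
- by move=> t; have := HM (s +i* t) (lexx _); rewrite expr0 mulr1.
- move=> x; rewrite psiE; have [x0|x0] := leP x 0.
    by rewrite iL_neg// !mulr0 cabs0 !mulr_ge0 ?pi_ge0 ?ker_ge0.
  have -> : 2 * pi * (M1 * M2) * ker x = 2 * pi * (M1 * M2 * ker x) by ring.
  rewrite cabsM cabs_real ger0_norm// ler_wpM2l//.
  rewrite cabsM cabs_cexp ReN /=.
  apply: (@le_trans _ _ (expR (- (s * x)) * (M1 * expR (s / 2 * x)))).
    by rewrite ler_wpM2l ?expR_ge0//; exact: HM1.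
  have -> : M1 * M2 * ker x = M1 * (M2 * ker x) by ring.
  rewrite mulrCA -expRD ler_wpM2l//; apply: le_trans (HM2 x (ltW x0)).
  by rewrite ler_expR; lra.
move=> _; rewrite (_ : (fun x => cI _ * _) = (fun x => (2 * pi)%:C * (zext (iL F) x * cexp (- p * x%:C)))); last first.
  apply/funext => x; rewrite psiE.
  have -> : zext (iL F) x = iL F x.
    by have [x0|x0] := ltP x 0; [rewrite zext_lt// iL_neg// ltW|rewrite zext_ge].
  have -> : cexp (- p * x%:C) = cexp (- (s * x)%:C) * cexp (- 'i * (1 * x * t0)%:C).
    rewrite -cexpD; congr cexp.
    by rewrite pE; apply: cplx_ext; rewrite ?ReD ?ImD ?ReM ?ImM ?ReN ?ImN /=; ring.
  by move: (iL F x) => w; ring.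
have PF : spaceP (iL F) by apply: iL_spaceP sF _.
rewrite cIZ; last exact: (@lap_ci _ 0).
by rewrite -/(lap (iL F) p) /phi -pE => /(mulfI pn).
Qed.

End LaplaceInversion.

(** * Powers acting on symbols, and holomorphy in the order of integration *)

Section SymbolOps.
Variable R : realType.
Local Notation C := (Cplx R).
Implicit Types (F G : C -> C) (f : R -> C) (x y e s t M a : R) (p r : C).

Lemma Re_cpw_lb a s : 0 < a < 1 -> 0 < s -> exists2 s', 0 < s' &
  forall p, s <= Re p -> s' <= Re (cpw p a%:C).
Proof.
move=> a01 s0; have /andP[a0 a1] := a01.
have c0 : 0 < cos (a * (pi / 2)) :> R.
  apply: cos_gt0_pihalf; have := pi_gt0 R => p0.
  apply/andP; split; first by apply: (@lt_trans _ _ 0); rewrite ?oppr_lt0 ?mulr_gt0 ?divr_gt0.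
  by rewrite gtr_pMl ?divr_gt0.
exists (cos (a * (pi / 2)) * s `^ a); first by rewrite mulr_gt0 ?powR_gt0.
move=> p sp; have p0 : 0 < Re p by apply: lt_le_trans sp.
apply: le_trans (Re_cpw_ge a01 p0); rewrite ler_wpM2l ?(ltW c0)//.
apply: ge0_ler_powR; rewrite ?nnegrE ?cabs_ge0 ?(ltW a0) ?(ltW s0)//.
exact: le_trans sp (cabs_Re_ge p).
Qed.

Lemma sym_cpw F a : 0 < a < 1 -> sym F -> sym (fun p => F (cpw p a%:C)).
Proof.
move=> a01 [hF dF]; have /andP[a0 a1] := a01; split.
  move=> p p0; have [s' s'0 hs'] := Re_cpw_lb a01 p0.
  have [l hl] := hF _ (lt_le_trans s'0 (hs' p (lexx _))).
  by eexists; exact: (@hasd_comp R setT F (fun q => cpw q a%:C) p _ _ hl (cderiv_cpw _ p0)).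
move=> s s0 n; have [s' s'0 hs'] := Re_cpw_lb a01 s0.
(* Decay of order m in p^a amounts to order a m in p, so a m >= n is required; the surplus power of
   |p| is bounded through |p| >= s. *)
pose m := Num.bound (n%:R / a); have am : n%:R <= a * m%:R.
  have : n%:R / a < m%:R by apply: archi_boundP; rewrite divr_ge0// ltW.
  by rewrite ltr_pdivrMr// mulrC => /ltW.
have [M HM] := dF s' s'0 m.
exists (s `^ (n%:R - a * m%:R) * M) => p sp.
have p0 : 0 < Re p by apply: lt_le_trans sp.
have ap := cabs_Re_gt0 p0.
have hM := HM _ (hs' p sp).
apply: (@le_trans _ _ (s `^ (n%:R - a * m%:R) * (cabs (F (cpw p a%:C)) * cabs (cpw p a%:C) ^+ m))); last first.
  by rewrite ler_wpM2l ?powR_ge0.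
rewrite mulrCA ler_wpM2l ?cabs_ge0// cabs_cpw_real//.
rewrite -powR_mulrn ?cabs_ge0// -[_ ^+ m]powR_mulrn ?powR_ge0// -powRrM.
have -> : cabs p `^ n%:R = cabs p `^ (n%:R - a * m%:R) * cabs p `^ (a * m%:R).
  by rewrite -powRD ?subrK// (gt_eqF ap) implybT.
rewrite ler_wpM2r ?powR_ge0//.
have k0 : 0 <= a * m%:R - n%:R by rewrite subr_ge0.
rewrite -[n%:R - _]opprB !powRN lef_pV2 ?posrE ?powR_gt0//.
apply: ge0_ler_powR; rewrite ?nnegrE ?cabs_ge0 ?(ltW s0)//.
exact: le_trans sp (cabs_Re_ge p).
Qed.

Lemma cabs_cpw_bnd r s : 0 < s -> exists K m, 0 <= K /\ forall p, s <= Re p ->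
  cabs (cpw p r) <= K * cabs p ^+ m.
Proof.
move=> s0; pose a := Re r; pose b := Im r.
pose m := Num.bound `|a|; have am : `|a| <= m%:R by exact/ltW/archi_boundP.
(* Since ln |p| >= ln s, Re r may be replaced by the integer m in front of ln |p| - ln s. The
   remaining terms restore ln s, and |Im r| pi/2 accounts for the argument of p. *)
exists (expR (`|a * ln s| - m%:R * ln s + `|b| * (pi / 2))), m; split; first exact: expR_ge0.
move=> p sp; have p0 : 0 < Re p by apply: lt_le_trans sp.
have ap := cabs_Re_gt0 p0.
rewrite /cpw cabs_cexp ReM -/a -/b /clog /=.
have -> : cabs p ^+ m = expR (m%:R * ln (cabs p)).
  by rewrite expRM_natl lnK.
rewrite -expRD ler_expR; set th := atan _.
have hth : `|th| <= pi / 2 by apply: ltW; exact: (Im_clog p).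
have ll : ln s <= ln (cabs p) by rewrite ler_ln ?posrE// (le_trans sp (cabs_Re_ge p)).
have h1 : - (b * th) <= `|b| * (pi / 2).
  apply: le_trans (ler_norm _) _; rewrite normrN normrM ler_wpM2l//.
have h2 : a * (ln (cabs p) - ln s) <= m%:R * (ln (cabs p) - ln s).
  by rewrite ler_wpM2r ?subr_ge0// (le_trans (ler_norm _)).
have h3 : a * ln s <= `|a * ln s| by exact: ler_norm.
move: h1 h2 h3; lra.
Qed.

Lemma sym_cpwM F r : sym F -> sym (fun p => cpw p r * F p).
Proof.
move=> [hF dF]; split.
  by move=> p p0; have [l hl] := hF p p0; eexists; exact: hasdM (cderiv_cpw r p0) hl.
move=> s s0 n; have [K [m [K0 hK]]] := cabs_cpw_bnd r s0.
have [M HM] := dF s s0 (m + n)%N; exists (K * M) => p sp.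
rewrite cabsM; apply: (@le_trans _ _ (K * cabs p ^+ m * cabs (F p) * cabs p ^+ n)).
  by rewrite ler_wpM2r ?exprn_ge0 ?cabs_ge0// ler_wpM2r ?cabs_ge0 ?hK.
have -> : K * cabs p ^+ m * cabs (F p) * cabs p ^+ n = K * (cabs (F p) * cabs p ^+ (m + n)).
  by rewrite exprD; ring.
by rewrite ler_wpM2l// HM.
Qed.

Lemma cabs_clog_le p : 1 <= Re p -> cabs (clog p) <= (1 + pi / 2) * cabs p /\
  expR (cabs (clog p)) <= expR (pi / 2) * cabs p.
Proof.
move=> p1; have p0 : 0 < Re p by apply: lt_le_trans p1.
have ap := cabs_Re_gt0 p0; have ap1 : 1 <= cabs p by apply: le_trans (cabs_Re_ge p).
have h : cabs (clog p) <= ln (cabs p) + pi / 2.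
  apply: le_trans (cabs_le _) _; apply: lerD; last exact: ltW (Im_clog p).
  by rewrite /clog /= ger0_norm// ln_ge0.
have pi0 : 0 <= pi / 2 :> R by rewrite divr_ge0 ?pi_ge0.
split.
  apply: le_trans h _; have -> : (1 + pi / 2) * cabs p = cabs p + pi / 2 * cabs p by ring.
  apply: lerD.
    exact/ltW/ln_sublinear.
  by rewrite ler_peMr.
by apply: (@le_trans _ _ (expR (ln (cabs p) + pi / 2))); rewrite ?ler_expR// expRD lnK// mulrC.
Qed.

(** Differentiation under the integral sign in r, where p^(-r) has derivative - p^(-r) log p. *)
Lemma iL_entire F x : sym F -> forall r, exists l, cderiv (fun r => iL (fun p => cpw p (- r) * F p) x) r l.
Proof.
move=> sF r; have [K [m [K0 hK]]] := cabs_cpw_bnd (- r) ltr01.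
(* For |u| <= 1 the Taylor remainder carries |log p|^2 e^|log p| = O(|p|^3), and p^(-r) itself costs
   |p|^m. *)
have [M M0 HM] := sym_ker (m + 3) sF ltr01.
have p0 : 0 <= (2 * pi)^-1 :> R by rewrite invr_ge0 mulr_ge0 ?pi_ge0.
have pi0 : 0 <= pi / 2 :> R by rewrite divr_ge0 ?pi_ge0.
pose q t : C := 1 +i* t.
pose c t : C := cpw (q t) (- r) * F (q t) * cexp (x%:C * q t).
pose B := K * M * expR x * (1 + pi / 2) ^+ 2 * expR (pi / 2).
have B0 : 0 <= B by rewrite !mulr_ge0 ?expR_ge0 ?exprn_ge0 ?addr_ge0.
have cc : rcont c by exact: (@lint_cont R (fun p => cpw p (- r) * F p) 1 x ltr01 (sym_cpwM (- r) sF)).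
have cl : rcont (fun t => clog (q t)).
  apply: rcon_global => t; eexists; apply: rderiv_ver; exact: (cderiv_clog (p := 1 +i* t) ltr01).
have cb t : cabs (c t) * (cabs (q t) ^+ 3) <= K * M * expR x * ker t.
  rewrite /c !cabsM cabs_cexp ReMr /= mulr1.
  apply: (@le_trans _ _ (K * cabs (q t) ^+ m * cabs (F (q t)) * expR x * cabs (q t) ^+ 3)).
    do 3 rewrite ler_wpM2r ?exprn_ge0 ?cabs_ge0 ?expR_ge0//.
    by apply: hK; rewrite /q.
  have -> : K * cabs (q t) ^+ m * cabs (F (q t)) * expR x * cabs (q t) ^+ 3 = K * expR x * (cabs (F (q t)) * cabs (q t) ^+ (m + 3)).
    by rewrite exprD; ring.
  have -> : K * M * expR x * ker t = K * expR x * (M * ker t) by ring.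
  by rewrite ler_wpM2l ?mulr_ge0 ?expR_ge0//; exact: HM.
have q1 t : 1 <= cabs (q t) by exact: (cabs_Re_ge (q t)).
pose d : C := ((2 * pi)^-1)%:C * cI (fun t => c t * - clog (q t)).
have id1 : ci (fun t => c t * - clog (q t)).
  apply: (@ci_dom _ (K * M * expR x * (1 + pi / 2))).
    by apply: cmeasM; [exact: cmeas_rcont|apply: cmeasN; exact: cmeas_rcont].
  move=> t; rewrite cabsM cabsN.
  have [h _] := @cabs_clog_le (q t) (lexx _).
  apply: (@le_trans _ _ (cabs (c t) * ((1 + pi / 2) * cabs (q t) ^+ 3))).
    rewrite ler_wpM2l ?cabs_ge0//; apply: le_trans h _; rewrite ler_wpM2l ?addr_ge0//.
    by rewrite -[leLHS]expr1 ler_weXn2l.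
  by rewrite mulrCA [leRHS]mulrAC mulrC ler_wpM2r ?addr_ge0.
have icr w : ci (fun t => cpw (q t) (- w) * F (q t) * cexp (x%:C * q t)).
  have [M2 _ D2] := lint_dom 0 ltr01 (sym_cpwM (- w) sF).
  apply: (@ci_dom _ (M2 * expR (x * 1))); first exact: cmeas_rcont (lint_cont x ltr01 (sym_cpwM (- w) sF)).
  by move=> t; exact: D2.
have key u : cabs u <= 1 -> cabs (iL (fun p => cpw p (- (r + u)) * F p) x - iL (fun p => cpw p (- r) * F p) x - d * u) <= (2 * pi)^-1 * (B * pi) * cabs u ^+ 2.
  move=> u1; rewrite /iL /lint /d.
  have -> : forall a b c d k : C, k * a - k * b - k * c * d = k * (a - b - d * c) by move=> *; ring.
  rewrite -cIB; [|exact: icr|exact: icr].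
  rewrite -cIZ// -cIB; [|by apply: ciB; exact: icr|exact: ciZ].
  rewrite cabsM cabs_2pi -mulrA ler_wpM2l//.
  have -> : B * pi * cabs u ^+ 2 = B * cabs u ^+ 2 * pi by ring.
  apply: cI_dom.
    apply: cmeasB; first by apply: cmeasB; exact: cmeas_rcont (lint_cont x ltr01 (sym_cpwM _ sF)).
    apply: cmeasM; first exact: cmeas_cst.
    by apply: cmeasM; [exact: cmeas_rcont|apply: cmeasN; exact: cmeas_rcont].
  move=> t; rewrite -/(q t).
  have -> : cpw (q t) (- (r + u)) * F (q t) * cexp (x%:C * q t) - cpw (q t) (- r) * F (q t) * cexp (x%:C * q t) -
     u * (c t * - clog (q t)) = c t * (cexp (- u * clog (q t)) - 1 - - u * clog (q t)).
    by rewrite /c /cpw opprD mulrDl cexpD; ring.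
  rewrite cabsM; apply: (@le_trans _ _ (cabs (c t) * (cabs (- u * clog (q t)) ^+ 2 * expR (cabs (clog (q t)))))).
    rewrite ler_wpM2l ?cabs_ge0//; apply: le_trans (cexp_taylor2 _) _.
    rewrite ler_wpM2l ?exprn_ge0 ?cabs_ge0// ler_expR; apply: le_trans (Re_le_cabs _) _.
    by rewrite cabsM cabsN ler_piMl ?cabs_ge0.
  have [h1 h2] := @cabs_clog_le (q t) (lexx _).
  apply: (@le_trans _ _ (cabs (c t) * ((cabs u * ((1 + pi / 2) * cabs (q t))) ^+ 2 * (expR (pi / 2) * cabs (q t))))).
    rewrite ler_wpM2l ?cabs_ge0//; apply: ler_pM; rewrite ?exprn_ge0 ?cabs_ge0 ?expR_ge0//.
    rewrite cabsM cabsN lerXn2r ?nnegrE ?mulr_ge0 ?cabs_ge0 ?addr_ge0//.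
    by rewrite ler_wpM2l ?cabs_ge0.
  have -> : cabs (c t) * ((cabs u * ((1 + pi / 2) * cabs (q t))) ^+ 2 * (expR (pi / 2) * cabs (q t))) =
    (cabs (c t) * cabs (q t) ^+ 3) * ((1 + pi / 2) ^+ 2 * expR (pi / 2) * cabs u ^+ 2) by ring.
  have -> : B * cabs u ^+ 2 * ker t = (K * M * expR x * ker t) * ((1 + pi / 2) ^+ 2 * expR (pi / 2) * cabs u ^+ 2).
    by rewrite /B; ring.
  by rewrite ler_wpM2r ?mulr_ge0 ?exprn_ge0 ?cabs_ge0 ?expR_ge0 ?addr_ge0.
exists d => e e0; set L := (2 * pi)^-1 * (B * pi) in key.
have L0 : 0 <= L by rewrite /L mulr_ge0// mulr_ge0// pi_ge0.
exists (Num.min 1 (e / (L + 1))); first by rewrite lt_min ltr01 divr_gt0// ltr_wpDl.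
move=> u _; rewrite lt_min => /andP[/ltW us ue]; apply: le_trans (key u us) _.
rewrite expr2 mulrA ler_wpM2r ?cabs_ge0//.
apply: (@le_trans _ _ ((L + 1) * cabs u)); first by rewrite ler_wpM2r ?cabs_ge0// lerDl.
by rewrite mulrC -ler_pdivlMr ?ltr_wpDl// ltW.
Qed.

End SymbolOps.

(** * Riemann-Liouville integration *)

Section Reflection.
Variable R : realType.
Local Notation C := (Cplx R).
Local Notation mu := (@lebesgue_measure R).
Implicit Types (f : R -> C) (g : R -> R) (D : set R) (x : R).

(** In J_r the reflected integrand may be singular at an endpoint, so the change of variable is made
    for measurable functions: the image of Lebesgue measure under t -> x - t agrees with it on
    intervals. *)
Lemma R_refl g x : measurable_fun setT g -> mu.-integrable setT (EFin \o (fun t => g (x - t))) ->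
  \int[mu]_t g t = \int[mu]_t g (x - t).
Proof.
move=> mg ig; rewrite /Rintegral; congr fine.
pose phi : R -> measurableTypeR R := fun t => x - t.
have mphi : measurable_fun setT phi.
  by apply: measurable_funB; [exact: measurable_cst|exact: measurable_id].
have := @integral_pushforward _ _ (measurableTypeR R) (measurableTypeR R) R phi mphi mu setT (fun t => (g t)%:E).
rewrite preimage_setT => <-//; last exact/measurable_EFinP.
apply: eq_measure_integral => A mA _.
apply: (@lebesgue_measure_unique R (pushforward mu phi)) => // _ [[a b]] _ <-.
rewrite /pushforward.
transitivity (mu `[x - b, x - a[%classic); last first.
  congr (mu _); apply/seteqP; split => t /=; rewrite !in_itv /= /phi => /andP[h1 h2]; apply/andP; split;
  move: h1 h2; lra.
rewrite !lebesgue_measure_itv /= !lte_fin.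
have -> : (x - b < x - a) = (a < b) by rewrite ltrD2l ltrN2.
by case: ifP => // _; congr (_%:E); ring.
Qed.

Lemma cI_refl f x : cmeas f -> ci (fun t => f (x - t)) -> cI f = cI (fun t => f (x - t)).
Proof.
move=> [m1 m2] [i1 i2]; rewrite /cI /cintegral; congr (_ +i* _).
  exact: (@R_refl (fun t => Re (f t)) x m1 i1).
exact: (@R_refl (fun t => Im (f t)) x m2 i2).
Qed.

Lemma cintegral_cI D f : cintegral D f = cI (fun t => if t \in D then f t else 0).
Proof.
rewrite /cI /cintegral; congr (_ +i* _); rewrite Rintegral_mkcond;
by congr Rintegral; apply/funext => t; rewrite /patch; case: ifP.
Qed.

End Reflection.

(** * Euler's integral along rotated rays, and the nonvanishing of Gamma *)

Section GammaIntegral.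
Variable R : realType.
Local Notation C := (Cplx R).
Implicit Types (z w r p : C) (x s t u e : R) (f g : R -> C).

Lemma ReMC z x : Re (z * x%:C) = Re z * x.
Proof. by rewrite mulrC ReMr mulrC. Qed.

Lemma ImMC z x : Im (z * x%:C) = Im z * x.
Proof. by rewrite mulrC ImMr mulrC. Qed.

Lemma rderiv_cexp_comp g x l : rderiv g x l ->
  rderiv (fun t => cexp (g t)) x (cexp (g x) * l).
Proof. by move=> dg; apply: rderiv_comp_cderiv dg; exact: cderiv_cexp. Qed.

Lemma rderiv_ofreal (h : R -> R) x l : is_derive x 1 h l ->
  rderiv (fun t => (h t)%:C) x l%:C.
Proof. by move=> dh; apply/rderivP; split => //=; exact: is_derive_cst. Qed.

Lemma rderivZ z g x l : rderiv g x l -> rderiv (fun t => z * g t) x (z * l).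
Proof. by move=> dg; exact: (hasdZ z dg). Qed.

Lemma rderivB f g x l m : rderiv f x l -> rderiv g x m ->
  rderiv (fun t => f t - g t) x (l - m).
Proof. by move=> df dg; exact: (hasdB df dg). Qed.

Lemma rcon_at_eps f x :
  (forall e, 0 < e -> exists2 d, 0 < d & forall h, `|h| < d -> cabs (f (x + h) - f x) <= e) ->
  {for x, continuous (fun t => Re (f t))} /\
  {for x, continuous (fun t => Im (f t))}.
Proof.
move=> H; split; apply/cvgrPdist_le => e e0; have [d d0 hd] := H e e0;
  near=> t; rewrite distrC -?ReB -?ImB; have := hd (t - x); rewrite [x + _]addrC subrK => hd'.
- apply: le_trans (Re_le_cabs _) (hd' _); near: t.
  by exists d => //= t; rewrite distrC.
- apply: le_trans (Im_le_cabs _) (hd' _); near: t.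
  by exists d => //= t; rewrite distrC.
Unshelve. all: by end_near. Qed.

(* t^(r-1) e^(-pt) dt in the variable s = ln t *)
Definition mell r p : C := cI (fun s => cexp (r * s%:C - p * (expR s)%:C)).

Lemma cabs_mell r p s :
  cabs (cexp (r * s%:C - p * (expR s)%:C)) = expR (Re r * s - Re p * expR s).
Proof. by rewrite cabs_cexp ReB !ReMC. Qed.

Lemma mell_cont r p : rcont (fun s => cexp (r * s%:C - p * (expR s)%:C)).
Proof.
apply: rcon_global => s; eexists; apply: rderiv_cexp_comp; apply: rderivB.
  by apply: rderivZ; exact: rderiv_real.
by apply: rderivZ; apply: rderiv_ofreal; exact: is_derive_expR.
Qed.

Lemma mell_dom r p : 0 < Re r -> 0 < Re p ->
  exists M, dom M (fun s => cexp (r * s%:C - p * (expR s)%:C)).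
Proof.
move=> r0 p0; have [M HM] := gamma_ker r0 p0; exists M => s.
by rewrite cabs_mell.
Qed.

Lemma cmeas_cpow w : cmeas (fun u => cpow u w).
Proof.
apply: cmeas_exp; apply: cmeasM; first exact: cmeas_cst.
by apply: cmeas_real; exact: measurable_ln.
Qed.

Lemma rderiv_cpow w u : 0 < u -> rderiv (fun u => cpow u w) u (cpow u w * (w * u^-1%:C)).
Proof.
move=> u0; apply: rderiv_cexp_comp; apply: rderivZ; apply: rderiv_ofreal.
exact: is_derive1_ln.
Qed.

Lemma rderiv_expN p u : rderiv (fun u => cexp (- p * u%:C)) u (cexp (- p * u%:C) * (- p * 1)).
Proof. by apply: rderiv_cexp_comp; apply: rderivZ; exact: rderiv_real. Qed.

Lemma rcon_cpow w a b : 0 < a -> rcon a b (fun u => cpow u w).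
Proof.
move=> a0 u /andP[au _]; have u0 : 0 < u by apply: lt_le_trans au.
exact: rderiv_cont (rderiv_cpow w u0).
Qed.

Lemma cpow_exp s w : cpow (expR s) (w - 1) * (expR s)%:C = cexp (w * s%:C).
Proof. by rewrite /cpow expRK -cexp_real -cexpD; congr cexp; ring. Qed.

Lemma mellE r p : 0 < Re r -> 0 < Re p ->
  ci (onpos (fun u => cpow u (r - 1) * cexp (- p * u%:C))) /\
  cI (onpos (fun u => cpow u (r - 1) * cexp (- p * u%:C))) = mell r p.
Proof.
move=> r0 p0; have [M HM] := mell_dom r0 p0.
have E s : cpow (expR s) (r - 1) * cexp (- p * (expR s)%:C) * (expR s)%:C =
    cexp (r * s%:C - p * (expR s)%:C).
  by rewrite mulrAC cpow_exp -cexpD mulNr.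
have [] := @cI_subst_exp R (fun u => cpow u (r - 1) * cexp (- p * u%:C)) M.
- apply: cmeasM; first exact: cmeas_cpow.
  by apply: cmeas_rcont; apply: rcon_global => u; eexists; exact: rderiv_expN.
- move=> a b a0; apply: rconM; first exact: rcon_cpow.
  by apply: rcon_rderiv => u _; exact: rderiv_expN.
- by move=> s; rewrite E; exact: HM.
by move=> h ->; split => //; congr cI; apply/funext => s; exact: E.
Qed.

Lemma Gamma_mell r : 0 < Re r -> Gamma r = mell r 1.
Proof.
move=> r0; have [_ <-] := mellE (p := 1) r0 ltr01.
rewrite /Gamma cintegral_cI; congr cI; apply/funext => u.
have -> : (u \in `]0, +oo[%classic) = (0 < u).
  by apply/idP/idP; rewrite inE /= in_itv /= andbT.
rewrite /onpos; case: ifP => // _.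
have -> : - 1 * u%:C = (- u)%:C :> C by rewrite mulN1r realCN.
by rewrite cexp_real.
Qed.

(* Rotation of the ray of integration. *)
Lemma mell_cpw r p : 0 < Re r -> 0 < Re p ->
  mell r p = cpw p (- r) * Gamma r.
Proof.
move=> r0 p0; rewrite Gamma_mell//.
pose th := Im (clog p); pose L := Re (clog p).
have wE : clog p = L +i* th by apply: cplx_ext.
have thp : `|th| < pi / 2 := Im_clog p.
(* In the variable w = log t, rays are horizontal lines. The line Im w = 0 gives Gamma(r); the line
   Im w = arg p, translated by log |p|, gives p^r times the integral with e^(-pt). *)
pose F w : C := cexp (r * w - cexp w).
have hF w : exists l, cderiv F w l.
  eexists; apply: (@hasd_comp _ _ (@cexp R) (fun w => r * w - cexp w)); first exact: cderiv_cexp.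
  by apply: hasdB; [apply: hasdZ; exact: hasd_id|exact: cderiv_cexp].
have F0 : mell r 1 = cI (fun s => F (s +i* 0)).
  congr cI; apply/funext => s; rewrite /F mul1r -cexp_real.
  by [].
(* As |arg p| < pi/2, Re e^w >= cos |arg p| e^s throughout the strip, which gives a uniform
   majorant. *)
have c0 : 0 < cos `|th| by apply: cos_gt0_pihalf; rewrite thp andbT (lt_le_trans _ (normr_ge0 _))// oppr_lt0 divr_gt0 ?pi_gt0.
have [M HM] := gamma_ker r0 c0.
have M0 : 0 <= M by have := le_trans (expR_ge0 _) (HM 0); rewrite pmulr_lge0 ?ker_gt0.
pose K := expR (`|Im r| * (pi / 2)) * M.
have Fb s t : `|t| <= `|th| -> cabs (F (s +i* t)) <= K * ker s.
  move=> tt; rewrite /F cabs_cexp ReB ReM /=.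
  apply: (@le_trans _ _ (expR (`|Im r| * (pi / 2)) * expR (Re r * s - cos `|th| * expR s))).
    rewrite -expRD ler_expR.
    have h1 : - (Im r * t) <= `|Im r| * (pi / 2).
      apply: le_trans (ler_norm _) _; rewrite normrN normrM ler_wpM2l//.
      exact: le_trans tt (ltW thp).
    have h2 : cos `|th| * expR s <= expR s * cos t.
      rewrite mulrC ler_wpM2l ?expR_ge0//.
      have -> : cos t = cos `|t| by case: (ger0P t) => // _; rewrite cosN.
      apply: le_cos => //; apply: le_trans (ltW thp) _.
      by rewrite ler_pdivrMr// ler_peMr ?pi_ge0// ler1n.
    by move: h1 h2; lra.
  by rewrite /K -mulrA ler_wpM2l ?expR_ge0.
have Fth : cI (fun s => F (s +i* 0)) = cI (fun s => F (s +i* th)).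
  have [th0|th0] := leP 0 th.
    apply: (@shift_hor R F 0 th K) => // s t /andP[t0 tt].
    by apply: Fb; rewrite !ger0_norm.
  apply/esym; apply: (@shift_hor R F th 0 K) => //; first exact: ltW.
  move=> s t /andP[t0 tt]; apply: Fb; rewrite (ltr0_norm th0) ler0_norm//.
  by rewrite lerN2.
have E s : F ((L + 1 * s) +i* th) = cexp (r * clog p) * cexp (r * s%:C - p * (expR s)%:C).
  rewrite /F; have -> : (L + 1 * s) +i* th = clog p + s%:C :> C.
    by rewrite wE; apply: cplx_ext => /=; ring.
  rewrite -cexpD (cexpD (clog p)) clogK// cexp_real; congr cexp; ring.
have [M' HM'] := mell_dom r0 p0.
have := @cI_affine R (fun s => F (s +i* th)) K (cabs (cexp (r * clog p)) * M') L 1 ltr01.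
rewrite mul1r (_ : (fun t => F ((L + 1 * t) +i* th)) = (fun s => cexp (r * clog p) * cexp (r * s%:C - p * (expR s)%:C))); last first.
  by apply/funext => s; exact: E.
move=> h; rewrite F0 Fth h.
- rewrite cIZ; last exact: ci_dom (cmeas_rcont (mell_cont r p)) HM'.
  by rewrite mulrA /cpw -cexpD mulNr addNr cexp0 mul1r.
- by apply: rcon_global => s; have [l hl] := hF (s +i* th); eexists; exact: rderiv_hor hl.
- by move=> s; exact: Fb.
- by move=> s; rewrite cabsM -mulrA ler_wpM2l ?cabs_ge0.
Qed.

(** If Gamma(r) = 0, then by [mell_cpw] the Laplace transform of u^(r-1) vanishes on Re p > 0, and
    Fourier inversion gives a contradiction. Inversion needs a continuous function, and u^(r-1) may
    blow up at 0; multiplied by e^(-u) - e^(-2u) it becomes O(u^(Re r)) there. *)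
Lemma Gamma_neq0 r : 0 < Re r -> Gamma r != 0.
Proof.
move=> r0; apply/eqP => G0; set a := Re r in r0.
pose g p u : C := cpow u (r - 1) * cexp (- p * u%:C).
pose phi u := onpos (g 1) u - onpos (g 2) u.
have two0 : 0 < Re (2 : C) by rewrite -[2 : C]/(2%:R) /= addr_gt0.
have cabs_cpow u : 0 < u -> cabs (cpow u (r - 1)) = u `^ a / u.
  move=> u0; rewrite /cpow cabs_cexp ReMC ReB -/a mulrBl mul1r expRD expRN lnK//.
  by rewrite /powR gt_eqF.
have phi_pos u : 0 < u -> cabs (phi u) = u `^ a / u * (expR (- u) * (1 - expR (- u))).
  move=> u0; rewrite /phi /onpos u0 /g -mulrBr cabsM cabs_cpow//; congr (_ * _).
  have -> : - 1 * u%:C = (- u)%:C by rewrite mulN1r realCN.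
  have -> : - 2 * u%:C = (- u)%:C + (- u)%:C by rewrite realCN; ring.
  have -> : cexp (- u)%:C - cexp ((- u)%:C + (- u)%:C) = (expR (- u) * (1 - expR (- u)))%:C.
    by rewrite cexpD cexp_real -realCM -rmorphB; congr (_%:C); ring.
  rewrite cabs_real ger0_norm//.
  by rewrite mulr_ge0 ?expR_ge0// subr_ge0 -expR0 ler_expR oppr_le0 ltW.
have phi_neg u : u <= 0 -> phi u = 0.
  by move=> u0; rewrite /phi /onpos ltNge u0 /= subrr.
have phi_le u : 0 < u -> cabs (phi u) <= u `^ a * expR (- u).
  move=> u0; rewrite phi_pos// -mulrA ler_wpM2l ?powR_ge0//.
  rewrite mulrCA ler_piMr ?expR_ge0// mulrC ler_pdivrMr// mul1r.
  by have := expR_ge1Dx (- u); lra.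
have cphi : rcont phi.
  move=> a' b' u _; have [u0|u0|->] := ltgtP u 0.
  - apply: (@rderiv_cont R phi u 0); apply: (@hasd_ext R _ (fun=> 0) _ _ _ (- u)).
    + by rewrite oppr_gt0.
    + by rewrite /= phi_neg// ltW.
    + move=> v _ vu; rewrite /= phi_neg//.
      by have := le_trans (ler_norm _) (Re_le_cabs v); rewrite ReD /=; move: vu; lra.
    + exact: hasd_cst.
  - have [l hl] : exists l, rderiv (fun u => g 1 u - g 2 u) u l.
      eexists; apply: rderivB; (apply: rderivM; [exact: rderiv_cpow|exact: rderiv_expN]).
    apply: (@rderiv_cont R phi u l); apply: (@hasd_ext R _ _ _ _ _ u) hl => //.
    + by rewrite /= /phi /onpos u0.
    + move=> v _ vu; rewrite /= /phi /onpos; suff -> : 0 < Re (u%:C + v) by [].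
      by have := le_trans (ler_norm _) (Re_le_cabs (- v)); rewrite ReN cabsN ReD /=; move: vu; lra.
  apply: rcon_at_eps => e e0; exists (e `^ a^-1); first by rewrite powR_gt0.
  move=> h hd; rewrite add0r (phi_neg 0)// subr0.
  have [h0|h0] := leP h 0; first by rewrite phi_neg// cabs0 ltW.
  apply: le_trans (phi_le h h0) _.
  apply: (@le_trans _ _ (h `^ a)).
    by rewrite ler_piMr ?powR_ge0// -expR0 ler_expR oppr_le0 ltW.
  have -> : e = (e `^ a^-1) `^ a by rewrite -powRrM mulVf ?gt_eqF// powRr1// ltW.
  apply: ge0_ler_powR; rewrite ?nnegrE ?powR_ge0 ?(ltW r0) ?(ltW h0)//.
  by move: hd; rewrite gtr0_norm// => /ltW.
have h1 : 0 < 1 / 2 :> R by rewrite divr_gt0.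
have [M1 H1] := gamma_ker r0 h1.
have M10 : 0 <= M1 by have := le_trans (expR_ge0 _) (H1 0); rewrite pmulr_lge0 ?ker_gt0.
have [M2 M20 H2] := growth_ker h1.
have dphi : dom (M1 * M2) phi.
  move=> u; have [u0|u0] := leP u 0.
    by rewrite phi_neg// cabs0 !mulr_ge0 ?ker_ge0.
  apply: le_trans (phi_le u u0) _.
  have -> : u `^ a * expR (- u) = expR (a * ln u - 1 / 2 * expR (ln u)) * expR (- (1 / 2 * u)).
    rewrite lnK// /powR gt_eqF// -!expRD; congr expR; lra.
  have -> : M1 * M2 * ker u = M1 * (M2 * ker u) by ring.
  apply: ler_pM; rewrite ?expR_ge0//; last exact: H2 (ltW u0).
  apply: le_trans (H1 _) _; by rewrite ler_piMr// ker_le1.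
(* The transform of [phi] is a difference of two Laplace transforms, taken at 1 + i w and 2 + i w,
   and each is a multiple of Gamma(r) = 0. *)
have psi0 (w : R) : cI (fun t => phi t * cexp ('i * (- 1 * w * t)%:C)) = 0.
  have q1 : 0 < Re (1 +i* w : C) by exact: ltr01.
  have q2 : 0 < Re (2 +i* w : C) by [].
  have [i1 e1] := mellE r0 q1; have [i2 e2] := mellE r0 q2.
  transitivity (mell r (1 +i* w) - mell r (2 +i* w)); last first.
    by rewrite !mell_cpw// G0 !mulr0 subrr.
  rewrite -e1 -e2 -cIB//; congr cI; apply/funext => t; rewrite /phi /onpos /g.
  case: ifP => _; last by rewrite !subr0 mul0r.
  have E (k : R) : cexp (- (k +i* w) * t%:C) = cexp (- k%:C * t%:C) * cexp ('i * (- 1 * w * t)%:C).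
    rewrite -cexpD; congr cexp.
    by apply: cplx_ext; rewrite ?ReD ?ImD ?ReM ?ImM ?ReN ?ImN /=; ring.
  by rewrite (E 1) (E 2) rmorphD /=; ring.
have [] := @fourier_inversion R phi (M1 * M2) 0 (-1) 1.
- by rewrite sqrrN expr1n.
- exact: cphi.
- exact: dphi.
- by move=> w; rewrite psi0 cabs0 mul0r.
move=> _; rewrite (_ : (fun x => cI _ * _) = (fun _ => 0 * 0)); last first.
  by apply/funext => w; rewrite psi0 !mul0r.
have pn : (2 * pi)%:C != 0 :> C by rewrite -cabs_eq0 cabs_real normr_eq0 gt_eqF// mulr_gt0// pi_gt0.
rewrite cIZ; last first.
  by apply: (@ci_dom _ 0); [exact: cmeas_cst|move=> t; rewrite cabs0 mul0r].
rewrite mul0r => /esym/eqP; rewrite mulf_eq0 (negbTE pn) /= -cabs_eq0 phi_pos//.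
rewrite gt_eqF// mulr_gt0 ?divr_gt0 ?powR_gt0// mulr_gt0 ?expR_gt0//.
Qed.

End GammaIntegral.

(** * The Laplace picture of J_r for Re r > 0 *)

Section RiemannLiouville.
Variable R : realType.
Local Notation C := (Cplx R).
Implicit Types (z w r p : C) (x s t u e : R) (f g : R -> C).

Lemma zext_iL f y : spaceP f -> zext f y = iL (lap f) y.
Proof.
move=> Pf; have [y0|y0] := ltP y 0; last by rewrite zext_ge// iL_lap.
by rewrite zext_lt// iL_neg ?(ltW y0)//; exact: lap_sym.
Qed.

(** After u = x - y and u = e^s, the zero extension of f is replaced by its Bromwich integral.
    Fubini's theorem leaves Euler's integral in s, equal to Gamma(r) p^(-r), and Gamma(r)
    cancels. *)
Lemma J_formula_iL f r x : spaceP f -> 0 < Re r -> 0 <= x ->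
  J_formula r f x = iL (fun p => cpw p (- r) * lap f p) x.
Proof.
move=> Pf r0 x0; have sf := lap_sym Pf; set a := Re r in r0.
have dz := @spaceP_rderiv R f Pf 0%N.
have cz : rcont (zext f) by apply: rcon_global => y; eexists; exact: dz.
have zx : rcont (fun u => zext f (x - u)).
  apply: (@rcont_comp R (zext f) (fun u => x - u) cz) => u.
  by apply: continuousB; [exact: cst_continuous|exact: cvg_id].
have [Mf Mf0 Hf] := spaceP_growth Pf 0 ltr01.
(* Growth of f with rate 1, evaluated at x - u, yields the factor e^(-u): this is the decay at
   infinity, whence the constant 1. *)
have [M HM] := @gamma_ker R a 1 r0 ltr01.
pose h u : C := zext f (x - u) * cpow u (r - 1).
have hE s : h (expR s) * (expR s)%:C = zext f (x - expR s) * cexp (r * s%:C).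
  by rewrite /h -mulrA cpow_exp.
have mh : cmeas h.
  apply: cmeasM; last exact: cmeas_cpow.
  exact: cmeas_rcont zx.
have hb s : cabs (h (expR s) * (expR s)%:C) <= Mf * expR x * M * ker s.
  rewrite hE; have [xs|xs] := ltP (x - expR s) 0.
    rewrite zext_lt// mul0r cabs0; apply: le_trans (mulr_ge0 (mulr_ge0 Mf0 (expR_ge0 x)) (le_trans (expR_ge0 _) (HM s))) _.
    by rewrite !mulrA.
  rewrite cabsM cabs_cexp ReMC -/a.
  apply: (@le_trans _ _ (Mf * expR (1 * (x - expR s)) * expR (a * s))).
    by rewrite ler_wpM2r ?expR_ge0//; exact: Hf.
  have -> : Mf * expR (1 * (x - expR s)) * expR (a * s) = Mf * expR x * expR (a * s - 1 * expR s).
    by rewrite -!mulrA -!expRD; congr (_ * expR _); ring.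
  have -> : Mf * expR x * M * ker s = Mf * expR x * (M * ker s) by ring.
  by rewrite ler_wpM2l// mulr_ge0 ?expR_ge0.
have [] := @cI_subst_exp R h (Mf * expR x * M) mh _ hb.
  move=> a' b' a'0; apply: rconM; last exact: rcon_cpow.
  exact: zx.
move=> ih eh.
have -> : J_formula r f x = (Gamma r)^-1 * cI (onpos h).
  rewrite /J_formula cintegral_cI; congr (_ * _).
  pose k y := onpos h (x - y).
  have kk : (fun t => k (x - t)) = onpos h by apply/funext => t; rewrite /k opprB addrCA subrr addr0.
  have mk : cmeas k.
    have mx : measurable_fun setT (fun y : R => x - y) by apply: measurable_funB; [exact: measurable_cst|exact: measurable_id].
    exact: (cmeas_comp mx (cmeas_onpos mh)).
  have -> : cI (onpos h) = cI k by rewrite -[in LHS]kk; apply/esym/cI_refl; rewrite ?kk.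
  congr cI; apply/funext => y.
  have -> : (y \in `]0, x[%classic) = (0 < y < x) by apply/idP/idP; rewrite inE /= in_itv.
  rewrite /k /onpos subr_gt0 /h opprB addrCA subrr addr0.
  have [yx|yx] := ltP y x; last by rewrite andbF.
  rewrite andbT; have [y0|y0] := ltP 0 y; first by rewrite zext_ge// ltW.
  have [_ Z _] := Pf; have [y1|y1] := ltP y 0; first by rewrite zext_lt// mul0r.
  have -> : y = 0 by apply/le_anti; rewrite y0 y1.
  by rewrite zext_ge// (Z 0%N : f 0 = 0) mul0r.
rewrite eh.
pose q t : C := 1 +i* t.
pose G (z : R * R) : C := lap f (q z.2) * cexp (x%:C * q z.2) * cexp (r * z.1%:C - q z.2 * (expR z.1)%:C).
have q1 t : 0 < Re (q t) := ltr01.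
have [M2 M20 D2] := lint_dom x ltr01 sf.
have qM (F : C -> C) : (forall p, 0 < Re p -> exists l, cderiv F p l) ->
    cmeas (fun z : R * R => F (q z.2)).
  move=> hF; apply: (cmeas_comp (phi := snd) (f := fun t => F (q t))); first exact: measurable_snd.
  apply: cmeas_rcont; apply: rcon_global => t; have [l hl] := hF _ (q1 t).
  by eexists; exact: rderiv_ver hl.
have mG : cmeas G.
  have m2 : cmeas (fun z : R * R => q z.2) by apply: (qM id) => p _; eexists; exact: hasd_id.
  have m1 : measurable_fun setT (fun z : R * R => z.1) by exact: measurable_fst.
  apply: cmeasM; first apply: cmeasM; first by apply: qM; have [] := sf.
    by apply: cmeas_exp; apply: cmeasM => //; exact: cmeas_cst.
  apply: cmeas_exp; apply: cmeasB.
    by apply: cmeasM; [exact: cmeas_cst|exact: cmeas_real].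
  by apply: cmeasM => //; apply: cmeas_real; exact: measurableT_comp (@measurable_expR R) m1.
have GM s t : cabs (G (s, t)) <= M2 * expR x * M * ker s * ker t.
  rewrite /G cabsM cabs_mell.
  have -> : M2 * expR x * M * ker s * ker t = M2 * expR (x * 1) * ker t * (M * ker s) by rewrite mulr1; ring.
  apply: ler_pM; [exact: cabs_ge0|exact: expR_ge0|exact: D2|exact: HM].
have [mW _ E2] := cFubini mG GM.
have mx s : cmeas (fun t => G (s, t)).
  by have := @cmeas_comp R _ _ _ _ G (fun t => (s, t)) (pair1_measurable s) mG.
have iW : ci (fun s => cI (fun t => G (s, t))).
  apply: (@ci_dom _ (M2 * expR x * M * pi)); first exact: mW.
  move=> s; have -> : M2 * expR x * M * pi * ker s = M2 * expR x * M * ker s * pi by ring.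
  by apply: cI_dom; [exact: mx|move=> t; exact: GM].
have E1 : cI (fun s => h (expR s) * (expR s)%:C) = ((2 * pi)^-1)%:C * cI (fun s => cI (fun t => G (s, t))).
  rewrite -(cIZ _ iW); apply: (congr1 (@cI R)); apply/funext => s.
  rewrite hE (zext_iL _ Pf) /iL -[LHS]mulrA; apply: (congr1 (fun z => ((2 * pi)^-1)%:C * z)).
  rewrite [LHS]mulrC /lint.
  have [M3 _ D3] := lint_dom (x - expR s) ltr01 sf.
  rewrite -cIZ; last first.
    apply: (@ci_dom _ (M3 * expR ((x - expR s) * 1))); first exact: cmeas_rcont (lint_cont _ ltr01 sf).
    by move=> t; exact: D3.
  apply: (congr1 (@cI R)); apply/funext => t; rewrite /G /= -/(q t) [LHS]mulrCA -[RHS]mulrA -!cexpD.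
  apply: (congr1 (fun z => lap f (q t) * cexp z)).
  by rewrite rmorphB /=; ring.
have Gn := Gamma_neq0 r0; apply: (mulfI Gn); rewrite (mulVKf Gn).
rewrite E1 E2 /iL /lint [RHS]mulrCA; apply: (congr1 (fun z => ((2 * pi)^-1)%:C * z)).
have sr := sym_cpwM (- r) sf; have [M4 _ D4] := lint_dom x ltr01 sr.
have isr : ci (fun t => cpw (q t) (- r) * lap f (q t) * cexp (x%:C * q t)).
  apply: (@ci_dom _ (M4 * expR (x * 1))) => [|t]; last exact: D4.
  exact: cmeas_rcont (lint_cont x ltr01 sr).
rewrite -(cIZ _ isr).
apply: (congr1 (@cI R)); apply/funext => t.
have -> : cI (fun s => G (s, t)) = lap f (q t) * cexp (x%:C * q t) * mell r (q t).
  have [M3 HM3] := mell_dom r0 (q1 t).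
  by rewrite /mell -(cIZ _ (ci_dom (cmeas_rcont (mell_cont r (q t))) HM3)).
rewrite (mell_cpw r0 (q1 t)); move: (cpw _ _) (lap _ _) (cexp _) (Gamma r) => ? ? ? ?.
ring.
Qed.

End RiemannLiouville.

(** * The operator B *)

Section MittagLefflerIntegral.
Variable R : realType.
Local Notation C := (Cplx R).
Implicit Types (z w r p : C) (x s t u e a A : R) (f g : R -> C).

(** In the variable t = e^s this lets e^(-t) absorb exp(A t^a), since a < 1. Past [s0] the ratio
    e^((1-a)s) is at least (A + 1) / e; before it, K suffices. *)
Lemma young_exp a A e : 0 < a < 1 -> 0 < e -> 0 <= A ->
  exists K, forall s, A * expR (a * s) <= e * expR s + K.
Proof.
move=> /andP[a0 a1] e0 A0; have A1 : 0 < A + 1 by rewrite ltr_wpDl.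
have b0 : 0 < 1 - a by rewrite subr_gt0.
pose s0 := ln ((A + 1) / e) / (1 - a); exists (A * expR (a * s0)) => s.
have [s1|s1] := leP s s0.
  apply: (@le_trans _ _ (A * expR (a * s0))); last by rewrite lerDr mulr_ge0 ?expR_ge0 ?(ltW e0).
  by rewrite ler_wpM2l// ler_expR ler_pM2l.
apply: (@le_trans _ _ (e * expR s)); last by rewrite lerDl mulr_ge0 ?expR_ge0.
have h : (A + 1) / e <= expR ((1 - a) * s).
  rewrite -(@lnK _ ((A + 1) / e)) ?posrE ?divr_gt0// ler_expR [leRHS]mulrC.
  by rewrite -ler_pdivrMr// ltW.
have -> : expR s = expR ((1 - a) * s) * expR (a * s) by rewrite -expRD; congr expR; ring.
rewrite mulrA ler_wpM2r ?expR_ge0//.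
apply: (@le_trans _ _ (e * ((A + 1) / e))); last by rewrite ler_wpM2l ?(ltW e0).
by rewrite mulrCA divff ?gt_eqF// mulr1 lerDl.
Qed.

(** A bound uniform in n, used to dominate the partial sums of the series of L. *)
Lemma cabs_texp n w : cabs (texp n w) <= 2 * expR (2 * cabs w).
Proof.
have h : cabs w ^+ n / (n`!)%:R <= expR (cabs w).
  rewrite ler_pdivrMr ?ltr0n ?fact_gt0// mulrC; exact/expR_ge_pow/cabs_ge0.
have -> : texp n w = cexp w - (cexp w - texp n w) by rewrite opprB addrCA subrr addr0.
have hw : expR `|Re w| <= expR (cabs w) by rewrite ler_expR Re_le_cabs.
have e1 : expR (cabs w) <= expR (2 * cabs w).
  by rewrite ler_expR; have := cabs_ge0 w; lra.
apply: le_trans (cabsB _ _) _; rewrite mulrDl mul1r; apply: lerD.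
  rewrite cabs_cexp; apply: le_trans e1; rewrite ler_expR; apply: le_trans (ler_norm _) (Re_le_cabs _).
apply: le_trans (cexp_taylor n w) _.
have -> : expR (2 * cabs w) = expR (cabs w) * expR (cabs w) by rewrite -expRD; congr expR; ring.
by apply: ler_pM; rewrite ?expR_ge0 ?divr_ge0 ?exprn_ge0 ?cabs_ge0.
Qed.

Lemma texp_lim w : seq_lim (fun n => texp n w) (cexp w).
Proof.
apply: (@seq_lim_bnd R _ _ (fun n => cabs w ^+ n / (n`!)%:R) (expR `|Re w|)).
- by move=> n; rewrite cabs_distC mulrC; exact: cexp_taylor.
- by move=> n; rewrite divr_ge0 ?exprn_ge0 ?cabs_ge0.
move=> e e0; have /cvgrPdist_le/(_ e e0)[N _ HN] := cvg_exp_coeff (cabs w).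
exists N => n /HN; rewrite sub0r normrN /exp_coeff /=.
by rewrite ger0_norm ?divr_ge0 ?exprn_ge0 ?cabs_ge0.
Qed.

(* exp(- t - z t^a) dt in the variable s = ln t *)
Definition Lker a z s : C := cexp (s%:C - (expR s)%:C) * cexp (- z * (expR (a * s))%:C).

Lemma cmeas_aff_exp (r c : C) : cmeas (fun s => cexp (r * s%:C - c * (expR s)%:C)).
Proof. exact: cmeas_rcont (mell_cont r c). Qed.

Lemma cmeas_expa a c : cmeas (fun s : R => c * (expR (a * s))%:C).
Proof.
apply: cmeasM; first exact: cmeas_cst.
apply: cmeas_real; apply: measurableT_comp; first exact: measurable_expR.
by apply: measurable_funM; [exact: measurable_cst|exact: measurable_id].
Qed.

(** Expanding exp(- z t^a) in its Taylor series, the k-th term integrates against e^(-t) to (- z)^k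
    Gamma(a k + 1) / k!. Dominated convergence of the partial sums exchanges sum and integral. *)
Lemma L_int a z : 0 < a < 1 -> L_alpha1 a z = cI (Lker a z).
Proof.
move=> a01; have /andP[a0 a1] := a01.
have h2 : 0 < 1 / 2 :> R by rewrite divr_gt0.
(* The factor 2 is that of exp(2 |w|) in [cabs_texp]. Half of the exponent of e^(-t) is spent on it,
   and the other half stays for integrability. *)
have [K HK] := young_exp a01 h2 (mulr_ge0 (ler0n R 2) (cabs_ge0 z)).
have [M HM] := @gamma_ker R 1 _ ltr01 h2.
pose E s : C := cexp (s%:C - (expR s)%:C).
have mE : cmeas E.
  have := cmeas_aff_exp 1 1; by under eq_fun do rewrite !mul1r.
have aE s : cabs (E s) = expR (s - expR s) by rewrite /E cabs_cexp ReB.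
pose v s : C := - z * (expR (a * s))%:C.
have av s : cabs (v s) = cabs z * expR (a * s) by rewrite cabsM cabsN cabs_real ger0_norm ?expR_ge0.
pose T k s : C := v s ^+ k / (k`!)%:R * E s.
have dT s : expR (2 * cabs (v s)) * expR (s - expR s) <= expR K * M * ker s.
  rewrite -expRD -mulrA.
  apply: (@le_trans _ _ (expR K * expR (1 * s - 1 / 2 * expR s))); last by rewrite ler_wpM2l ?expR_ge0.
  by rewrite -expRD ler_expR av; have := HK s; lra.
have mv : cmeas v by exact: cmeas_expa.
have mT k : cmeas (T k).
  apply: cmeasM => //; rewrite /T; elim: k => [|k ih].
    by under eq_fun do rewrite expr0; exact: cmeas_cst.
  have -> : (fun s => v s ^+ k.+1 / (k.+1`!)%:R : C) = (fun s => (k.+1%:R)^-1 * (v s * (v s ^+ k / (k`!)%:R))).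
    apply/funext => s; rewrite exprS factS natrM invfM; ring.
  by apply: cmeasM; [exact: cmeas_cst|exact: cmeasM].
have iT k : ci (T k).
  apply: (@ci_dom _ (expR K * M)) => // s; rewrite cabsM aE; apply: le_trans (dT s).
  rewrite ler_wpM2r ?expR_ge0//.
  have -> : cabs (v s ^+ k / (k`!)%:R) = cabs (v s) ^+ k / (k`!)%:R.
    rewrite cabsM cabsX cabsV -[k`!%:R](rmorph_nat (real_complex R)) cabs_real ger0_norm//.
  apply: (@le_trans _ _ (expR (cabs (v s)))).
    by rewrite ler_pdivrMr ?ltr0n ?fact_gt0// mulrC; exact/expR_ge_pow/cabs_ge0.
  by rewrite ler_expR; have := cabs_ge0 (v s); lra.
have GT k : (-1) ^+ k * Gamma ((a * k%:R + 1)%:C) / (k`!)%:R * z ^+ k = cI (T k).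
  rewrite Gamma_mell; last by rewrite /= ltr_wpDl// mulr_ge0// ltW.
  rewrite /mell.
  have ik : ci (fun s => cexp ((a * k%:R + 1)%:C * s%:C - 1 * (expR s)%:C)).
    have [|M' HM'] := @mell_dom R ((a * k%:R + 1)%:C) 1 _ ltr01.
      by rewrite /= ltr_wpDl// mulr_ge0// ltW.
    exact: ci_dom (cmeas_aff_exp _ _) HM'.
  transitivity ((-1) ^+ k / (k`!)%:R * z ^+ k * cI (fun s => cexp ((a * k%:R + 1)%:C * s%:C - 1 * (expR s)%:C))).
    by ring.
  rewrite -(cIZ _ ik); apply: (congr1 (@cI R)); apply/funext => s.
  rewrite /T /v exprMn [(- z) ^+ k]exprNn.
  have -> : cexp ((a * k%:R + 1)%:C * s%:C - 1 * (expR s)%:C) = ((expR (a * s))%:C) ^+ k * E s.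
    rewrite -[(expR (a * s))%:C]cexp_real cexpX /E -cexpD; congr cexp.
    by rewrite -mulr_natl !rmorphM !rmorphD !rmorphM rmorph_nat rmorph1; ring.
  by ring.
have St n : series (fun k : nat => (-1) ^+ k * Gamma ((a * k%:R + 1)%:C) / (k`!)%:R * z ^+ k) n =
    cI (fun s => texp n (v s) * E s) /\ ci (fun s => texp n (v s) * E s).
  elim: n => [|n [ih1 ih2]].
    rewrite /series /= big_geq// /texp.
    have -> : (fun s => (\sum_(i < 0) v s ^+ i / (i`!)%:R) * E s) = (fun s => 0 * T 0%N s).
      by apply/funext => s; rewrite big_ord0 !mul0r.
    by split; [rewrite cIZ// mul0r|exact: ciZ].
  have -> : (fun s => texp n.+1 (v s) * E s) = (fun s => texp n (v s) * E s + T n s).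
    by apply/funext => s; rewrite /texp big_ord_recr /= mulrDl.
  split; last exact: ciD.
  by rewrite (cID ih2 (iT n)) -ih1 -GT /series /= big_nat_recr.
rewrite /L_alpha1; apply: cvg_lim; first exact: norm_hausdorff.
apply: seq_lim_cvg.
have -> : series (fun k : nat => (-1) ^+ k * Gamma ((a * k%:R + 1)%:C) / (k`!)%:R * z ^+ k) =
    (fun n => cI (fun s => texp n (v s) * E s)).
  by apply/funext => n; have [] := St n.
apply: (@cI_dct R _ _ (2 * (expR K * M))).
- move=> n; apply: cmeasM => //; rewrite /texp.
  have h k : cmeas (fun s => v s ^+ k / (k`!)%:R : C).
    elim: k => [|k ih]; first by under eq_fun do rewrite expr0; exact: cmeas_cst.
    have -> : (fun s => v s ^+ k.+1 / (k.+1`!)%:R : C) = (fun s => (k.+1%:R)^-1 * (v s * (v s ^+ k / (k`!)%:R))).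
      apply/funext => s; rewrite exprS factS natrM invfM; ring.
    by apply: cmeasM; [exact: cmeas_cst|exact: cmeasM].
  elim: n => [|n ih]; first by under eq_fun do rewrite big_ord0; exact: cmeas_cst.
  by under eq_fun do rewrite big_ord_recr; exact: cmeasD.
- by apply: cmeasM => //; exact: cmeas_exp.
- move=> n s; rewrite cabsM aE.
  apply: (@le_trans _ _ (2 * (expR (2 * cabs (v s)) * expR (s - expR s)))).
    by rewrite mulrA ler_wpM2r ?expR_ge0// cabs_texp.
  by rewrite -mulrA ler_wpM2l.
move=> s; rewrite /Lker -/(E s) -/(v s) [E s * _]mulrC.
under eq_fun do rewrite [_ * E s]mulrC.
rewrite [cexp (v s) * _]mulrC.
exact: seq_limZ (texp_lim (v s)).
Qed.

End MittagLefflerIntegral.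

(** * Rotating the ray arg p = pi into arg p = pi / 2 *)

Section RotatedContour.
Variable R : realType.
Local Notation C := (Cplx R).
Implicit Types (z w r p : C) (x y s t u e a A th : R) (f g : R -> C).

Lemma Lker_dom a z : 0 < a < 1 -> exists M, dom M (Lker a z).
Proof.
move=> a01; have h2 : 0 < 1 / 2 :> R by rewrite divr_gt0.
have [K HK] := young_exp a01 h2 (cabs_ge0 z).
have [M HM] := @gamma_ker R 1 _ ltr01 h2.
exists (expR K * M) => s; rewrite /Lker cabsM !cabs_cexp ReB ReMC ReN /= -expRD -mulrA.
apply: (@le_trans _ _ (expR K * expR (1 * s - 1 / 2 * expR s))); last by rewrite ler_wpM2l ?expR_ge0.
rewrite -expRD ler_expR.
have h : - Re z * expR (a * s) <= cabs z * expR (a * s).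
  by rewrite ler_wpM2r ?expR_ge0// -ReN; apply: le_trans (ler_norm _) _; rewrite -(cabsN z) Re_le_cabs.
by have := HK s; move: h; lra.
Qed.

Lemma ker_scale a s : 0 < a -> a <= 1 -> ker (a * s) <= (a ^+ 2)^-1 * ker s.
Proof.
move=> a0 a1; rewrite /ker /oneDsqr -invfM lef_pV2 ?posrE; last 2 first.
- by rewrite ltr_pwDl ?sqr_ge0.
- by rewrite mulr_gt0 ?exprn_gt0// ltr_pwDl ?sqr_ge0.
by rewrite mulrDr mulr1 exprMn lerD2r exprn_ile1// ltW.
Qed.

(* exp(x p - y p^a) dp in the variable w = log p *)
Definition Fw x y a w : C := cexp (w + x%:C * cexp w - y%:C * cexp (a%:C * w)).

Lemma cabs_Fw x y a s th : cabs (Fw x y a (s +i* th)) =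
  expR (s + x * (expR s * cos th) - y * (expR (a * s) * cos (a * th))).
Proof.
rewrite /Fw cabs_cexp ReB ReD !ReMr; congr expR; congr (_ + _ * _ - _ * _).
by rewrite /cexp ReMr ImMr.
Qed.

(** Two regimes give the uniform decay. Near arg p = pi/2 the factor e^(xp) does not decay but exp(-
    y p^a) does; near arg p = pi the latter may grow, and e^(xp) dominates it because a < 1. *)
Lemma Fw_bound x y a : 0 < a < 1 -> 0 < x -> 0 < y -> exists M, forall s th,
  pi / 2 <= th <= pi -> cabs (Fw x y a (s +i* th)) <= M * ker s.
Proof.
move=> a01 x0 y0; have /andP[a0 a1] := a01; have p0 := pi_gt0 R.
(* The midpoint of pi / 2 and pi / (2 a): beyond pi / 2, so that cos th1 < 0 when th1 < pi, and with
   a th1 < pi / 2. *)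
pose th1 : R := pi * (1 + a) / (4 * a).
have t1 : pi / 2 < th1.
  rewrite /th1 ltr_pdivlMr ?mulr_gt0// ; nra.
have at1 : a * th1 < pi / 2.
  have -> : a * th1 = pi * (1 + a) / 4 by rewrite /th1; field; rewrite gt_eqF.
  by nra.
have c1 : 0 < cos (a * th1).
  by apply: cos_gt0_pihalf; rewrite at1 andbT; nra.
(* [gamma_ker] is applied at a s with exponent 1 / a, and [ker_scale] returns to s. *)
have [M1 H1] : exists M, forall s, expR (s - y * cos (a * th1) * expR (a * s)) <= M * ker s.
  have ia : 0 < a^-1 by rewrite invr_gt0.
  have [M HM] := gamma_ker ia (mulr_gt0 y0 c1); exists (M * (a ^+ 2)^-1) => s.
  have := HM (a * s); rewrite mulKf ?gt_eqF// => h; apply: le_trans h _.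
  have M0 : 0 <= M by have := le_trans (expR_ge0 _) (HM 0); rewrite pmulr_lge0 ?ker_gt0.
  by rewrite -mulrA ler_wpM2l// ker_scale// ltW.
(* If th1 >= pi, the first regime covers all the angles. *)
have [tp|tp] := ltP th1 pi; last first.
  exists M1 => s th /andP[h1 h2]; rewrite cabs_Fw; apply: le_trans (H1 s); rewrite ler_expR.
  have k1 : cos th <= 0.
    by rewrite -(cos_pihalf R); apply: le_cos => //; rewrite divr_ge0 ?ltW.
  have k2 : cos (a * th1) <= cos (a * th).
    by apply: le_cos; [nra|rewrite ler_pM2l//; exact: le_trans tp|nra].
  have k3 : x * (expR s * cos th) <= 0 by rewrite pmulr_rle0// pmulr_rle0 ?expR_gt0.
  have k4 : y * cos (a * th1) * expR (a * s) <= y * (expR (a * s) * cos (a * th)).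
    by rewrite -mulrA ler_pM2l// mulrC ler_wpM2l ?expR_ge0.
  by move: k3 k4; lra.
have c2 : 0 < - cos th1.
  have := @ltr_cos R (pi / 2) th1; rewrite !in_itv /= cos_pihalf oppr_gt0 => ->//.
    by rewrite divr_ge0 ?(ltW p0)//=; lra.
  by rewrite (ltW tp) andbT; lra.
(* Half of the decay rate x (- cos th1) absorbs y e^(as) by [young_exp]; the other half is kept. *)
have e0 : 0 < x * (- cos th1) / 2 by rewrite divr_gt0 ?mulr_gt0.
have [K HK] := young_exp a01 e0 (ltW y0).
have [M2 H2] := gamma_ker ltr01 e0.
have M10 : 0 <= M1 by have := le_trans (expR_ge0 _) (H1 0); rewrite pmulr_lge0 ?ker_gt0.
have M20 : 0 <= M2 by have := le_trans (expR_ge0 _) (H2 0); rewrite pmulr_lge0 ?ker_gt0.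
exists (M1 + expR K * M2) => s th /andP[h1 h2]; rewrite cabs_Fw mulrDl.
have [tt|tt] := leP th th1.
  apply: (@le_trans _ _ (M1 * ker s)); last by rewrite lerDl !mulr_ge0 ?expR_ge0 ?ker_ge0.
  apply: le_trans (H1 s); rewrite ler_expR.
  have k1 : cos th <= 0.
    by rewrite -(cos_pihalf R); apply: le_cos => //; rewrite divr_ge0 ?ltW.
  have k2 : cos (a * th1) <= cos (a * th).
    by apply: le_cos; [nra|rewrite ler_pM2l|nra].
  have k3 : x * (expR s * cos th) <= 0 by rewrite pmulr_rle0// pmulr_rle0 ?expR_gt0.
  have k4 : y * cos (a * th1) * expR (a * s) <= y * (expR (a * s) * cos (a * th)).
    by rewrite -mulrA ler_pM2l// mulrC ler_wpM2l ?expR_ge0.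
  by move: k3 k4; lra.
apply: (@le_trans _ _ (expR K * M2 * ker s)); last by rewrite lerDr mulr_ge0 ?ker_ge0.
rewrite -mulrA; apply: (@le_trans _ _ (expR K * expR (1 * s - x * (- cos th1) / 2 * expR s))).
  rewrite -expRD ler_expR.
  have k1 : cos th <= cos th1 by apply: le_cos; [lra|exact: ltW|].
  have k2 : x * (expR s * cos th) <= x * (expR s * cos th1).
    by rewrite ler_pM2l// ler_pM2l ?expR_gt0.
  have k3 : - (y * (expR (a * s) * cos (a * th))) <= y * expR (a * s).
    by rewrite -mulrN ler_pM2l// -mulrN ler_piMr ?expR_ge0// lerNl cos_geN1.
  by have := HK s; move: k2 k3; lra.
by rewrite ler_wpM2l ?expR_ge0.
Qed.

Lemma Fw_hol x y a : forall w, exists l, cderiv (Fw x y a) w l.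
Proof.
move=> w; eexists; apply: (@hasd_comp _ _ (@cexp R) (fun w => w + x%:C * cexp w - y%:C * cexp (a%:C * w))).
  exact: cderiv_cexp.
apply: hasdB.
  by apply: hasdD; [exact: hasd_id|apply: hasdZ; exact: cderiv_cexp].
apply: hasdZ; apply: (@hasd_comp _ _ (@cexp R) (fun w => a%:C * w)); first exact: cderiv_cexp.
by apply: hasdZ; exact: hasd_id.
Qed.

Lemma cexp_im t : cexp ('i * t%:C) = cos t +i* sin t.
Proof.
have -> : 'i * t%:C = 0 +i* t :> C by apply: cplx_ext => /=; ring.
by rewrite /cexp /= expR0 !mul1r.
Qed.

Lemma cexp_pi : cexp ('i * pi%:C) = -1 :> C.
Proof. by rewrite cexp_im cospi sinpi; apply: cplx_ext; rewrite //= oppr0. Qed.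

Lemma cexp_pihalf : cexp ('i * (pi / 2)%:C) = 'i :> C.
Proof. by rewrite cexp_im cos_pihalf sin_pihalf. Qed.

(* exp(xp - yp^a) at p = it *)
Definition gedge x y a t : C :=
  cexp ('i * (x * t)%:C - y%:C * ((t `^ a)%:C * cexp ('i * (a * (pi / 2))%:C))).

(** With t = x e^s and p = - e^s, the integrand exp(- t - z t^a) dt becomes - x exp(xp - y p^a) dp
    on the ray arg p = pi. After the rotation p = i t, and dp = i dt gives the factor i. *)
Lemma L_alpha1_edge x y a : 0 < a < 1 -> 0 < x -> 0 < y ->
  L_alpha1 a ((x `^ (- a) * y)%:C * cexp ('i * (pi * a)%:C)) =
    - (x%:C * ('i * cI (onpos (gedge x y a)))).
Proof.
move=> a01 x0 y0; have /andP[a0 a1] := a01; have p0 := pi_gt0 R.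
rewrite L_int//; set z : C := _ * cexp _.
have [ML HL] := Lker_dom z a01; have [M HM] := Fw_bound a01 x0 y0.
have pp : pi / 2 <= pi :> R by lra.
have E1 s : Lker a z (ln x + 1 * s) = - x%:C * Fw x y a (s +i* pi).
  rewrite /Lker /Fw.
  have -> : s +i* pi = s%:C + 'i * pi%:C :> C.
    by apply: cplx_ext; rewrite ?ReD ?ImD ?ReMC ?ImMC /=; ring.
  have e1 : cexp (s%:C + 'i * pi%:C) = - (expR s)%:C.
    by rewrite cexpD cexp_pi cexp_real; ring.
  have e2 : - z * (expR (a * (ln x + 1 * s)))%:C = - (y%:C * cexp (a%:C * (s%:C + 'i * pi%:C))).
    have -> : a%:C * (s%:C + 'i * pi%:C) = (a * s)%:C + 'i * (pi * a)%:C :> C.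
      by rewrite !realCM; ring.
    rewrite cexpD cexp_real /z.
    have -> : expR (a * (ln x + 1 * s)) = x `^ a * expR (a * s).
      by rewrite mul1r mulrDr expRD /powR gt_eqF.
    have -> : x `^ (- a) * y = (x `^ a)^-1 * y by rewrite powRN.
    rewrite !realCM.
    have xa : (x `^ a)%:C != 0 :> C by rewrite -cabs_eq0 cabs_real normr_eq0 gt_eqF ?powR_gt0.
    have -> : ((x `^ a)^-1)%:C = ((x `^ a)%:C)^-1 :> C by rewrite realCV.
    move: ((x `^ a)%:C : C) xa (cexp _ : C) => b b0 c.
    by field.
  rewrite -cexpD e2 e1 mul1r expRD lnK// realCD realCM.
  set Y : C := y%:C * _.
  have -> : cexp (s%:C + 'i * pi%:C + x%:C * - (expR s)%:C - Y) = - cexp (s%:C - x%:C * (expR s)%:C - Y).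
    have -> : s%:C + 'i * pi%:C + x%:C * - (expR s)%:C - Y = (s%:C - x%:C * (expR s)%:C - Y) + 'i * pi%:C by ring.
    by rewrite cexpD cexp_pi mulrN1.
  rewrite mulrNN; transitivity (cexp (ln x)%:C * cexp (s%:C - x%:C * (expR s)%:C - Y)).
    by rewrite -cexpD; congr cexp; ring.
  by rewrite cexp_real lnK.
have cL : rcont (Lker a z).
  apply: rcon_global => s; eexists; apply: rderivM; apply: rderiv_cexp_comp.
    by apply: rderivB; [exact: rderiv_real|apply: rderiv_ofreal; exact: is_derive_expR].
  apply: rderivZ; apply: rderiv_ofreal; apply: is_derive1_comp.
have cF th : rcont (fun s => Fw x y a (s +i* th)).
  apply: rcon_global => s; have [l hl] := Fw_hol x y a (s +i* th).
  by eexists; exact: rderiv_hor hl.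
have b1 : pi / 2 <= (pi : R) <= pi by rewrite pp lexx.
have b2 : pi / 2 <= (pi / 2 : R) <= pi by rewrite pp lexx.
have i1 : ci (fun s => Fw x y a (s +i* pi)).
  by apply: (@ci_dom _ M); [exact: cmeas_rcont (cF pi)|move=> s; exact: HM].
have E2 s : gedge x y a (expR s) * (expR s)%:C = - 'i * Fw x y a (s +i* (pi / 2)).
  rewrite /gedge /Fw.
  have -> : s +i* (pi / 2) = s%:C + 'i * (pi / 2)%:C :> C.
    by apply: cplx_ext; rewrite ?ReD ?ImD ?ReMC ?ImMC /=; ring.
  have e1 : cexp (s%:C + 'i * (pi / 2)%:C) = (expR s)%:C * 'i.
    by rewrite cexpD cexp_pihalf cexp_real.
  have -> : cexp (a%:C * (s%:C + 'i * (pi / 2)%:C)) = ((expR s) `^ a)%:C * cexp ('i * (a * (pi / 2))%:C).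
    rewrite -expRM -cexp_real -cexpD; congr cexp; rewrite [s * a]mulrC !realCM; ring.
  rewrite e1; set Y : C := y%:C * _.
  have -> : s%:C + 'i * (pi / 2)%:C + x%:C * ((expR s)%:C * 'i) - Y =
      ('i * (x * expR s)%:C - Y) + s%:C + 'i * (pi / 2)%:C by rewrite realCM; ring.
  move: ('i * (x * expR s)%:C - Y) => X.
  have -> : cexp (X + s%:C + 'i * (pi / 2)%:C) = cexp X * (expR s)%:C * 'i.
    by rewrite 2!cexpD cexp_pihalf cexp_real.
  have ii : 'i * 'i = -1 :> C by rewrite -expr2 sqr_i.
  transitivity (- ('i * 'i) * (cexp X * (expR s)%:C)); last by ring.
  by rewrite ii opprK mul1r.
have dg : dom M (fun s => gedge x y a (expR s) * (expR s)%:C).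
  by move=> s; rewrite E2 cabsM cabsN cabs_i mul1r; exact: HM.
have mg : cmeas (gedge x y a).
  apply: cmeas_exp; apply: cmeasB.
    apply: cmeasM; first exact: cmeas_cst.
    apply: cmeas_real; by apply: measurable_funM; [exact: measurable_cst|exact: measurable_id].
  apply: cmeasM; first exact: cmeas_cst.
  apply: cmeasM; last exact: cmeas_cst.
  by apply: cmeas_real; exact: measurable_powR.
have rg c d : 0 < c -> rcon c d (gedge x y a).
  move=> c0; have dg' t : c <= t <= d -> exists l, rderiv (gedge x y a) t l.
    move=> /andP[ct _]; have t0 : 0 < t by apply: lt_le_trans ct.
    eexists; apply: rderiv_cexp_comp; apply: rderivB.
      apply: rderivZ; apply: rderiv_ofreal; exact: is_derive_mull.
    apply: rderivZ; apply: rderivM; last exact: hasd_cst.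
    apply: rderiv_ofreal; exact: is_derive1_powR.
  by move=> t /dg'[l hl]; exact: rderiv_cont hl.
have [_ ->] := @cI_subst_exp R (gedge x y a) M mg rg dg.
have hs := @shift_hor R (Fw x y a) (pi / 2) pi M pp (fun w _ => Fw_hol x y a w) HM.
have dL : dom (x * M) (fun s => Lker a z (ln x + 1 * s)).
  move=> s; rewrite E1 cabsM cabsN cabs_real gtr0_norm// -mulrA ler_pM2l//; exact: HM.
rewrite (@cI_affine R (Lker a z) ML (x * M) (ln x) 1 ltr01 cL HL dL) mul1r.
rewrite (_ : (fun s => Lker a z (ln x + 1 * s)) = (fun s => - x%:C * Fw x y a (s +i* pi))); last first.
  by apply/funext => s; exact: E1.
rewrite (cIZ _ i1) -hs.
rewrite (_ : (fun s => gedge x y a (expR s) * (expR s)%:C) = (fun s => - 'i * Fw x y a (s +i* (pi / 2)))); last first.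
  by apply/funext => s; exact: E2.
have i2 : ci (fun s => Fw x y a (s +i* (pi / 2))).
  by apply: (@ci_dom _ M); [exact: cmeas_rcont (cF _)|move=> s; exact: HM].
rewrite (cIZ _ i2); move: (cI _) => w.
have ii : 'i * 'i = -1 :> C by rewrite -expr2 sqr_i.
transitivity ((x%:C * w) * ('i * 'i)); last by ring.
by rewrite ii; ring.
Qed.

End RotatedContour.

(** * Conjugation symmetry *)

Section Conj.
Variable R : realType.
Local Notation C := (Cplx R).
Implicit Types (z w p : C) (x y s t a b : R) (f : R -> C).

Definition cj z : C := Re z +i* (- Im z).

Lemma Re_cj z : Re (cj z) = Re z. Proof. by []. Qed.
Lemma Im_cj z : Im (cj z) = - Im z. Proof. by []. Qed.

Lemma cabs_cj z : cabs (cj z) = cabs z.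
Proof.
by apply/eqP; rewrite -(@eqrXn2 _ 2) ?cabs_ge0// !cabs_sqr Re_cj Im_cj sqrrN.
Qed.

Lemma cj_exp z : cj (cexp z) = cexp (cj z).
Proof. by rewrite /cexp /cj /= cosN sinN mulrN. Qed.

Lemma cj_clog z : cj (clog z) = clog (cj z).
Proof. by rewrite /clog /cj cabs_cj /= mulNr atanN. Qed.

Lemma cjB z w : cj (z - w) = cj z - cj w.
Proof. by apply: cplx_ext; rewrite ?(Re_cj, Im_cj, ReB, ImB) //; ring. Qed.

Lemma cjMr x z : cj (x%:C * z) = x%:C * cj z.
Proof. by apply: cplx_ext; rewrite ?(Re_cj, Im_cj, ReMr, ImMr) ?mulrN. Qed.

Lemma cint_cj a b f : rcon a b f -> cint a b (fun t => cj (f t)) = cj (cint a b f).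
Proof.
move=> cf; apply: cplx_ext; first by rewrite Re_cj !cint_Re.
rewrite Im_cj.
transitivity (Im (cint a b (fun t => -1 * f t))).
  by rewrite !cint_Im; apply: eq_Rintegral => t _; rewrite mulN1r ImN.
by rewrite cintZ// mulN1r ImN.
Qed.

Lemma cI_sym f M : rcont f -> dom M f -> (forall t, f (- t) = cj (f t)) ->
  cI f = (2 * Re (cI (onpos f)))%:C.
Proof.
move=> cf df fN; have mf := cmeas_rcont cf.
have l1 := cI_exhaustT mf df.
have ho : dom M (fun t => if 0 <= t then f t else 0).
  move=> t; case: ifP => // _; rewrite cabs0 mulr_ge0 ?ker_ge0//; exact: dom_ge0 df.
have mo : cmeas (fun t => if 0 <= t then f t else 0).
  by apply: cmeas_if; [exact: measurable_ge|exact: mf|exact: cmeas_cst].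
have := cI_exhaustT mo ho.
set w := cI _.
have E1 n : cint (- n%:R) n%:R (fun t => if 0 <= t then f t else 0) = cint 0 n%:R f.
  rewrite /cint; apply: (congr1 (@cI R)); apply/funext => t; rewrite /rest.
  have [t0|t0] := leP 0 t; last by case: ifP.
  by rewrite (le_trans _ t0)// oppr_le0.
(* The closed and the open half-line differ by the null set {0}. *)
have wE : w = cI (onpos f).
  rewrite /w /cI /cintegral; congr (_ +i* _); rewrite /Rintegral; congr fine;
  (apply: ae_eq_integral => //;
    [by apply/measurable_EFinP; have [] := mo|by apply/measurable_EFinP; have [] := cmeas_onpos mf|]);
  (exists [set 0]; split; [exact: measurable_set1|exact: lebesgue_measure_set1|]);
  move=> t /= ht; apply: contrapT => t0; apply: ht => _; rewrite /onpos;
  (have [tp|tp] := ltP 0 t; first by rewrite (ltW tp));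
  (have [tz|tz] := leP 0 t => //; exfalso; apply: t0; apply/eqP; by rewrite eq_le tp tz).
move=> l2; rewrite -wE.
have l3 : seq_lim (fun n => cint (- n%:R) n%:R f) ((2 * Re w)%:C).
  apply: (@seq_lim_bnd R _ _ (fun n => cabs (cint 0 n%:R f - w)) 2).
  - move=> n.
    have -> : cint (- n%:R) n%:R f = cj (cint 0 n%:R f) + cint 0 n%:R f.
      rewrite (@cint_split R (- n%:R) 0 n%:R f)//.
      congr (_ + _); have := @cint_opp R f 0 n%:R cf; rewrite oppr0 => ->.
      rewrite -cint_cj//.
      by apply: cint_eq => t _.
    have -> : cj (cint 0 n%:R f) + cint 0 n%:R f - (2 * Re w)%:C =
        cj (cint 0 n%:R f - w) + (cint 0 n%:R f - w).
      by rewrite cjB; apply: cplx_ext; rewrite ?(ReD, ImD, ReN, ImN) /=; ring.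
    by apply: le_trans (cabsD _ _) _; rewrite cabs_cj; lra.
  - by move=> n; exact: cabs_ge0.
  move=> e e0; have [N HN] := l2 e e0; exists N => n /HN; by rewrite E1.
exact: seq_lim_unique l1 l3.
Qed.

End Conj.

(** * From the imaginary axis to the line Re p = 1 *)

Section VerticalLine.
Variable R : realType.
Local Notation C := (Cplx R).
Implicit Types (z w q p : C) (x y s t a : R) (f : R -> C).

(** The integrand [Fw] without its Jacobian e^w, in the variable p of the right half-plane. *)
Definition hker x y a p : C := cexp (x%:C * p - y%:C * cpw p a%:C).

Lemma hker_hol x y a p : 0 < Re p -> exists l, cderiv (hker x y a) p l.
Proof.
move=> p0; eexists; apply: (@hasd_comp _ _ (@cexp R) (fun p => x%:C * p - y%:C * cpw p a%:C)).
  exact: cderiv_cexp.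
by apply: hasdB; [apply: hasdZ; exact: hasd_id|apply: hasdZ; exact: cderiv_cpw].
Qed.

Lemma powR_exp_ker a c : 0 < a -> 0 < c ->
  exists2 M, 0 <= M & forall t, expR (- (c * `|t| `^ a)) <= M * ker t.
Proof.
(* With a n >= 2 the power (|t|^a)^n dominates t^2 for |t| > 1. *)
move=> a0 c0; pose n := Num.bound (2 / a).
have an : 2 <= a * n%:R.
  have : 2 / a < n%:R by apply: archi_boundP; rewrite divr_ge0// ltW.
  by rewrite ltr_pdivrMr// mulrC => /ltW.
have [M HM] := pow_exp_ker n c0.
have M0 : 0 <= M.
  have := HM 0 (lexx _); move=> h; have : 0 <= M * ker 0 by apply: le_trans h; rewrite mulr_ge0 ?exprn_ge0 ?expR_ge0.
  by rewrite pmulr_lge0 ?ker_gt0.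
exists (2 + M) => [|t]; first by rewrite addr_ge0.
set v := `|t| `^ a; have v0 : 0 <= v by rewrite powR_ge0.
rewrite /ker ler_pdivlMr; last by rewrite /oneDsqr ltr_pwDl ?sqr_ge0.
have h1 : oneDsqr t <= 2 + v ^+ n.
  rewrite /oneDsqr -real_normK ?num_real//; have [t1|t1] := leP `|t| 1.
    have : `|t| ^+ 2 <= 1 by rewrite exprn_ile1.
    by have := exprn_ge0 n v0; lra.
  have : `|t| ^+ 2 <= v ^+ n; last by lra.
  by rewrite -!powR_mulrn ?normr_ge0// /v -powRrM ler_powR// ltW.
apply: (@le_trans _ _ (expR (- (c * v)) * (2 + v ^+ n))); first by rewrite ler_wpM2l ?expR_ge0.
have h2 : expR (- (c * v)) <= 1 by rewrite -expR0 ler_expR oppr_le0 mulr_ge0// ltW.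
have h3 : v ^+ n * expR (- (c * v)) <= M.
  by apply: le_trans (HM v v0) _; rewrite ler_piMr// ker_le1.
by move: h2 h3; lra.
Qed.

Lemma cos_pa a : 0 < a < 1 -> 0 < cos (a * (pi / 2)) :> R.
Proof.
move=> /andP[a0 a1]; have p0 := pi_gt0 R; apply: cos_gt0_pihalf; apply/andP; split; nra.
Qed.

Lemma hker_le x y a p : 0 < a < 1 -> 0 <= y -> 0 < Re p ->
  cabs (hker x y a p) <= expR (x * Re p - y * (cos (a * (pi / 2)) * cabs p `^ a)).
Proof.
move=> a01 y0 p0; rewrite cabs_cexp ReB !ReMr ler_expR lerD2l lerN2 ler_wpM2l//.
exact: Re_cpw_ge.
Qed.

(** The uniformity in s over ]0, 1] permits both the shift of the line and the limit s -> 0. *)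
Lemma hker_dom x y a : 0 < a < 1 -> 0 < x -> 0 < y -> exists M, forall s t,
  0 < s <= 1 -> cabs (hker x y a (s +i* t)) <= M * ker t.
Proof.
move=> a01 x0 y0; have /andP[a0 _] := a01; have c0 := cos_pa a01.
have [M M0 HM] := powR_exp_ker a0 (mulr_gt0 y0 c0).
exists (expR x * M) => s t /andP[s0 s1]; apply: le_trans (hker_le x a01 (ltW y0) _) _ => //=.
rewrite expRD -mulrA; apply: ler_pM; rewrite ?expR_ge0//.
  by rewrite ler_expR ler_piMr// ltW.
apply: le_trans (HM t); rewrite ler_expR lerN2 -mulrA ler_wpM2l ?(ltW y0)// ler_wpM2l ?(ltW c0)//.
apply: ge0_ler_powR; rewrite ?nnegrE ?cabs_ge0 ?(ltW a0)//.
exact: (Im_le_cabs (s +i* t)).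
Qed.

(** With q = p / i, the upper part of the right half-plane lies just below the positive axis. The
    right-hand side is regular across that axis, so it continues log p to the imaginary axis, where
    [clog] itself is not the logarithm. *)
Lemma clog_mulI q : 0 < Re q -> Im q < 0 ->
  clog ('i * q) = clog q + 'i * (pi / 2)%:C.
Proof.
move=> q0 qi; have -> : 'i * q = cexp (clog q + 'i * (pi / 2)%:C).
  by rewrite cexpD clogK// cexp_pihalf mulrC.
rewrite cexpK//.
rewrite ImD ImMC /= mul1r.
have h1 : atan (Im q / Re q) < 0.
  rewrite ltNge; apply/negP => h; move: qi; rewrite ltNge => /negP; apply.
  rewrite -(clogK q0) /cexp /= mulr_ge0 ?expR_ge0//; apply: sin_ge0_pi.
  by have := atan_ltpi2 (Im q / Re q); rewrite h /=; have := pi_gt0 R; lra.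
have := Im_clog q; rewrite /= ltr_norml ltr_norml => /andP[h2 _]; apply/andP.
by move: h1 h2; have := pi_gt0 R; split; lra.
Qed.

(** The line Re p = 1 is moved to Re p = 1 / (n + 1), conjugation symmetry reduces it to Im p > 0,
    and dominated convergence leads to the upper imaginary axis. *)
Lemma hker_line x y a : 0 < a < 1 -> 0 < x -> 0 < y ->
  cI (fun t => hker x y a (1 +i* t)) = (2 * Re (cI (onpos (gedge x y a))))%:C.
Proof.
move=> a01 x0 y0; have /andP[a0 a1] := a01; have [M HM] := hker_dom a01 x0 y0.
have M0 : 0 <= M.
  have h : 0 <= M * ker 0 by apply: le_trans (HM 1 0 _); rewrite ?cabs_ge0// ltr01 lexx.
  by move: h; rewrite pmulr_lge0 ?ker_gt0.
pose sg (n : nat) : R := n.+1%:R^-1.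
have sg0 n : 0 < sg n <= 1 by rewrite invr_gt0 ltr0n /= invf_le1 ?ltr0n// ler1n.
have cs s : 0 < s -> rcont (fun t => hker x y a (s +i* t)).
  move=> s0; apply: rcon_global => t; have [|l hl] := @hker_hol x y a (s +i* t); first by [].
  by eexists; exact: rderiv_ver hl.
have E n : cI (fun t => hker x y a (1 +i* t)) =
    (2 * Re (cI (onpos (fun t => hker x y a (sg n +i* t)))))%:C.
  have /andP[s0 s1] := sg0 n.
  rewrite -(@shift_ver R (hker x y a) (sg n) 1 M s1).
  - apply: (@cI_sym _ _ M); first exact: cs.
      by move=> t; apply: HM.
    move=> t; rewrite /hker cj_exp; congr cexp; rewrite cjB !cjMr; congr (_ * _ - _ * _).
    by rewrite /cpw cj_exp cjMr cj_clog.
  - by move=> p /andP[p0 _]; apply: hker_hol; exact: lt_le_trans p0.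
  - by move=> s t /andP[h1 h2]; apply: HM; rewrite h2 (lt_le_trans s0).
have mg : cmeas (gedge x y a).
  apply: cmeas_exp; apply: cmeasB.
    apply: cmeasM; first exact: cmeas_cst.
    apply: cmeas_real; by apply: measurable_funM; [exact: measurable_cst|exact: measurable_id].
  apply: cmeasM; first exact: cmeas_cst.
  apply: cmeasM; last exact: cmeas_cst.
  by apply: cmeas_real; exact: measurable_powR.
(* The kernel as a function of q = p / i: differentiable at positive reals, where it equals [gedge],
   so pointwise convergence follows from continuity at t. *)
pose G q : C := cexp (x%:C * ('i * q) - y%:C * cexp (a%:C * (clog q + 'i * (pi / 2)%:C))).
have hG t : 0 < t -> exists l, cderiv G t%:C l.
  move=> t0; eexists.
  apply: (@hasd_comp _ _ (@cexp R) (fun q => x%:C * ('i * q) - y%:C * cexp (a%:C * (clog q + 'i * (pi / 2)%:C)))).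
    exact: cderiv_cexp.
  apply: hasdB; first by do 2 apply: hasdZ; exact: hasd_id.
  apply: hasdZ; apply: (@hasd_comp _ _ (@cexp R) (fun q => a%:C * (clog q + 'i * (pi / 2)%:C))).
    exact: cderiv_cexp.
  apply: hasdZ; apply: hasdD; last exact: hasd_cst.
  exact: cderiv_clog.
have lim : seq_lim (fun n => cI (onpos (fun t => hker x y a (sg n +i* t)))) (cI (onpos (gedge x y a))).
  apply: (@cI_dct R _ _ M).
  - move=> n; apply: cmeas_onpos; apply: cmeas_rcont; apply: cs; by have /andP[] := sg0 n.
  - exact: cmeas_onpos.
  - move=> n t; rewrite /onpos; case: ifP => _; first exact: HM.
    by rewrite cabs0 mulr_ge0 ?ker_ge0.
  move=> t; rewrite /onpos; case: ifPn => [t0|_]; last exact: seq_lim_cst.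
  have -> : gedge x y a t = G t%:C.
    have e1 : 'i * (x * t)%:C = x%:C * ('i * t%:C) by rewrite realCM; ring.
    have e2 : clog t%:C = (ln t)%:C.
      by rewrite -{1}(lnK t0) -cexp_real cexpK//= normr0 divr_gt0 ?pi_gt0.
    have e3 : (t `^ a)%:C * cexp ('i * (a * (pi / 2))%:C) = cexp (a%:C * (clog t%:C + 'i * (pi / 2)%:C)).
      have -> : t `^ a = expR (a * ln t) by rewrite /powR gt_eqF.
      rewrite -cexp_real -cexpD e2 mulrDr -realCM; apply: (congr1 (fun z => cexp ((a * ln t)%:C + z))).
      by rewrite realCM; ring.
    by rewrite /gedge /G e1 e3.
  pose v n : C := 'i * (- sg n)%:C.
  have Gn n : hker x y a (sg n +i* t) = G (t%:C + v n).
    have /andP[s0 _] := sg0 n.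
    have Rq : Re (t%:C + v n) = t by rewrite ReD /v ReMC /= mul0r addr0.
    have Iq : Im (t%:C + v n) = - sg n by rewrite ImD /v ImMC /= mul1r add0r.
    have qE : sg n +i* t = 'i * (t%:C + v n).
      by apply: cplx_ext; rewrite ?ReM ?ImM Rq Iq /=; ring.
    by rewrite /hker /G /cpw qE clog_mulI ?Rq ?Iq// oppr_lt0.
  have [l hl] := hG t t0; move=> e e0; have [d d0 hd] := hasd_cont hl e0.
  have [N HN] := nat_lt_bnd (d^-1 + 1); exists N => n /HN Nn; rewrite Gn; apply: hd => //.
  have /andP[s0 _] := sg0 n.
  rewrite /v cabsM cabs_i mul1r cabs_real normrN gtr0_norm// /sg -[ltRHS]invrK ltf_pV2 ?posrE ?invr_gt0 ?ltr0n//.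
  by rewrite -natr1; move: Nn; have := invr_gt0 d; rewrite d0; lra.
have lim2 : seq_lim (fun n => (2 * Re (cI (onpos (fun t => hker x y a (sg n +i* t)))))%:C)
    (2 * Re (cI (onpos (gedge x y a))))%:C.
  move=> e e0; have e2 : 0 < e / 2 by rewrite divr_gt0.
  have [N HN] := lim _ e2; exists N => n /HN h.
  rewrite -rmorphB cabs_real -mulrBr -ReB normrM ger0_norm//.
  have := le_trans (Re_le_cabs _) h; lra.
apply: seq_lim_unique lim2; have -> : (fun n => (2 * Re (cI (onpos (fun t => hker x y a (sg n +i* t)))))%:C) =
    (fun _ => cI (fun t => hker x y a (1 +i* t))) by apply/funext => n; rewrite (E n).
exact: seq_lim_cst.
Qed.

End VerticalLine.

(** * The Laplace picture of B_alpha *)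

Section BFormula.
Variable R : realType.
Local Notation C := (Cplx R).
Local Notation mu := (@lebesgue_measure R).
Implicit Types (z w q p : C) (x y s t a e : R) (f : R -> C).

(** Flatness made quantitative: integrating from 0 the bound on the next derivative gains one factor
    y. *)
Lemma spaceP_pow f N n e : spaceP f -> 0 < e -> exists2 M, 0 <= M &
  forall y, 0 <= y -> cabs (zext (hderiven n f) y) <= M * y ^+ N * expR (e * y).
Proof.
move=> Pf e0; elim: N n => [|N ih] n.
  have [M M0 HM] := spaceP_growth Pf n e0; exists M => // y _.
  by rewrite expr0 mulr1; exact: HM.
have [M M0 HM] := ih n.+1; exists M => // y y0.
have [_ Z _] := Pf.
have := @mvi R (zext (hderiven n f)) (zext (hderiven n.+1 f))
  (fun t => (M * y ^+ N * expR (e * y)) * t) (fun=> M * y ^+ N * expR (e * y)) 0 y y0.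
rewrite (zext_ge _ (lexx _)) Z subr0 mulr0 subr0 exprS => h.
have -> : M * (y * y ^+ N) * expR (e * y) = M * y ^+ N * expR (e * y) * y by ring.
apply: h.
- by move=> t _; exact: spaceP_rderiv.
- by move=> t _; exact: is_derive_mull.
move=> t /andP[t0 ty]; apply: le_trans (HM t t0) _.
apply: ler_pM; rewrite ?mulr_ge0 ?exprn_ge0 ?expR_ge0//.
  by rewrite ler_wpM2l// lerXn2r ?nnegrE.
by rewrite ler_expR ler_pM2l.
Qed.

(** Let Q = |p|^a >= 1. Half of the decay exp(- c y Q), together with the factor y^N from the
    flatness of f, gives O(Q^(-N)), integrable in t as a N >= 2. The other half gives the decay in
    y. *)
Lemma hker_spaceP_dom f x a : spaceP f -> 0 < a < 1 -> exists M, forall t y,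
  cabs (zext f y * hker x y a (1 +i* t)) <= M * ker t * ker y.
Proof.
move=> Pf a01; have /andP[a0 a1] := a01; set c : R := cos (a * (pi / 2)).
have c0 : 0 < c by exact: cos_pa.
pose N := Num.bound (2 / a).
have aN : 2 <= a * N%:R.
  have : 2 / a < N%:R by apply: archi_boundP; rewrite divr_ge0// ltW.
  by rewrite ltr_pdivrMr// mulrC => /ltW.
(* The half kept for y is at most e^(-cy/2) since Q >= 1; growth e^(cy/4) of f leaves e^(-cy/4). *)
have c4 : 0 < c / 4 by rewrite divr_gt0.
have [M M0 HM] := spaceP_pow N 0 Pf c4.
have [M2 M20 H2] := growth_ker c4.
pose K := (N`!)%:R * (2 / c) ^+ N.
have K0 : 0 <= K by rewrite mulr_ge0 ?exprn_ge0 ?divr_ge0// ltW.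
have C0 : 0 <= M * expR x * K * M2 by rewrite mulr_ge0// mulr_ge0// mulr_ge0// expR_ge0.
exists (M * expR x * K * M2) => t y; have [y0|y0] := ltP y 0.
  by rewrite zext_lt// mul0r cabs0 mulr_ge0 ?ker_ge0// mulr_ge0 ?ker_ge0.
have q0 : 0 < Re (1 +i* t : C) by exact: ltr01.
set Q := cabs (1 +i* t : C) `^ a.
have q1 : 1 <= cabs (1 +i* t : C) := cabs_Re_ge (1 +i* t : C).
have Q1 : 1 <= Q.
  have -> : 1 = (1 : R) `^ a by rewrite powR1.
  by apply: ge0_ler_powR; rewrite ?nnegrE ?(ltW a0)// (le_trans _ q1).
have Q0 : 0 < Q by apply: lt_le_trans Q1.
have QN : (Q ^+ N)^-1 <= ker t.
  rewrite /ker lef_pV2 ?posrE ?exprn_gt0//.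
  have -> : oneDsqr t = cabs (1 +i* t : C) ^+ 2 by rewrite cabs_sqr /= expr1n.
  rewrite -!powR_mulrn ?cabs_ge0 ?(ltW Q0)// /Q -powRrM ler_powR//.
rewrite cabsM; have h1 := HM y y0; have h2 := hker_le x a01 y0 q0.
have h3 : y ^+ N * expR (- (y * c * Q / 2)) <= K * ker t.
  have : (y * c * Q / 2) ^+ N <= (N`!)%:R * expR (y * c * Q / 2).
    by apply: expR_ge_pow; rewrite !mulr_ge0// ltW.
  have -> : (y * c * Q / 2) ^+ N = y ^+ N * ((2 / c) ^+ N)^-1 * Q ^+ N.
    rewrite !exprMn !exprVn invfM invrK; ring.
  move=> h; rewrite expRN ler_pdivrMr ?expR_gt0//.
  apply: (@le_trans _ _ (K * (Q ^+ N)^-1 * expR (y * c * Q / 2))); last first.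
    by rewrite ler_wpM2r ?expR_ge0// ler_wpM2l.
  have d0 : 0 < (2 / c) ^+ N by rewrite exprn_gt0// divr_gt0.
  have QQ : 0 < Q ^+ N by rewrite exprn_gt0.
  rewrite /K [leRHS]mulrAC ler_pdivlMr//.
  have -> : (N`!)%:R * (2 / c) ^+ N * expR (y * c * Q / 2) = (N`!)%:R * expR (y * c * Q / 2) * (2 / c) ^+ N by ring.
  by rewrite -ler_pdivrMr// mulrAC.
apply: (@le_trans _ _ (M * y ^+ N * expR (c / 4 * y) * expR (x * 1 - y * (c * Q)))).
  by apply: ler_pM; rewrite ?cabs_ge0.
have -> : M * y ^+ N * expR (c / 4 * y) * expR (x * 1 - y * (c * Q)) =
    M * expR x * (y ^+ N * expR (- (y * c * Q / 2))) * expR (c / 4 * y - y * c * Q / 2).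
  have -> : expR (x * 1 - y * (c * Q)) = expR x * expR (- (y * c * Q / 2)) * expR (- (y * c * Q / 2)).
    by rewrite -!expRD; congr expR; lra.
  by rewrite [expR (c / 4 * y - _)]expRD; ring.
have -> : M * expR x * K * M2 * ker t * ker y = M * expR x * (K * ker t) * (M2 * ker y) by ring.
apply: ler_pM; rewrite ?mulr_ge0 ?exprn_ge0 ?expR_ge0//.
  by rewrite ler_wpM2l ?mulr_ge0 ?expR_ge0.
apply: le_trans (H2 y y0); rewrite ler_expR.
have : y * c <= y * c * Q by rewrite ler_peMr// mulr_ge0// ltW.
have : 0 <= y * c by rewrite mulr_ge0// ltW.
lra.
Qed.

Lemma cmeas_hker f x a : spaceP f ->
  cmeas (fun z : R * R => zext f z.2 * hker x z.2 a (1 +i* z.1)).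
Proof.
move=> Pf.
have m1 : measurable_fun setT (fun z : R * R => z.1) by exact: measurable_fst.
have m2 : measurable_fun setT (fun z : R * R => z.2) by exact: measurable_snd.
have qM (F : C -> C) : (forall p, 0 < Re p -> exists l, cderiv F p l) ->
    cmeas (fun z : R * R => F (1 +i* z.1)).
  move=> hF; apply: (cmeas_comp (phi := fst) (f := fun t => F (1 +i* t))); first exact: measurable_fst.
  apply: cmeas_rcont; apply: rcon_global => t; have [|l hl] := hF (1 +i* t); first exact: ltr01.
  by eexists; exact: rderiv_ver hl.
apply: cmeasM.
  apply: (cmeas_comp (phi := snd) (f := zext f)); first exact: measurable_snd.
  by apply: cmeas_rcont; apply: rcon_global => y; eexists; exact: (@spaceP_rderiv _ f Pf 0%N).
apply: cmeas_exp; apply: cmeasB.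
  apply: cmeasM; first exact: cmeas_cst.
  by apply: (qM id) => p _; eexists; exact: hasd_id.
apply: cmeasM; first exact: cmeas_real.
by apply: (qM (fun p => cpw p a%:C)) => p p0; eexists; exact: cderiv_cpw.
Qed.

(** For y > 0, let w be the integral along the upper imaginary axis: Im L = - x Re w, and the line
    integral is 2 Re w, whence the factor - x / 2. At y = 0, f 0 = 0 makes both sides vanish. *)
Lemma B_integrand_line f x a y : spaceP f -> 0 < a < 1 -> 0 < x ->
  (if y \in `[0, +oo[%classic then B_integrand a f x y else 0) =
  (- (x / 2))%:C * cI (fun t => zext f y * hker x y a (1 +i* t)).
Proof.
move=> Pf a01 x0; have [_ Z _] := Pf.
have -> : (y \in `[0, +oo[%classic) = (0 <= y).
  by apply/idP/idP; rewrite inE /= in_itv /= andbT.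
have i0 : ci (fun _ : R => 0 : C).
  by apply: (@ci_dom _ 0); [exact: cmeas_cst|move=> t; rewrite cabs0 mul0r].
have z0 : cI (fun _ : R => 0 : C) = 0 by have := cIZ 0 i0; rewrite mulr0 mul0r.
have [y0|y0|yE] := ltgtP y 0.
- have -> : (fun t => zext f y * hker x y a (1 +i* t)) = (fun=> 0).
    by apply/funext => t; rewrite zext_lt// mul0r.
  by rewrite z0 mulr0.
- have ih : ci (fun t => hker x y a (1 +i* t)).
    have [M HM] := hker_dom a01 x0 y0; apply: (@ci_dom _ M).
      apply: cmeas_rcont; apply: rcon_global => t.
      have [|l hl] := @hker_hol R x y a (1 +i* t); first exact: ltr01.
      by eexists; exact: rderiv_ver hl.
    by move=> t; apply: HM; rewrite ltr01 lexx.
  rewrite (cIZ _ ih) (hker_line a01 x0 y0) /B_integrand (L_alpha1_edge a01 x0 y0).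
  rewrite zext_ge ?(ltW y0)//; move: (cI _) (f y) => w fy.
  have -> : Im (- (x%:C * ('i * w))) = - (x * Re w).
    by rewrite ImN ImMr ImM /=; ring.
  have -> : - (x * Re w) = - (x / 2) * (2 * Re w) by field.
  by rewrite realCM; ring.
have f0 : f 0 = 0 := Z 0%N.
rewrite yE /B_integrand f0 mulr0.
have -> : (fun t => zext f 0 * hker x 0 a (1 +i* t)) = (fun=> 0).
  by apply/funext => t; rewrite zext_ge// f0 mul0r.
by rewrite z0 mulr0.
Qed.

(** Integrated first over y, f(y) exp(- y p^a) is the Laplace transform of f at p^a: here the
    substitution p -> p^a arises. *)
Lemma hker_fubini f x a : spaceP f -> 0 < a < 1 ->
  ci (fun y => cI (fun t => zext f y * hker x y a (1 +i* t))) /\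
  cI (fun y => cI (fun t => zext f y * hker x y a (1 +i* t))) =
    lint (fun p => lap f (cpw p a%:C)) 1 x.
Proof.
move=> Pf a01; have [M HM] := hker_spaceP_dom x Pf a01.
have mG := cmeas_hker x a Pf; set G := (fun z : R * R => _) in mG.
have [_ mW E] := cFubini mG HM.
have my y : cmeas (fun t => G (t, y)).
  by have := @cmeas_comp R _ _ _ _ G (fun t => (t, y)) (pair2_measurable y) mG.
split.
  apply: (@ci_dom _ (M * pi)); first exact: mW.
  move=> y; have -> : M * pi * ker y = M * ker y * pi by ring.
  apply: cI_dom; first exact: my.
  move=> t; have -> : M * ker y * ker t = M * ker t * ker y by ring.
  exact: HM.
rewrite -[LHS]E /lint; apply: (congr1 (@cI R)); apply/funext => t.
have q0 : 0 < Re (1 +i* t : C) by exact: ltr01.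
have p0 : 0 < Re (cpw (1 +i* t) a%:C).
  have [s' s'0 H] := Re_cpw_lb a01 q0; exact: lt_le_trans s'0 (H _ (lexx _)).
rewrite [RHS]mulrC /lap -(cIZ _ (@lap_ci R f 0 _ Pf p0)); apply: (congr1 (@cI R)); apply/funext => y.
rewrite /G /= /hker cexpD; move: (cpw _ _) => w.
have -> : - (y%:C * w) = - w * y%:C by ring.
by ring.
Qed.

Lemma B_integrand_integrable f x a : spaceP f -> 0 < a < 1 -> 0 < x ->
  cintegrable `[0, +oo[ (B_integrand a f x).
Proof.
move=> Pf a01 x0; have [i1 _] := hker_fubini x Pf a01.
have := ciZ (- (x / 2))%:C i1.
have -> : (fun y => (- (x / 2))%:C * cI (fun t => zext f y * hker x y a (1 +i* t))) =
    (fun y => if y \in `[0, +oo[%classic then B_integrand a f x y else 0).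
  by apply/funext => y; rewrite (B_integrand_line y Pf a01 x0).
move=> [j1 j2]; split.
- have [_ h] := @integrable_mkcond _ _ R mu `[0, +oo[%classic
    (EFin \o (fun y => Re (B_integrand a f x y))) (measurable_itv _).
  apply: h; apply: eq_integrable j1 => // y _; rewrite /= patchE; by case: ifP.
- have [_ h] := @integrable_mkcond _ _ R mu `[0, +oo[%classic
    (EFin \o (fun y => Im (B_integrand a f x y))) (measurable_itv _).
  apply: h; apply: eq_integrable j2 => // y _; rewrite /= patchE; by case: ifP.
Qed.

Lemma B_formula_iL f x a : spaceP f -> 0 < a < 1 -> 0 < x ->
  B_formula a f x = iL (fun p => lap f (cpw p a%:C)) x.
Proof.
move=> Pf a01 x0; have [i1 e1] := hker_fubini x Pf a01.
rewrite /B_formula cintegral_cI /iL -e1.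
rewrite (_ : (fun t => if _ then _ else _) = (fun y => (- (x / 2))%:C * cI (fun t => zext f y * hker x y a (1 +i* t)))); last first.
  by apply/funext => y; rewrite (B_integrand_line y Pf a01 x0).
rewrite (cIZ _ i1) mulrA; apply: (congr1 (fun c => c * _)).
rewrite -realCN -realCM; congr (_%:C).
move: (pi : R) (lt0r_neq0 (pi_gt0 R)) => P P0; field.
by rewrite P0 gt_eqF.
Qed.

End BFormula.

(** * The operators on P and their Laplace transforms *)

Section Operators.
Variable R : realType.
Local Notation C := (Cplx R).
Implicit Types (r p : C) (x a b : R) (f : R -> C).

Lemma J_continuation f x : spaceP f -> 0 <= x ->
  is_J_continuation f x (fun r => iL (fun p => cpw p (- r) * lap f p) x).
Proof.
move=> Pf x0; split; last by move=> r r0; rewrite J_formula_iL.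
by move=> r; apply/derivable_cderivP; apply: iL_entire; exact: lap_sym.
Qed.

Lemma J_iL f r x : spaceP f -> 0 <= x ->
  J r f x = iL (fun p => cpw p (- r) * lap f p) x.
Proof.
move=> Pf x0; rewrite /J; case: ifPn => [r0|_]; first exact: J_formula_iL.
have [eG G1] := J_continuation Pf x0.
have [eF F1] : is_J_continuation f x (xget (fun=> 0) [set F | is_J_continuation f x F]).
  by apply: (@xgetPex _ _ [set F | is_J_continuation f x F]); eexists; exact: J_continuation Pf x0.
rewrite (entire_unique eF eG) // => q q0.
by rewrite F1// G1.
Qed.

Lemma B_iL f a x : spaceP f -> 0 < a < 1 -> 0 <= x ->
  B a f x = iL (fun p => lap f (cpw p a%:C)) x.
Proof.
move=> Pf a01; rewrite le_eqVlt => /predU1P[<-|x0]; last by rewrite /B x0 B_formula_iL.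
rewrite /B ltxx; apply: cvg_lim; first exact: norm_hausdorff.
have sF := sym_cpw a01 (lap_sym Pf).
apply/cvgrPdist_le => /= e e0.
have [eR e0'] := cplx_gt0 e0.
(* The value at 0 is a limit from the right; the Bromwich integral is differentiable, hence
   continuous, at 0. *)
have [d d0 hd] := hasd_cont (iL_rderiv 0 sF) e0'.
near=> t.
have t0 : 0 < t by near: t; exact: nbhs_right_gt.
rewrite B_formula_iL// normE eR lecR cabs_distC.
have := hd t%:C; rewrite /= add0r; apply => //.
rewrite cabs_real gtr0_norm//; near: t; exact: nbhs_right_lt.
Unshelve. all: by end_near. Qed.

Lemma B_spaceP f a : spaceP f -> 0 < a < 1 -> spaceP (B a f).
Proof.
move=> Pf a01; apply: iL_spaceP (sym_cpw a01 (lap_sym Pf)) _ => x.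
exact: B_iL.
Qed.

Lemma J_spaceP f r : spaceP f -> spaceP (J r f).
Proof.
move=> Pf; apply: iL_spaceP (sym_cpwM (- r) (lap_sym Pf)) _ => x.
exact: J_iL.
Qed.

Lemma lap_eq f g p : (forall x, 0 <= x -> f x = g x) -> lap f p = lap g p.
Proof.
move=> fg; apply: (congr1 (@cI R)); apply/funext => y; congr (_ * _).
by have [y0|y0] := ltP y 0; [rewrite !zext_lt|rewrite !zext_ge// fg].
Qed.

Lemma lap_B f a p : spaceP f -> 0 < a < 1 -> 0 < Re p ->
  lap (B a f) p = lap f (cpw p a%:C).
Proof.
move=> Pf a01 p0; rewrite (lap_eq p (fun x => @B_iL f a x Pf a01)).
by rewrite lap_iL//; exact: sym_cpw a01 (lap_sym Pf).
Qed.

Lemma lap_J f r p : spaceP f -> 0 < Re p ->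
  lap (J r f) p = cpw p (- r) * lap f p.
Proof.
move=> Pf p0; rewrite (lap_eq p (fun x => @J_iL f r x Pf)).
by rewrite lap_iL//; exact: sym_cpwM (lap_sym Pf).
Qed.

(** The law of exponents behind both identities, with r = beta in the first and r = - h in the
    second. *)
Lemma cpw_cpw p a r : 0 < a < 1 -> cpw (cpw p a%:C) r = cpw p (r * a%:C).
Proof.
by move=> /andP[a0 a1]; rewrite {1}/cpw clog_cpw_real ?ltW// mulrA.
Qed.

Lemma Re_cpw_gt0 p a : 0 < a < 1 -> 0 < Re p -> 0 < Re (cpw p a%:C).
Proof.
by move=> a01 p0; have [s' s'0 H] := Re_cpw_lb a01 p0; exact: lt_le_trans s'0 (H _ (lexx _)).
Qed.

End Operators.

Theorem mainTheorem4 (R : realType) (alpha beta : R) (h : Cplx R)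
    (halpha : 0 < alpha < 1) (hbeta : 0 < beta < 1) :
  B_acts_in_P alpha /\ J_acts_in_P h /\
  eq_opP (B alpha \o B beta) (B (alpha * beta)) /\
  eq_opP (B alpha \o J h) (J (h * alpha%:C) \o B alpha).
Proof.
have hab : 0 < alpha * beta < 1.
  by move: halpha hbeta => /andP[a0 a1] /andP[b0 b1]; rewrite mulr_gt0//= mulr_ilt1// ltW.
split; [|split; [|split]] => f Pf.
- split; last exact: B_spaceP.
  by move=> x x0; exact: B_integrand_integrable.
- split; last exact: J_spaceP.
  by move=> x x0; eexists; exact: J_continuation Pf x0.
- move=> x x0; rewrite /= (B_iL (B_spaceP Pf hbeta) halpha x0) (B_iL Pf hab x0).
  apply: iL_eq => p p0; rewrite lap_B ?Re_cpw_gt0// cpw_cpw//.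
  by rewrite -rmorphM mulrC.
move=> x x0; rewrite /= (B_iL (J_spaceP h Pf) halpha x0) (J_iL _ (B_spaceP Pf halpha) x0).
apply: iL_eq => p p0; rewrite lap_J ?Re_cpw_gt0// lap_B// cpw_cpw//.
by rewrite mulNr.
Qed.
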